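(* Let $T$ be a Calder\'on--Zygmund operator with an $s$-dimensional CZ kernel $K$ on $\mathbb{R}^d$ (as in the context). Suppose that the only reflectionless measure for $T$ is the zero measure. Let $\mu$ be an $s$-dimensional measure, i.e. $\mu$ is $\Lambda$-nice for some $\Lambda>0$ and $\mathcal{H}^s(\operatorname{supp}(\mu))<\infty$. If $T_\mu$ is bounded in $L^2(\mu)$ (i.e. $\mu$ is $\Lambda$-good for some $\Lambda>0$), then $\mu$ is the zero measure.
   Context: Fix integers $d\ge 2$, $d'\ge1$, reals $s\in(0,d)$, $\alpha\in(0,1]$. Let $\Omega:\mathbb{R}^d\to\mathbb{C}^{d'}$ satisfy $\Omega(\lambda x)=\lambda\Omega(x)$ for all $\lambda\in\mathbb{R}$, $|\Omega(x)|\le1$ and $|\Omega(x)-\Omega(x')|\le|x-x'|^\alpha$ for $x,x'$ on the unit sphere, and $\Omega(-x)=-\Omega(x)$. The $s$-dimensional CZ kernel is $K(x)=\Omega(x)/|x|^{s+1}$ ($x\neq0$), and for $\delta>0$, $K_\delta(x)=\Omega(x)/\max(\delta,|x|)^{s+1}$. A measure is a nonnegative locally finite Borel measure on $\mathbb{R}^d$. For functions $f,g$ (scalar or $\mathbb{C}^{d'}$-valued), $\langle f,g\rangle_\mu=\int f\cdot g\,d\mu$ (no conjugation). $\mathcal{H}^s$ is $s$-dimensional Hausdorff measure. A measure $\mu$ is $\Lambda$-nice if $\mu(B(x,r))\le\Lambda r^s$ for every ball. For such $\mu$ and $f\in L^2(\mu)$, $T_{\mu,\delta}f(x)=\int K_\delta(x-y)f(y)\,d\mu(y)$.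 $\mu$ is $\Lambda$-good if it is $\Lambda$-nice and $\|T_{\mu,\delta}\|_{L^2(\mu)\to L^2(\mu)}\le\Lambda$ for all $\delta>0$; then $\langle T_\mu f,g\rangle_\mu:=\lim_{\delta\to0}\langle T_{\mu,\delta}f,g\rangle_\mu$ exists for all $f,g\in L^2(\mu)$ and defines a bounded operator $T_\mu$ on $L^2(\mu)$ of norm $\le\Lambda$. For a $\Lambda$-good $\mu$ and a compactly supported Lipschitz $\psi$ with $\int\psi\,d\mu=0$, choose a ball $B\supset\operatorname{supp}\psi$, a point $z\in B$, and $\varphi\in L^2(\mu)$ with $\varphi\equiv1$ on $2B$ (the concentric ball of twice the radius) and $0\le\varphi\le1$, and set $\langle T_\mu(1),\psi\rangle_\mu=\langle T_\mu(\varphi),\psi\rangle_\mu+\int\psi(x)\int(1-\varphi(y))[K(x-y)-K(z-y)]\,d\mu(y)\,d\mu(x)$; this is independent of the choices. A measure $\mu$ is reflectionless (for $T$) if it is $\Lambda$-good for some $\Lambda>0$ and $\langle T_\mu(1),\psi\rangle_\mu=0$ for every compactly supported Lipschitz $\psi$ with $\int\psi\,d\mu=0$. *)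

(* Defs.v *)
From HB Require Import structures.
From mathcomp Require Import all_boot all_algebra.
From mathcomp Require Import all_classical all_reals all_analysis.
From mathcomp Require Import complex.
From mathcomp Require Import order.

Set Implicit Arguments.
Unset Strict Implicit.
Unset Printing Implicit Defensive.

Import Order.TTheory GRing.Theory Num.Theory.
Import numFieldNormedType.Exports.

Local Open Scope classical_set_scope.
Local Open Scope ring_scope.
Local Open Scope complex_scope.

Definition enorm (R : realType) (d : nat) (x : 'rV[R]_d) : R :=
  Num.sqrt (\sum_(i < d) (x ord0 i) ^+ 2).

Definition eball (R : realType) (d : nat) (c : 'rV[R]_d) (r : R) : set 'rV[R]_d :=
  [set y | enorm (y - c) < r].

Definition cabs2 (R : realType) (z : R[i]) : R := (complex.Re z) ^+ 2 + (complex.Im z) ^+ 2.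
Definition cabs (R : realType) (z : R[i]) : R := Num.sqrt (cabs2 z).

Definition cvnorm2 (R : realType) (n : nat) (v : 'rV[R[i]]_n) : R :=
  \sum_(j < n) cabs2 (v ord0 j).
Definition cvnorm (R : realType) (n : nat) (v : 'rV[R[i]]_n) : R :=
  Num.sqrt (cvnorm2 v).

Definition open_sets (R : realType) (d : nat) : set (set 'rV[R]_d) :=
  [set A : set 'rV[R]_d | open A].
Arguments open_sets : clear implicits.
Notation Rd R d := (g_sigma_algebraType (open_sets R d)).

(** A measure: a nonnegative (countably additive) Borel measure on R^d.
    Local finiteness is implied by Lambda-niceness, which is required by
    all the notions below. *)
Notation bmeasure R d := {measure set (Rd R d) -> \bar R}.

Definition is_zero_measure (R : realType) (d : nat) (mu : bmeasure R d) : Prop :=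
  forall A : set (Rd R d), measurable A -> mu A = 0%E.

Definition msupp (R : realType) (d : nat) (mu : bmeasure R d) : set 'rV[R]_d :=
  [set x | forall r : R, 0 < r -> (0 < mu (eball x r))%E].

Definition nice (R : realType) (d : nat) (s : R) (Lam : R) (mu : bmeasure R d) : Prop :=
  forall (x : 'rV[R]_d) (r : R), 0 < r -> (mu (eball x r) <= (Lam * r `^ s)%:E)%E.

Definition cint (R : realType) (d : nat) (mu : bmeasure R d) (f : 'rV[R]_d -> R[i]) : R[i] :=
  (Rintegral mu setT (fun x => complex.Re (f x))) +i* (Rintegral mu setT (fun x => complex.Im (f x))).

Definition cvint (R : realType) (d n : nat) (mu : bmeasure R d)
  (F : 'rV[R]_d -> 'rV[R[i]]_n) : 'rV[R[i]]_n :=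
  \row_(j < n) cint mu (fun x => F x ord0 j).

Definition L2 (R : realType) (d : nat) (mu : bmeasure R d) (f : 'rV[R]_d -> R[i]) : Prop :=
  [/\ measurable_fun setT (fun x : Rd R d => complex.Re (f x)),
      measurable_fun setT (fun x : Rd R d => complex.Im (f x)) &
      (\int[mu]_x ((cabs2 (f x))%:E) < +oo)%E].

Definition CZ_Omega (R : realType) (d d' : nat) (alpha : R)
  (Om : 'rV[R]_d -> 'rV[R[i]]_d') : Prop :=
  [/\ (forall (lam : R) (x : 'rV[R]_d), Om (lam *: x) = (lam%:C) *: Om x),
      (forall x, enorm x = 1 -> cvnorm (Om x) <= 1),
      (forall x x', enorm x = 1 -> enorm x' = 1 ->
          cvnorm (Om x - Om x') <= (enorm (x - x')) `^ alpha) &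
      (forall x, Om (- x) = - Om x)].

(** K(x) = Omega(x)/|x|^{s+1} for x <> 0 (value at 0 irrelevant; set to 0). *)
Definition Kern (R : realType) (d d' : nat) (s : R) (Om : 'rV[R]_d -> 'rV[R[i]]_d')
  (x : 'rV[R]_d) : 'rV[R[i]]_d' :=
  if x == 0 then 0 else ((enorm x `^ (s + 1))^-1)%:C *: Om x.

Definition Kdelta (R : realType) (d d' : nat) (s : R) (Om : 'rV[R]_d -> 'rV[R[i]]_d')
  (delta : R) (x : 'rV[R]_d) : 'rV[R[i]]_d' :=
  ((Num.max delta (enorm x) `^ (s + 1))^-1)%:C *: Om x.

Definition Tdelta (R : realType) (d d' : nat) (s : R) (Om : 'rV[R]_d -> 'rV[R[i]]_d')
  (mu : bmeasure R d) (delta : R) (f : 'rV[R]_d -> R[i]) (x : 'rV[R]_d) : 'rV[R[i]]_d' :=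
  cvint mu (fun y => f y *: Kdelta s Om delta (x - y)).

Definition good (R : realType) (d d' : nat) (s : R) (Om : 'rV[R]_d -> 'rV[R[i]]_d')
  (Lam : R) (mu : bmeasure R d) : Prop :=
  nice s Lam mu /\
  forall (delta : R) (f : 'rV[R]_d -> R[i]), 0 < delta -> L2 mu f ->
    (\int[mu]_x ((cvnorm2 (Tdelta s Om mu delta f x))%:E)
       <= (Lam ^+ 2)%:E * \int[mu]_x ((cabs2 (f x))%:E))%E.

(** <T_{mu,delta} f, g>_mu = \int T_{mu,delta} f . g dmu (no conjugation). *)
Definition pairTdelta (R : realType) (d d' : nat) (s : R) (Om : 'rV[R]_d -> 'rV[R[i]]_d')
  (mu : bmeasure R d) (delta : R) (f g : 'rV[R]_d -> R[i]) : 'rV[R[i]]_d' :=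
  cvint mu (fun x => g x *: Tdelta s Om mu delta f x).

Definition pairT_is (R : realType) (d d' : nat) (s : R) (Om : 'rV[R]_d -> 'rV[R[i]]_d')
  (mu : bmeasure R d) (f g : 'rV[R]_d -> R[i]) (L : 'rV[R[i]]_d') : Prop :=
  forall eps : R, 0 < eps -> exists2 eta : R, 0 < eta &
    forall delta : R, 0 < delta -> delta < eta ->
      cvnorm (pairTdelta s Om mu delta f g - L) < eps.

Definition lip_cs (R : realType) (d : nat) (psi : 'rV[R]_d -> R[i]) : Prop :=
  (exists M : R, forall x y, cabs (psi x - psi y) <= M * enorm (x - y)) /\
  (exists (c : 'rV[R]_d) (r : R), forall x, r <= enorm (x - c) -> psi x = 0).

Definition fsupp (R : realType) (d : nat) (psi : 'rV[R]_d -> R[i]) : set 'rV[R]_d :=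
  closure [set x | psi x != 0].

Definition corr_term (R : realType) (d d' : nat) (s : R) (Om : 'rV[R]_d -> 'rV[R[i]]_d')
  (mu : bmeasure R d) (psi : 'rV[R]_d -> R[i]) (phi : 'rV[R]_d -> R) (z : 'rV[R]_d)
  : 'rV[R[i]]_d' :=
  cvint mu (fun x => psi x *:
    cvint mu (fun y => ((1 - phi y)%:C) *: (Kern s Om (x - y) - Kern s Om (z - y)))).

(** mu is reflectionless: Lambda-good for some Lambda > 0, and
    <T_mu(1), psi>_mu = 0 for every compactly supported Lipschitz psi with
    \int psi dmu = 0, where <T_mu(1),psi>_mu is computed (for any admissible
    choice of B = B(c,r), z, phi) as <T_mu phi, psi>_mu + correction. *)
Definition reflectionless (R : realType) (d d' : nat) (s : R)
  (Om : 'rV[R]_d -> 'rV[R[i]]_d') (mu : bmeasure R d) : Prop :=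
  (exists2 Lam : R, 0 < Lam & good s Om Lam mu) /\
  forall psi : 'rV[R]_d -> R[i], lip_cs psi -> cint mu psi = 0 ->
  forall (c : 'rV[R]_d) (r : R) (z : 'rV[R]_d) (phi : 'rV[R]_d -> R),
    0 < r -> fsupp psi `<=` eball c r -> z \in eball c r ->
    L2 mu (fun y => (phi y)%:C) ->
    (forall y, y \in eball c (2 * r) -> phi y = 1) ->
    (forall y, 0 <= phi y <= 1) ->
    exists L : 'rV[R[i]]_d',
      pairT_is s Om mu (fun y => (phi y)%:C) psi L /\
      L + corr_term s Om mu psi phi z = 0.

Definition ediam (R : realType) (d : nat) (U : set 'rV[R]_d) : R :=
  sup [set t | exists x y, U x /\ U y /\ t = enorm (x - y)].

Definition Hdelta (R : realType) (d : nat) (s delta : R) (E : set 'rV[R]_d) : \bar R :=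
  ereal_inf [set (\sum_(0 <= i <oo) ((ediam (U i)) `^ s)%:E)%E
            | U in [set U : nat -> set 'rV[R]_d |
                     E `<=` \bigcup_i U i /\
                     forall i x y, U i x -> U i y -> enorm (x - y) <= delta]].

Definition hausdorff (R : realType) (d : nat) (s : R) (E : set 'rV[R]_d) : \bar R :=
  ereal_sup [set Hdelta s delta E | delta in [set delta : R | 0 < delta]].

(* Main.v *)
(** Suppose [mu] is nonzero and blow it up at a point [x]: let [mu_j] be the image of
    [r_j^(-s) mu] under [y |-> (y - x) / r_j], with [r_j] tending to 0, and let [nu] be a weak
    limit of the [mu_j].  Finiteness of the Hausdorff measure of the support forces positive
    upper density [mu]-almost everywhere, so [x] and [r_j] can be chosen such that [nu] is
    nonzero; it is nice, and good because the [L^2] bounds pass to the limit.  It remains to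
    see that [nu] is reflectionless, which contradicts the hypothesis.

    For a cutoff [chi] equal to 1 near [x], the functional [l h = lim <T_{mu,eps} chi, h>] is
    bounded on [L^2 mu], hence is given by an [L^2] function.  A Vitali covering argument
    shows that almost every [x] is a Lebesgue point in the sense that [|l psi| = o(r^s)]
    uniformly over the [psi] with mean zero and [|psi| <= 1] supported in [B(x, r)].  After
    rescaling, and because the kernel decays fast enough against functions of mean zero,
    [<T_{nu,delta} phi_M, psi> = O(M^(-alpha)) + O_M(delta)] whenever [psi] is Lipschitz with
    [\int psi dnu = 0] and [phi_M] is the cutoff at scale [M]; the error [O_M(delta)] comes
    from the antisymmetry of the kernel.  Letting [delta] tend to 0 and then [M] to infinity
    gives [<T_nu 1, psi> = 0]. *)
Require Import Defs.
From HB Require Import structures.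
From mathcomp Require Import all_boot all_order all_algebra.
From mathcomp Require Import all_classical all_reals all_analysis.
From mathcomp Require Import complex measurable_realfun ring lra.

Set Implicit Arguments.
Unset Strict Implicit.
Unset Printing Implicit Defensive.
Import Order.TTheory GRing.Theory Num.Theory.
Import numFieldNormedType.Exports.
Local Open Scope classical_set_scope.
Local Open Scope ring_scope.

(** * Euclidean topology *)

Lemma exists_natSinv_lt {R : archiRealFieldType} (e : R) : 0 < e ->
  exists n, n.+1%:R^-1 < e.
Proof.
by move=> e0; have [n _ /(_ n (leqnn n))] := near_infty_natSinv_lt (PosNum e0); exists n.
Qed.

Section continuous_real_functions.
Context {R : realType} {T : topologicalType}.
Implicit Types f g : T -> R.

Lemma continuous_funD f g :
  continuous f -> continuous g -> continuous (fun x => f x + g x).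
Proof. by move=> cf cg x; apply: cvgD; [exact: cf|exact: cg]. Qed.

Lemma continuous_funN f : continuous f -> continuous (fun x => - f x).
Proof. by move=> cf x; apply: cvgN; exact: cf. Qed.

Lemma continuous_funM f g :
  continuous f -> continuous g -> continuous (fun x => f x * g x).
Proof. by move=> cf cg x; apply: cvgM; [exact: cf|exact: cg]. Qed.

Lemma continuous_fun_comp f (h : R -> R) : continuous f ->
  (forall x, {for f x, continuous h}) -> continuous (fun x => h (f x)).
Proof. by move=> cf ch x; apply: continuous_comp; [exact: cf|exact: ch]. Qed.

Lemma continuous_fun_norm f : continuous f -> continuous (fun x => `|f x|).
Proof. by move=> cf; apply: continuous_fun_comp => // x; exact: norm_continuous. Qed.

Lemma continuous_fun_max f g :
  continuous f -> continuous g -> continuous (fun x => Num.max (f x) (g x)).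
Proof. by move=> cf cg x; apply: continuous_max; [exact: cf|exact: cg]. Qed.

Lemma continuous_fun_min f g :
  continuous f -> continuous g -> continuous (fun x => Num.min (f x) (g x)).
Proof. by move=> cf cg x; apply: continuous_min; [exact: cf|exact: cg]. Qed.

Lemma continuous_fun_sum (I : Type) (r : seq I) (F : I -> T -> R) :
  (forall i, continuous (F i)) -> continuous (fun x => \sum_(i <- r) F i x).
Proof.
move=> cF; elim: r => [|i r ih].
  by under eq_fun do rewrite big_nil; exact: cst_continuous.
by under eq_fun do rewrite big_cons; exact: continuous_funD.
Qed.

Lemma continuous_fun_powR f a : (forall x, 0 < f x) -> continuous f ->
  continuous (fun x => f x `^ a).
Proof.
move=> f0 cf; under eq_fun => x do rewrite /powR gt_eqF//.
apply: (continuous_fun_comp (f := fun x => a * ln (f x))) => [|x]; last first.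
  exact: continuous_expR.
apply: continuous_funM; first exact: cst_continuous.
by apply: continuous_fun_comp => // x; exact: continuous_ln.
Qed.

End continuous_real_functions.

Section euclid.
Context (R : realType) (d : nat).
Local Notation V := 'rV[R]_d.
Implicit Types x y z : V.

Lemma enorm_ge0 x : 0 <= enorm x.
Proof. exact: sqrtr_ge0. Qed.

Lemma enorm_sqr x : enorm x ^+ 2 = \sum_(i < d) (x ord0 i) ^+ 2.
Proof. by rewrite sqr_sqrtr// sumr_ge0// => i _; rewrite sqr_ge0. Qed.

Lemma enorm0 : enorm (0 : V) = 0.
Proof. by rewrite /enorm big1 ?sqrtr0// => i _; rewrite mxE expr0n. Qed.

Lemma coord_le_enorm x i : `|x ord0 i| <= enorm x.
Proof.
rewrite -sqrtr_sqr ler_wsqrtr// (bigD1 i)//= lerDl sumr_ge0// => j _.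
by rewrite sqr_ge0.
Qed.

Lemma enorm_eq0 x : enorm x = 0 -> x = 0.
Proof.
move=> x0; apply/rowP => i; rewrite mxE; apply/eqP; rewrite -normr_eq0.
by rewrite eq_le normr_ge0 andbT -x0 coord_le_enorm.
Qed.

Lemma enorm_gt0 x : x != 0 -> 0 < enorm x.
Proof.
by move=> x0; rewrite lt_def enorm_ge0 andbT; apply: contra x0 => /eqP/enorm_eq0/eqP.
Qed.

Lemma enormZ a x : enorm (a *: x) = `|a| * enorm x.
Proof.
rewrite /enorm -sqrtr_sqr -sqrtrM ?sqr_ge0// mulr_sumr.
by congr Num.sqrt; apply: eq_bigr => i _; rewrite mxE exprMn.
Qed.

Lemma enormZ_gt0 a x : 0 < a -> enorm (a *: x) = a * enorm x.
Proof. by move=> a0; rewrite enormZ gtr0_norm. Qed.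

Lemma enorm_unit x : x != 0 -> enorm ((enorm x)^-1 *: x) = 1.
Proof.
by move=> /enorm_gt0 x0; rewrite enormZ_gt0 ?invr_gt0// mulVf// gt_eqF.
Qed.

Lemma enormN x : enorm (- x) = enorm x.
Proof. by rewrite -scaleN1r enormZ normrN1 mul1r. Qed.

Lemma enormB x y : enorm (x - y) = enorm (y - x).
Proof. by rewrite -enormN opprB. Qed.

Lemma inner_le_enorm x y :
  \sum_(i < d) x ord0 i * y ord0 i <= enorm x * enorm y.
Proof.
set a := enorm x; set b := enorm y; set xy := \sum_(i < d) _.
have [/eqP a0|a0] := boolP (a == 0).
  by rewrite (enorm_eq0 a0) in xy *; rewrite a0 mul0r /xy big1// => i _; rewrite mxE mul0r.
have [/eqP b0|b0] := boolP (b == 0).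
  by rewrite (enorm_eq0 b0) in xy *; rewrite b0 mulr0 /xy big1// => i _; rewrite mxE mulr0.
have ab_gt0 : 0 < a * b by rewrite mulr_gt0// lt_def ?a0 ?b0 enorm_ge0.
have : 0 <= \sum_(i < d) (b * x ord0 i - a * y ord0 i) ^+ 2.
  by apply: sumr_ge0 => i _; rewrite sqr_ge0.
have -> : \sum_(i < d) (b * x ord0 i - a * y ord0 i) ^+ 2 =
    2 * (a * b) * (a * b - xy).
  under eq_bigr => i _.
    rewrite (_ : _ ^+ 2 = b ^+ 2 * x ord0 i ^+ 2 + a ^+ 2 * y ord0 i ^+ 2
       + (- (2 * (a * b))) * (x ord0 i * y ord0 i)); last by ring.
    over.
  by rewrite !big_split/= -!mulr_sumr -!enorm_sqr -/a -/b -/xy; ring.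
by rewrite pmulr_rge0 ?subr_ge0// mulr_gt0.
Qed.

Lemma ler_enormD x y : enorm (x + y) <= enorm x + enorm y.
Proof.
rewrite -(@ler_pXn2r _ 2)// ?nnegrE ?addr_ge0 ?enorm_ge0// enorm_sqr.
under eq_bigr => i _.
  rewrite mxE (_ : _ ^+ 2 = x ord0 i ^+ 2 + y ord0 i ^+ 2
     + 2 * (x ord0 i * y ord0 i)); last by ring.
  over.
rewrite !big_split/= -!mulr_sumr -!enorm_sqr.
have := inner_le_enorm x y; nra.
Qed.

Lemma enorm_triangle z x y : enorm (x - y) <= enorm (x - z) + enorm (z - y).
Proof. by rewrite -[x - y](subrKA z) ler_enormD. Qed.

Lemma enorm_dist x y : `|enorm x - enorm y| <= enorm (x - y).
Proof.
have := ler_enormD (x - y) y; have := ler_enormD (y - x) x.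
by rewrite !subrK (enormB y x) ler_norml; lra.
Qed.

Lemma enorm_le_sum x : enorm x <= \sum_(i < d) `|x ord0 i|.
Proof.
rewrite -(@ler_pXn2r _ 2)// ?nnegrE ?enorm_ge0 ?sumr_ge0// enorm_sqr.
suff: 0 <= \sum_(i < d) `|x ord0 i| /\
    \sum_(i < d) x ord0 i ^+ 2 <= (\sum_(i < d) `|x ord0 i|) ^+ 2 by case.
elim/big_ind2 : _ => [|b b' a a' [b'0 bb'] [a'0 aa']|i _].
- by rewrite expr0n.
- by rewrite addr_ge0//; split=> //; rewrite sqrrD; nra.
- by rewrite real_normK// num_real.
Qed.

Lemma enorm_lt_coord x (e : R) : 0 < e ->
  (forall i, `|x ord0 i| <= e / d.+1%:R) -> enorm x < e.
Proof.
move=> e0 xe; apply: (le_lt_trans (enorm_le_sum _)).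
apply: (@le_lt_trans _ _ (\sum_(i < d) (e / d.+1%:R))); first exact: ler_sum.
rewrite sumr_const card_ord -[ltLHS]mulr_natr -mulrA.
rewrite -[ltRHS]mulr1 ltr_pM2l// mulrC ltr_pdivrMr// mul1r ltr_nat.
exact: ltnSn.
Qed.

Lemma eballxx x (r : R) : 0 < r -> eball x r x.
Proof. by rewrite /eball/= subrr enorm0. Qed.

Lemma eball_ge x (r : R) y : ~ eball x r y <-> r <= enorm (y - x).
Proof. by rewrite leNgt; split=> [|/negP//] ?; exact/negP. Qed.

Lemma sub_eball x (r t : R) : r <= t -> eball x r `<=` eball x t.
Proof. by move=> rt y /lt_le_trans; apply. Qed.

Lemma nbhs_eballP x (A : set V) :
  nbhs x A <-> exists2 r : R, 0 < r & eball x r `<=` A.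
Proof.
split=> [/nbhs_ballP[e /= e0 eA]|[r r0 rA]].
  exists e => // y xy; apply: eA => //=; split=> // i j; rewrite (ord1 i).
  rewrite /ball/= distrC.
  have := coord_le_enorm (y - x) j; rewrite !mxE => /le_lt_trans; exact.
apply/nbhs_ballP; exists (r / (d.+1)%:R) => /=; first by rewrite divr_gt0.
move=> y [_ xy]; apply: rA; apply: enorm_lt_coord => // i.
by rewrite !mxE distrC ltW//; exact: xy.
Qed.

Lemma nbhs_eball x (r : R) : 0 < r -> nbhs x (eball x r).
Proof. by move=> r0; apply/nbhs_eballP; exists r. Qed.

Lemma nbhs_eball2P (p : V * V) (A : set (V * V)) : nbhs p A ->
  exists2 r : R, 0 < r & eball p.1 r `*` eball p.2 r `<=` A.
Proof.
move=> [[B C] /= [/nbhs_eballP[r r0 rB] /nbhs_eballP[t t0 tC]] BCA].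
exists (Num.min r t); first by rewrite lt_min r0.
move=> [x y] [/= xr yt]; apply: BCA; split=> /=.
  by apply: rB; apply: sub_eball xr; rewrite ge_min lexx.
by apply: tC; apply: sub_eball yt; rewrite ge_min lexx orbT.
Qed.

Lemma open_eball x (r : R) : open (eball x r).
Proof.
rewrite openE => y xy; apply/nbhs_eballP.
exists (r - enorm (y - x)); first by rewrite subr_gt0.
by move=> z; rewrite /eball/= => zy; have := enorm_triangle y z x; lra.
Qed.

Lemma continuous_eballP (f : V -> R) : continuous f <->
  forall x (e : R), 0 < e -> exists2 r : R, 0 < r &
    forall y, enorm (y - x) < r -> `|f y - f x| < e.
Proof.
split=> [cf x e e0|cf x].
  have /cvgrPdist_lt/(_ _ e0)/nbhs_eballP[r r0 rf] := cf x.
  by exists r => // y /rf /=; rewrite distrC.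
apply/(@cvgrPdist_lt _ _ _ _ (nbhs_filter x)) => e e0; apply/nbhs_eballP.
by have [r r0 rf] := cf x e e0; exists r => // y /rf; rewrite distrC.
Qed.

Lemma enorm_continuous : continuous (@enorm R d).
Proof.
apply/continuous_eballP => x e e0; exists e => // y ye.
exact: le_lt_trans (enorm_dist _ _) ye.
Qed.

Lemma enormB_continuous z : continuous (fun x => enorm (x - z)).
Proof.
apply/continuous_eballP => x e e0; exists e => // y ye.
by apply: le_lt_trans (enorm_dist _ _) _; rewrite opprB addrA subrK.
Qed.

Lemma closed_bounded_compact (N : R) (A : set V) : closed A ->
  (forall x, A x -> enorm x <= N) -> compact A.
Proof.
move=> cA AN; apply: bounded_closed_compact => //.
exists N; split; first exact: num_real.
move=> M NM x Ax; apply: le_trans (ltW NM); apply: le_trans (AN x Ax).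
rewrite [leLHS]mx_normrE; apply/bigmax_leP; split; first exact: enorm_ge0.
by move=> [i j] _ /=; rewrite (ord1 i); exact: coord_le_enorm.
Qed.

Definition cball x (r : R) : set V := [set y | enorm (y - x) <= r].

Lemma closed_cball x (r : R) : closed (cball x r).
Proof.
by have := @enormB_continuous x; rewrite continuous_closedP => /(_ _ (@closed_le R r)).
Qed.

Lemma compact_cball (r : R) : compact (cball 0 r).
Proof.
apply: closed_bounded_compact (closed_cball (x := 0) (r := r)) _ => x.
by rewrite /cball/= subr0; exact.
Qed.

Lemma open_superlevel (f : V -> R) (t : R) : continuous f -> open [set x | t < f x].
Proof. by move=> /continuousP/(_ _ (@open_gt R t)). Qed.

Lemma near_unif_cball (F : V * V -> R) x (r e : R) : continuous F -> 0 < e ->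
  \forall x' \near x, forall y, enorm y <= r -> `|F (x', y) - F (x, y)| < e.
Proof.
move=> cF e0; have /compact_near_coveringP cover := compact_cball (r := r).
have {}cover := cover V (nbhs x) (fun x' y => `|F (x', y) - F (x, y)| < e) (nbhs_filter x).
apply: (@filterS _ _ (nbhs_filter x) _ _ _ (cover _)) => [x' xx' y yr|y _].
  by apply: xx'; rewrite /cball/= subr0.
have e20 : 0 < e / 2 by rewrite divr_gt0.
have /cvgrPdist_lt/(_ _ e20)/nbhs_eball2P[t t0 Ft] := cF (x, y).
exists (eball y t, eball x t) => /=; first by split; exact: nbhs_eball.
move=> [y' x'] [/= yy' xx'].
have near_x' : `|F (x, y) - F (x', y')| < e / 2 by apply: (Ft (x', y')).
have near_x : `|F (x, y) - F (x, y')| < e / 2.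
  by apply: (Ft (x, y')); split=> //; exact: eballxx.
move: near_x' near_x; rewrite !ltr_norml; lra.
Qed.

Definition ratvec (q : 'rV[rat]_d) : V := map_mx (@ratr R) q.

Lemma ratvec_dense x (e : R) : 0 < e -> exists q, enorm (x - ratvec q) < e.
Proof.
move=> e0; have /choice[q qx] : forall i, exists q : rat, `|x ord0 i - ratr q| < e / d.+1%:R.
  move=> i; have : 0 < e / d.+1%:R by rewrite divr_gt0.
  move: (e / _) => t t0.
  have [|q] := @rat_in_itvoo R (x ord0 i - t) (x ord0 i + t); first by lra.
  by rewrite in_itv/= => xqt; exists q; rewrite ltr_norml; lra.
by exists (\row_i q i); apply: enorm_lt_coord => // i; rewrite !mxE ltW.
Qed.

End euclid.

(** * Borel sets *)

Section borel.
Context (R : realType) (d : nat).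
Local Notation V := 'rV[R]_d.
Local Notation X := (Rd R d).

Lemma open_measurable_Rd (A : set V) : open A -> measurable (A : set X).
Proof. by move=> oA; apply: sub_sigma_algebra. Qed.

Lemma measurable_eball (x : V) (r : R) : measurable (eball x r : set X).
Proof. by apply: open_measurable_Rd; exact: open_eball. Qed.

Lemma measurable_cball (x : V) (r : R) : measurable (cball x r : set X).
Proof.
rewrite -[cball x r]setCK; apply: measurableC; apply: open_measurable_Rd.
apply: closed_openC; exact: closed_cball.
Qed.

Lemma continuous_measurable_Rd (f : V -> R) :
  continuous f -> measurable_fun setT (f : X -> R).
Proof.
move=> /continuousP cf; apply: (measurability _ (RGenOpens.measurableE R)).
move=> _ [_ [a [b ->] <-]]; rewrite setTI; apply: open_measurable_Rd.
exact/cf/interval_open.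
Qed.

Lemma continuous_measurable_RdRd (f : V -> V) :
  continuous f -> measurable_fun setT (f : X -> X).
Proof.
move=> /continuousP cf.
apply: (@measurability _ _ X X setT f (open_sets R d) erefl).
move=> _ [A oA <-]; rewrite setTI; apply: open_measurable_Rd; exact: cf.
Qed.

Definition rational_ball (qn : 'rV[rat]_d * nat) : set V :=
  eball (ratvec R qn.1) qn.2.+1%:R^-1.

Lemma nbhs_rational_ball (x : V) (A : set V) : nbhs x A ->
  exists qn, rational_ball qn x /\ rational_ball qn `<=` A.
Proof.
move=> /nbhs_eballP[r r0 rA]; have r20 : 0 < r / 2 by rewrite divr_gt0.
have [n nr] := exists_natSinv_lt r20.
have [q xq] := ratvec_dense x (e := n.+1%:R^-1) ltac:(by rewrite invr_gt0).
exists (q, n); split=> // y yq; apply: rA; rewrite /rational_ball /eball/= in yq *.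
move: nr xq yq; move: n.+1%:R^-1 => t.
by have := enorm_triangle (ratvec R q) y x; rewrite (enormB (ratvec R q) x); lra.
Qed.

(* The union is the union of the rational balls contained in some member; picking
   one such member above each of these balls gives a countable subfamily. *)
Lemma lindelof (I : Type) (D : set I) (O : I -> set V) :
  (forall i, D i -> open (O i)) ->
  exists E : nat -> set V,
    (forall n, E n = set0 \/ exists2 i, D i & E n = O i) /\
    \bigcup_(i in D) O i = \bigcup_n E n.
Proof.
move=> oO; pose above qn i := D i /\ rational_ball qn `<=` O i.
pose E n := if unpickle n is Some qn then
    if pselect (exists i, above qn i) is left ex then O (projT1 (cid ex))
    else set0 else set0.
exists E; split.
  move=> n; rewrite /E; case: unpickle => [qn|]; last by left.
  case: pselect => [ex|]; last by left.
  by right; exists (projT1 (cid ex)) => //; case: (cid ex) => i [].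
apply/seteqP; split=> x.
  move=> [i Di Oix].
  have [|qn [xqn qnO]] := @nbhs_rational_ball x (O i).
    by apply: open_nbhs_nbhs; split=> //; exact: oO.
  exists (pickle qn) => //; rewrite /E pickleK.
  case: pselect => [ex|[]]; last by exists i.
  by case: (cid ex) => j [/= _]; apply.
move=> [n _]; rewrite /E; case: unpickle => [qn|//].
by case: pselect => [ex|//]; case: (cid ex) => i [/= Di _] Oi; exists i.
Qed.

Lemma open_prod_measurable (A : set (V * V)) :
  open A -> measurable (A : set (X * X)%type).
Proof.
move=> oA; pose E n : set (X * X) :=
  if (unpickle n : option ('rV[rat]_d * nat * ('rV[rat]_d * nat))) is Some (p, q) then
    if pselect (rational_ball p `*` rational_ball q `<=` A) is left _
    then rational_ball p `*` rational_ball q else set0 else set0.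
rewrite (_ : A = \bigcup_n E n).
  apply: bigcup_measurable => n _; rewrite /E.
  case: unpickle => [[p q]|//] /=; case: pselect => // _.
  by apply: measurableX; exact: measurable_eball.
apply/seteqP; split=> [xy Axy|xy [n _]].
  have [[B C] /= [xB yC] BCA] : nbhs xy A by apply: open_nbhs_nbhs.
  have [p [xp pB]] := nbhs_rational_ball xB.
  have [q [yq qC]] := nbhs_rational_ball yC.
  exists (pickle (p, q)) => //; rewrite /E pickleK.
  by case: pselect => [//|[]] uv [/pB Bu /qC Cv]; exact: BCA.
by rewrite /E; case: unpickle => [[p q]|//] /=; case: pselect => // pqA /pqA.
Qed.

Lemma continuous_prod_measurable (F : V * V -> R) : continuous F ->
  measurable_fun setT (F : X * X -> R).
Proof.
move=> /continuousP cF; apply: (measurability _ (RGenOpens.measurableE R)).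
move=> _ [_ [a [b ->] <-]]; rewrite setTI; apply: open_prod_measurable.
exact/cF/interval_open.
Qed.

End borel.

(** * Real integrals *)

Section measures.
Context {dd : measure_display} {T : measurableType dd} {R : realType}.
Variable mu : {measure set T -> \bar R}.

Lemma measure_nondecreasing_bigcup_le (F : nat -> set T) (c : \bar R) :
  (forall n, measurable (F n)) -> nondecreasing_seq F ->
  (forall n, (mu (F n) <= c)%E) -> (mu (\bigcup_n F n) <= c)%E.
Proof.
move=> mF ndF Fc.
have cvF := nondecreasing_cvg_mu (mu := mu) mF (bigcup_measurable (fun n _ => mF n)) ndF.
rewrite -(cvg_lim _ cvF)//; apply: lime_le; last exact: nearW.
by apply/cvg_ex; eexists; exact: cvF.
Qed.

Lemma measure0_le_natSinv (A : set T) (C : R) :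
  (forall n, (mu A <= (C * n.+1%:R^-1)%:E)%E) -> mu A = 0%E.
Proof.
move=> muA; apply/eqP; rewrite -measure_le0; apply/lee_addgt0Pr => e e0; rewrite add0e.
have C1 : 0 < `|C| + 1 by rewrite ltr_wpDl.
have [n ne] := exists_natSinv_lt (divr_gt0 e0 C1).
apply: (le_trans (muA n)); rewrite lee_fin; apply: (@le_trans _ _ ((`|C| + 1) * n.+1%:R^-1)).
  by rewrite ler_wpM2r ?invr_ge0//; have := ler_norm C; lra.
by rewrite mulrC -ler_pdivlMr// ltW.
Qed.

Lemma ae_exists (A : set T) (P : T -> Prop) : measurable A -> mu A <> 0%E ->
  {ae mu, forall x, P x} -> exists2 x, A x & P x.
Proof.
move=> mA muA aeP; apply: contrapT => noP; apply: muA.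
apply: measure_negligible => //; apply: negligibleS aeP => x Ax Px.
by apply: noP; exists x.
Qed.

End measures.

Section real_integral.
Context {dd : measure_display} {T : measurableType dd} {R : realType}.
Variable mu : {measure set T -> \bar R}.
Implicit Types f g : T -> R.

Definition Rintegrable f : Prop := mu.-integrable setT (EFin \o f).

Lemma Rintegrable_measurable f : Rintegrable f -> measurable_fun setT f.
Proof. by move=> /integrableP[/measurable_EFinP]. Qed.

Lemma le_Rintegrable f g : measurable_fun setT f -> Rintegrable g ->
  (forall x, `|f x| <= g x) -> Rintegrable f.
Proof.
move=> mf ig fg; apply: le_integrable ig => //; first exact/measurable_EFinP.
by move=> x _ /=; rewrite lee_fin (le_trans (fg x))// ler_norm.
Qed.

Lemma Rintegrable0 : Rintegrable (fun=> 0).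
Proof. exact: integrable0. Qed.

Lemma RintegrableD f g :
  Rintegrable f -> Rintegrable g -> Rintegrable (fun x => f x + g x).
Proof. by move=> /(integrableD measurableT)/[apply]. Qed.

Lemma RintegrableB f g :
  Rintegrable f -> Rintegrable g -> Rintegrable (fun x => f x - g x).
Proof. by move=> /(integrableB measurableT)/[apply]. Qed.

Lemma RintegrableZl (k : R) f : Rintegrable f -> Rintegrable (fun x => k * f x).
Proof. by move=> /(integrableZl measurableT k). Qed.

Lemma Rintegrable_norm f : Rintegrable f -> Rintegrable (fun x => `|f x|).
Proof. by move=> /integrable_norm. Qed.

Lemma Rintegrable_sum (I : Type) (s : seq I) (F : I -> T -> R) :
  (forall i, Rintegrable (F i)) -> Rintegrable (fun x => \sum_(i <- s) F i x).
Proof.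
move=> iF; elim: s => [|i s ih].
  by under [X in Rintegrable X]eq_fun do rewrite big_nil; exact: Rintegrable0.
rewrite (_ : (fun x => _) = (fun x => F i x + \sum_(i <- s) F i x)).
  exact: RintegrableD.
by apply/funext => x; rewrite big_cons.
Qed.

Lemma Rintegral_sum (I : Type) (s : seq I) (F : I -> T -> R) :
  (forall i, Rintegrable (F i)) ->
  \int[mu]_x (\sum_(i <- s) F i x) = \sum_(i <- s) \int[mu]_x F i x.
Proof.
move=> iF; elim: s => [|i s ih].
  by under eq_Rintegral do rewrite big_nil; rewrite Rintegral_cst// mul0r big_nil.
under eq_Rintegral do rewrite big_cons.
by rewrite RintegralD ?ih ?big_cons//; [exact: iF|have := Rintegrable_sum s iF].
Qed.

Lemma EFin_Rintegral f : Rintegrable f ->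
  (\int[mu]_x f x)%:E = (\int[mu]_x (f x)%:E)%E.
Proof. by move=> jf; rewrite /Rintegral fineK//; exact: integrable_fin_num. Qed.

Lemma Rintegral_sqr_ge0 f : 0 <= \int[mu]_x (f x ^+ 2).
Proof. by apply: Rintegral_ge0 => x _; exact: sqr_ge0. Qed.

Lemma Rintegrable_ge0_le f (c : R) : measurable_fun setT f -> (forall x, 0 <= f x) ->
  (\int[mu]_x (f x)%:E <= c%:E)%E -> Rintegrable f /\ \int[mu]_x f x <= c.
Proof.
move=> mf f0 fc.
have jf : Rintegrable f.
  apply/integrableP; split; first exact/measurable_EFinP.
  apply: le_lt_trans (ltry c); apply: le_trans fc.
  by under eq_integral do rewrite /= ger0_norm//.
by split=> //; rewrite -lee_fin EFin_Rintegral.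
Qed.

Lemma Rintegrable_norm_le f (c : R) : measurable_fun setT f ->
  (\int[mu]_x (`|f x|)%:E <= c%:E)%E -> Rintegrable f /\ \int[mu]_x `|f x| <= c.
Proof.
move=> mf fc; have mnf : measurable_fun setT (fun x => `|f x|) by exact: measurableT_comp.
have [inf nf] := Rintegrable_ge0_le mnf (fun x => normr_ge0 _) fc.
by split=> //; exact: le_Rintegrable inf _.
Qed.

Lemma Rintegral_le_measure (E : set T) f : measurable E -> (mu E < +oo)%E ->
  measurable_fun setT f -> (forall x, 0 <= f x <= 1) -> (forall x, ~ E x -> f x = 0) ->
  Rintegrable f /\ \int[mu]_x f x <= fine (mu E).
Proof.
move=> mE Ey mf f01 f0; apply: Rintegrable_ge0_le => //; first by move=> x; case/andP: (f01 x).
rewrite fineK ?ge0_fin_numE//.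
apply: (@le_trans _ _ (\int[mu]_x (\1_E x)%:E)%E); last by rewrite integral_indic// setIT.
apply: ge0_le_integral => //.
- by move=> x _; rewrite lee_fin; case/andP: (f01 x).
- exact/measurable_EFinP.
- by apply/measurable_EFinP; exact: measurable_indic.
- move=> x _; rewrite lee_fin indicE; case: (boolP (x \in E)) => Ex.
    by case/andP: (f01 x).
  by rewrite f0//; move/negP: Ex; rewrite inE.
Qed.

Lemma measure_le_Rintegral (E : set T) f : measurable E -> (mu E < +oo)%E ->
  Rintegrable f -> (forall x, 0 <= f x) -> (forall x, E x -> 1 <= f x) ->
  fine (mu E) <= \int[mu]_x f x.
Proof.
move=> mE Ey jf f0 f1; rewrite -lee_fin fineK ?ge0_fin_numE// EFin_Rintegral//.
apply: (@le_trans _ _ (\int[mu]_x (\1_E x)%:E)%E); first by rewrite integral_indic// setIT.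
apply: ge0_le_integral => //.
- by apply/measurable_EFinP; exact: measurable_indic.
- exact/measurable_EFinP/Rintegrable_measurable.
- move=> x _; rewrite lee_fin indicE; case: (boolP (x \in E)) => Ex //=.
  by apply: f1; rewrite inE in Ex.
Qed.

Lemma dominated_cvg_Rintegral (F : nat -> T -> R) f g :
  (forall n, measurable_fun setT (F n)) -> measurable_fun setT f -> Rintegrable g ->
  (forall n x, `|F n x| <= g x) -> (forall x, F n x @[n --> \oo] --> f x) ->
  \int[mu]_x F n x @[n --> \oo] --> \int[mu]_x f x.
Proof.
move=> mF mf ig Fg Ff.
have [|||||if' _ cvF] := @dominated_convergence _ T R mu setT measurableT
    (fun n x => (F n x)%:E) (EFin \o f) (EFin \o g).
- by move=> n; exact/measurable_EFinP.
- exact/measurable_EFinP.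
- by apply: aeW => x _; apply: cvg_EFin; [exact: nearW|exact: Ff].
- exact: ig.
- by apply: aeW => x n _; rewrite lee_fin.
by move: cvF; rewrite -(EFin_Rintegral if') => /fine_cvg.
Qed.

End real_integral.

Section square_integrable.
Context {dd : measure_display} {T : measurableType dd} {R : realType}.
Variable mu : {measure set T -> \bar R}.
Implicit Types f g : T -> R.

Definition square_integrable f : Prop :=
  measurable_fun setT f /\ Rintegrable mu (fun x => f x ^+ 2).

Lemma Rintegrable_mul f g : square_integrable f -> square_integrable g ->
  Rintegrable mu (fun x => f x * g x).
Proof.
move=> [mf if2] [mg ig2]; apply: (le_Rintegrable _ (RintegrableD if2 ig2)).
  exact: measurable_funM.
move=> x; rewrite normrM -(real_normK (num_real (f x))) -(real_normK (num_real (g x))).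
have := normr_ge0 (f x); have := normr_ge0 (g x); have := sqr_ge0 (`|f x| - `|g x|).
by nra.
Qed.

Lemma square_integrableN f : square_integrable f -> square_integrable (fun x => - f x).
Proof.
move=> [mf if2]; split; first exact: measurableT_comp.
by under [X in Rintegrable _ X]eq_fun do rewrite sqrrN.
Qed.

Lemma square_integrableB f g : square_integrable f -> square_integrable g ->
  square_integrable (fun x => f x - g x).
Proof.
move=> Lf Lg; split; first by case: Lf => mf _; case: Lg => mg _; exact: measurable_funB.
have ifg := RintegrableZl 2 (Rintegrable_mul Lf Lg).
have := RintegrableB (RintegrableD Lf.2 Lg.2) ifg.
by congr (Rintegrable mu _); apply/funext => x; ring.
Qed.

Lemma sqr_le_quadratic (a b c : R) :
  (forall t, 0 <= a + 2 * t * b + t ^+ 2 * c) -> b ^+ 2 <= a * c.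
Proof.
move=> pos; pose p := Poly [:: a; 2 * b; c].
have := @deg_le2_poly_ge0 _ p (size_Poly _) _.
rewrite !coefE/= exprMn -mulrA [c * a]mulrC => le4; rewrite -subr_le0.
suff : 2 ^+ 2 * b ^+ 2 - 4 * (a * c) <= 0 by rewrite -natrX; lra.
apply: le4 => t; rewrite horner_Poly/= mul0r add0r.
by have := pos t; congr (0 <= _); ring.
Qed.

Lemma Rintegral_sqrD f g (t : R) : square_integrable f -> square_integrable g ->
  \int[mu]_x ((f x + t * g x) ^+ 2) =
  \int[mu]_x (f x ^+ 2) + 2 * t * \int[mu]_x (f x * g x) + t ^+ 2 * \int[mu]_x (g x ^+ 2).
Proof.
move=> Lf Lg; have ifg := Rintegrable_mul Lf Lg.
have i2fg := RintegrableZl (2 * t) ifg; have it2g := RintegrableZl (t ^+ 2) Lg.2.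
rewrite -(RintegralZl _ measurableT ifg) -(RintegralZl _ measurableT Lg.2).
rewrite -(RintegralD measurableT Lf.2 i2fg) -(RintegralD measurableT (RintegrableD Lf.2 i2fg) it2g).
by apply: eq_Rintegral => x _; ring.
Qed.

Lemma Rintegral_cauchy_schwarz f g : square_integrable f -> square_integrable g ->
  (\int[mu]_x (f x * g x)) ^+ 2 <= \int[mu]_x (f x ^+ 2) * \int[mu]_x (g x ^+ 2).
Proof.
move=> Lf Lg; apply: sqr_le_quadratic => t.
by rewrite -Rintegral_sqrD//; apply: Rintegral_sqr_ge0.
Qed.

End square_integrable.

(* An alias of [mu] that can carry the canonical sigma-finite structure. *)
Definition sigma_finite_alias {dd : measure_display} {T : measurableType dd}
  {R : realType} (mu : {measure set T -> \bar R})
  of sigma_finite setT mu : set T -> \bar R := mu.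

Section fubini_real.
Context {dd : measure_display} {T : measurableType dd} {R : realType}.
Variable mu : {measure set T -> \bar R}.
Hypothesis smu : sigma_finite setT mu.

HB.instance Definition _ := Measure.copy (sigma_finite_alias smu) mu.
HB.instance Definition _ :=
  Measure_isSigmaFinite.Build _ _ _ (sigma_finite_alias smu) smu.

Variables (F : T -> T -> R) (g : T -> R).
Hypothesis mF : measurable_fun setT (fun p : T * T => F p.1 p.2).
Hypothesis iF : forall x, Rintegrable mu (F x).
Hypothesis ig : Rintegrable mu g.
Hypothesis Fg : forall x, \int[mu]_y `|F x y| <= g x.

Let m : {sigma_finite_measure set T -> \bar R} := sigma_finite_alias smu.

Let f (p : T * T) := (F p.1 p.2)%:E.

Let integrable_f : (m \x m)%E.-integrable setT f.
Proof.
have mf : measurable_fun setT f by exact/measurable_EFinP.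
apply/(integrable12ltyP m m mf).
have /integrableP[mg /(le_lt_trans _)] := ig; apply.
apply: ge0_le_integral => //.
- by move=> x _; apply: integral_ge0.
- apply: (measurable_fun_fubini_tonelli_F (abse \o f)) => //.
  exact: measurableT_comp.
- by move=> p; exact: abse_ge0.
- exact: measurableT_comp.
- move=> x _ /=; apply: (@le_trans _ _ (g x)%:E); last by rewrite lee_fin ler_norm.
  apply: (@le_trans _ _ (\int[mu]_y `|F x y|)%:E); last by rewrite lee_fin.
  by rewrite EFin_Rintegral//; exact: Rintegrable_norm.
Qed.

Lemma Rintegrable_Rintegral : Rintegrable mu (fun x => \int[mu]_y F x y).
Proof.
have := integrable_fubini_F integrable_f; rewrite /Rintegrable.
rewrite (_ : _ \o _ = fubini_F m f)//.
by apply/funext => x /=; rewrite EFin_Rintegral.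
Qed.

Lemma Rintegral_fubini : (forall y, Rintegrable mu (F^~ y)) ->
  \int[mu]_x (\int[mu]_y F x y) = \int[mu]_y (\int[mu]_x F x y).
Proof.
move=> iF'; have := Fubini integrable_f; rewrite /Rintegral => swap.
congr fine; transitivity (\int[m]_x \int[m]_y f (x, y))%E.
  by apply: eq_integral => x _; rewrite -EFin_Rintegral.
by rewrite swap; apply: eq_integral => y _; rewrite -EFin_Rintegral//; exact: iF'.
Qed.

End fubini_real.

Section continuity_under_integral.
Context {dd : measure_display} {T : measurableType dd} {R : realType} (d : nat).
Variable mu : {measure set T -> \bar R}.
Local Notation V := 'rV[R]_d.

Lemma continuous_Rintegral (F : V -> T -> R) (g : V -> T -> R) :
  (forall x, measurable_fun setT (F x)) -> (forall x, Rintegrable mu (g x)) ->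
  (forall y, continuous (F^~ y)) ->
  (forall x x' y, enorm (x' - x) < 1 -> `|F x' y| <= g x y) ->
  continuous (fun x => \int[mu]_y F x y).
Proof.
move=> mF ig cF Fg; apply/continuous_eballP => x e e0; apply: contrapT => noball.
have /choice[u ux] : forall n, exists x', enorm (x' - x) < n.+1%:R^-1 /\
    e <= `|\int[mu]_y F x' y - \int[mu]_y F x y|.
  move=> n; apply: contrapT => /forallNP far; apply: noball.
  exists n.+1%:R^-1 => [|x' xx']; first by rewrite invr_gt0.
  by rewrite ltNge; apply/negP => ?; exact: (far x').
have uF y : F (u n) y @[n --> \oo] --> F x y.
  apply/cvgrPdist_lt => t t0; have /continuous_eballP/(_ x t t0)[r r0 rF] := @cF y.
  near=> n; rewrite distrC; apply: rF; apply: lt_trans (ux n).1 _.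
  by near: n; exact: near_infty_natSinv_lt (PosNum r0).
have uF_le n y : `|F (u n) y| <= g x y.
  apply: Fg; apply: lt_le_trans (ux n).1 _.
  by rewrite invf_le1// ler1n.
have /cvgrPdist_lt/(_ e e0)[n _ /(_ n (leqnn n))] :=
  dominated_cvg_Rintegral (fun n => mF (u n)) (mF x) (ig x) uF_le uF.
by rewrite /= distrC ltNge (ux n).2.
Unshelve. all: by end_near. Qed.

End continuity_under_integral.

(** * Continuous functions with compact support *)

Section test_functions.
Context (R : realType) (d : nat).
Local Notation V := 'rV[R]_d.
Implicit Types f g : V -> R.

Definition supp_in (A : set V) f : Prop := forall x, ~ A x -> f x = 0.

Definition elipschitz (L : R) f : Prop := forall x y, `|f x - f y| <= L * enorm (x - y).

Definition Cc f : Prop := continuous f /\ exists N, supp_in (eball 0 N) f.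

Lemma supp_inS (A B : set V) f : A `<=` B -> supp_in A f -> supp_in B f.
Proof. by move=> AB Af x Bx; apply: Af => /AB. Qed.

Lemma elipschitz_le (L L' : R) f : L <= L' -> elipschitz L f -> elipschitz L' f.
Proof.
by move=> LL' fL x y; apply: le_trans (fL x y) _; rewrite ler_wpM2r// enorm_ge0.
Qed.

Lemma elipschitz_continuous (L : R) f : 0 < L -> elipschitz L f -> continuous f.
Proof.
move=> L0 fL; apply/continuous_eballP => x e e0; exists (e / L); first by rewrite divr_gt0.
by move=> y; rewrite ltr_pdivlMr// mulrC; exact: le_lt_trans.
Qed.

Lemma Cc_continuous f : Cc f -> continuous f.
Proof. by case. Qed.

Lemma Cc_measurable f : Cc f -> measurable_fun setT (f : Rd R d -> R).
Proof. by move=> /Cc_continuous; exact: continuous_measurable_Rd. Qed.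

Lemma Cc_support (N0 : R) f : Cc f -> exists2 N, N0 < N & supp_in (eball 0 N) f.
Proof.
move=> [_ [N fN]]; exists (Num.max N N0 + 1); first by rewrite ltr_pwDr// le_max lexx orbT.
by apply: supp_inS fN; apply: sub_eball; rewrite ler_wpDr// le_max lexx.
Qed.

Lemma supp_in_Cc (c : V) (r : R) f : continuous f -> supp_in (eball c r) f -> Cc f.
Proof.
move=> cf fr; split=> //; exists (r + enorm c); apply: supp_inS fr => x.
by rewrite /eball/= subr0; have := ler_enormD (x - c) c; rewrite subrK; lra.
Qed.

Lemma Cc_bounded f : Cc f -> exists2 M : R, 0 < M & forall x, `|f x| <= M.
Proof.
move=> Cf; have [N N0 fN] := Cc_support 0 Cf.
have [|c _ maxf] := @compact_EVT_max V R (fun x => `|f x|) (cball 0 N) _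
   (@compact_cball R d N) (continuous_subspaceT (continuous_fun_norm (Cc_continuous Cf))).
  by exists 0; rewrite /cball/= subrr enorm0 ltW.
exists (`|f c| + 1); first by rewrite ltr_wpDl.
move=> x; have [xN|xN] := leP (enorm (x - 0)) N.
  by rewrite (le_trans (maxf x (mem_set xN)))// lerDl.
by rewrite fN ?normr0 ?addr_ge0//; apply/eball_ge/ltW.
Qed.

Lemma Cc0 : Cc (fun=> 0).
Proof. by split; [exact: cst_continuous|exists 0]. Qed.

Lemma Cc_comp2 (h : R -> R -> R) f g : h 0 0 = 0 ->
  continuous (fun x => h (f x) (g x)) -> Cc f -> Cc g -> Cc (fun x => h (f x) (g x)).
Proof.
move=> h0 cfg Cf Cg; split=> //.
have [N _ fN] := Cc_support 0 Cf; have [N' NN' gN'] := Cc_support N Cg.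
by exists N' => x xN'; rewrite gN'// fN// => xN; apply: xN'; apply: sub_eball xN; exact: ltW.
Qed.

Lemma CcD f g : Cc f -> Cc g -> Cc (fun x => f x + g x).
Proof.
move=> Cf Cg; apply: (Cc_comp2 (h := +%R)) => //; first exact: addr0.
by apply: continuous_funD; exact: Cc_continuous.
Qed.

Lemma Cc_max f g : Cc f -> Cc g -> Cc (fun x => Num.max (f x) (g x)).
Proof.
move=> Cf Cg; apply: (Cc_comp2 (h := Num.max)) => //; first exact: maxxx.
by apply: continuous_fun_max; exact: Cc_continuous.
Qed.

Lemma CcMl g f : continuous g -> Cc f -> Cc (fun x => g x * f x).
Proof.
move=> cg [cf [N fN]]; split; first exact: continuous_funM.
by exists N => x /fN ->; rewrite mulr0.
Qed.

Lemma CcMr g f : continuous g -> Cc f -> Cc (fun x => f x * g x).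
Proof. by move=> cg Cf; under [X in Cc X]eq_fun do rewrite mulrC; exact: CcMl. Qed.

Lemma CcZ (a : R) f : Cc f -> Cc (fun x => a * f x).
Proof. by apply: CcMl; exact: cst_continuous. Qed.

Lemma Cc_sqr f : Cc f -> Cc (fun x => f x ^+ 2).
Proof. by move=> Cf; apply: CcMl => //; exact: Cc_continuous. Qed.

Lemma CcN f : Cc f -> Cc (fun x => - f x).
Proof. by move=> Cf; under [X in Cc X]eq_fun do rewrite -mulN1r; exact: CcZ. Qed.

Lemma CcB f g : Cc f -> Cc g -> Cc (fun x => f x - g x).
Proof. by move=> Cf Cg; apply: CcD => //; exact: CcN. Qed.

Lemma Cc_sum (I : Type) (r : seq I) (F : I -> V -> R) :
  (forall i, Cc (F i)) -> Cc (fun x => \sum_(i <- r) F i x).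
Proof.
move=> CF; elim: r => [|i r ih].
  by under [X in Cc X]eq_fun do rewrite big_nil; exact: Cc0.
by under [X in Cc X]eq_fun do rewrite big_cons; exact: CcD.
Qed.

Lemma Cc_min_ge0 f g : Cc f -> continuous g -> (forall x, 0 <= g x) ->
  Cc (fun x => Num.min (f x) (g x)).
Proof.
move=> [cf [N fN]] cg g0; split; first exact: continuous_fun_min.
by exists N => x xN; rewrite fN// min_l.
Qed.

Definition cutoff (c : V) (r : R) (x : V) : R :=
  Num.max 0 (Num.min 1 (2 - enorm (x - c) / r)).

Lemma cutoff_ge0 c r x : 0 <= cutoff c r x.
Proof. by rewrite le_max lexx. Qed.

Lemma cutoff_le1 c r x : cutoff c r x <= 1.
Proof. by rewrite ge_max ler01/= ge_min lexx. Qed.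

Lemma cutoff_itv01 c r x : 0 <= cutoff c r x <= 1.
Proof. by rewrite cutoff_ge0 cutoff_le1. Qed.

Lemma normr_cutoff_le1 c r x : `|cutoff c r x| <= 1.
Proof. by rewrite ger0_norm ?cutoff_ge0 ?cutoff_le1. Qed.

Lemma cutoff1 c r x : 0 < r -> enorm (x - c) <= r -> cutoff c r x = 1.
Proof.
move=> r0 xr; rewrite /cutoff min_l ?max_r//.
have : enorm (x - c) / r <= 1 by rewrite ler_pdivrMr// mul1r.
by lra.
Qed.

Lemma cutoff_supp c r : 0 < r -> supp_in (eball c (2 * r)) (cutoff c r).
Proof.
move=> r0 x /eball_ge xr; rewrite /cutoff max_l// ge_min; apply/orP; right.
have : 2 <= enorm (x - c) / r by rewrite ler_pdivlMr.
by lra.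
Qed.

Lemma clamp01_lip (a b : R) :
  `|Num.max 0 (Num.min 1 a) - Num.max 0 (Num.min 1 b)| <= `|a - b|.
Proof.
wlog ab : a b / a <= b => [swap|].
  by case: (leP a b) => [/swap//|/ltW /swap]; rewrite distrC (distrC b).
rewrite distrC [leRHS]distrC [leRHS]ger0_norm ?subr_ge0// ler_norml !maxEle !minEle.
by case: (leP 1 a) => ?; case: (leP 1 b) => ?; rewrite ?ler01;
  case: (leP 0 a) => ?; case: (leP 0 b) => ?; lra.
Qed.

Lemma cutoff_lip c r : 0 < r -> elipschitz r^-1 (cutoff c r).
Proof.
move=> r0 x y; apply: (le_trans (clamp01_lip _ _)).
rewrite (_ : _ - _ = - (r^-1 * (enorm (x - c) - enorm (y - c)))); last by ring.
rewrite normrN normrM gtr0_norm ?invr_gt0// ler_pM2l ?invr_gt0//.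
by apply: (le_trans (enorm_dist _ _)); rewrite opprB addrA subrK.
Qed.

Lemma cutoff_Cc c r : 0 < r -> Cc (cutoff c r).
Proof.
move=> r0; apply: (supp_in_Cc _ (cutoff_supp r0)).
by apply: (elipschitz_continuous _ (cutoff_lip c r0)); rewrite invr_gt0.
Qed.

End test_functions.

Section linear_functional.
Context (R : realType) (d : nat).
Local Notation V := 'rV[R]_d.
Implicit Types (f g : V -> R) (l : (V -> R) -> R).

Definition Cc_linear l : Prop :=
  (forall f g, Cc f -> Cc g -> l (fun x => f x + g x) = l f + l g) /\
  (forall a f, Cc f -> l (fun x => a * f x) = a * l f).

Variable l : (V -> R) -> R.
Hypothesis linl : Cc_linear l.

Lemma Cc_linearD f g : Cc f -> Cc g -> l (fun x => f x + g x) = l f + l g.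
Proof. by case: linl => + _; apply. Qed.

Lemma Cc_linearZ a f : Cc f -> l (fun x => a * f x) = a * l f.
Proof. by case: linl => _; apply. Qed.

Lemma Cc_linear0 : l (fun=> 0) = 0.
Proof.
rewrite -[RHS](mul0r (l (fun=> 0))) -Cc_linearZ; last exact: Cc0.
by congr l; apply/funext => x; rewrite mul0r.
Qed.

Lemma Cc_linearB f g : Cc f -> Cc g -> l (fun x => f x - g x) = l f - l g.
Proof.
move=> Cf Cg; rewrite -[- l g]mulN1r -Cc_linearZ// -Cc_linearD//; last exact: CcZ.
by congr l; apply/funext => x; rewrite mulN1r.
Qed.

Lemma Cc_linear_sum (I : Type) (r : seq I) (F : I -> V -> R) :
  (forall i, Cc (F i)) -> l (fun x => \sum_(i <- r) F i x) = \sum_(i <- r) l (F i).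
Proof.
move=> CF; elim: r => [|i r ih].
  by rewrite big_nil -[RHS]Cc_linear0; congr l; apply/funext => x; rewrite big_nil.
rewrite big_cons -ih -Cc_linearD//; last exact: Cc_sum.
by congr l; apply/funext => x; rewrite big_cons.
Qed.

Lemma Cc_linear_sub l' : Cc_linear l' -> Cc_linear (fun f => l f - l' f).
Proof.
move=> [l'D l'Z]; split=> [f g Cf Cg|a f Cf]; first by rewrite Cc_linearD// l'D//; ring.
by rewrite Cc_linearZ// l'Z// mulrBr.
Qed.

End linear_functional.

(** * Integrals against nice measures *)

Section real_powers.
Context {R : realType}.
Implicit Types x y a b : R.

Lemma ge0_ler_powR2 a x y : 0 <= a -> 0 <= x -> x <= y -> x `^ a <= y `^ a.
Proof.
by move=> a0 x0 xy; apply: ge0_ler_powR => //; rewrite nnegrE// (le_trans x0).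
Qed.

Lemma ler_powRN a x y : 0 <= a -> 0 < x -> x <= y -> y `^ (- a) <= x `^ (- a).
Proof.
move=> a0 x0 xy; rewrite !powRN lef_pV2 ?posrE ?powR_gt0// ?(lt_le_trans x0)//.
by apply: ge0_ler_powR2 => //; exact: ltW.
Qed.

Lemma powR_exprn a x n : 0 <= x -> (x ^+ n) `^ a = (x `^ a) ^+ n.
Proof.
by move=> x0; rewrite -(powR_mulrn n x0) -powRrM mulrC powRrM powR_mulrn// powR_ge0.
Qed.

Lemma powRND a b x : 0 < x -> x `^ (- (a + b)) * x `^ a = x `^ (- b).
Proof.
move=> x0; rewrite -powRD; last by rewrite (gt_eqF x0) implybT.
by rewrite opprD addrAC addNr add0r.
Qed.

Lemma powR_mulNl a x : 0 < x -> x `^ (- a) * x `^ a = 1.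
Proof. by move=> x0; rewrite -{1}[a]addr0 powRND// oppr0 powRr0. Qed.

Lemma powR2N_lt1 a : 0 < a -> 2 `^ (- a) < 1 :> R.
Proof.
move=> a0; rewrite powRN invf_lt1 ?powR_gt0//.
by have := @gt0_ltr_powR R a a0 1 2; rewrite powR1; apply; rewrite ?nnegrE//; lra.
Qed.

Lemma exists_dyadic (t : R) : 1 <= t -> exists k : nat, 2 ^+ k <= t < 2 ^+ k.+1.
Proof.
move=> t1.
have big : exists n : nat, t < 2 ^+ n.
  exists (Num.truncn t).+1; apply: (lt_le_trans (truncnS_gt _)).
  by rewrite -natrX ler_nat ltnW// ltn_expl.
case: (ex_minnP big) => -[|k] tk kmin; first by rewrite expr0 ltNge t1 in tk.
exists k; rewrite tk andbT leNgt; apply/negP => /kmin.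
by rewrite ltnn.
Qed.

End real_powers.

Section nice_measure.
Context (R : realType) (d : nat).
Local Notation V := 'rV[R]_d.
Local Notation X := (Rd R d).
Variables (s Lam : R) (mu : bmeasure R d).
Hypothesis nmu : nice s Lam mu.

Lemma nice_ge0 : 0 <= Lam.
Proof. by have := le_trans (measure_ge0 mu _) (nmu 0 ltr01); rewrite powR1 mulr1 lee_fin. Qed.

Lemma nice_le (Lam' : R) : Lam <= Lam' -> nice s Lam' mu.
Proof.
move=> LL x r r0; apply: (le_trans (nmu x r0)).
by rewrite lee_fin ler_wpM2r// powR_ge0.
Qed.

Lemma nice_lty (x : V) (r : R) : (mu (eball x r) < +oo)%E.
Proof.
have [r0|r0] := ltP 0 r; first exact: le_lt_trans (nmu x r0) (ltry _).
rewrite (_ : eball x r = set0) ?measure0//; apply/seteqP; split=> // y.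
by move=> /(le_lt_trans (enorm_ge0 _)); rewrite ltNge r0.
Qed.

Lemma nice_sigma_finite : sigma_finite setT mu.
Proof.
exists (fun n => eball (0 : V) n%:R) => [|n].
  apply/seteqP; split=> // x _; exists (Num.truncn (enorm x)).+1 => //.
  by rewrite /eball/= subr0 truncnS_gt.
by split; [exact: measurable_eball|exact: nice_lty].
Qed.

Lemma integral_indic_eball_le (M : R) (c : V) (r : R) : 0 <= M -> 0 < r ->
  (\int[mu]_x (M * \1_(eball c r : set X) x)%:E <= (M * (Lam * r `^ s))%:E)%E.
Proof.
move=> M0 r0; under eq_integral do rewrite EFinM.
rewrite ge0_integralZl//=; last first.
  by apply/measurable_EFinP; apply: measurable_indic; exact: measurable_eball.
rewrite integral_indic//; last exact: measurable_eball.
by rewrite setIT EFinM lee_wpmul2l ?lee_fin//; exact: nmu.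
Qed.

Lemma Rintegrable_bounded (f : V -> R) (M : R) (c : V) (r : R) :
  0 < r -> measurable_fun setT (f : X -> R) ->
  (forall x, `|f x| <= M) -> supp_in (eball c r) f ->
  Rintegrable mu f /\ \int[mu]_x `|f x| <= M * (Lam * r `^ s).
Proof.
move=> r0 mf fM fr; apply: Rintegrable_norm_le => //.
have M0 : 0 <= M by apply: le_trans (fM 0).
apply: le_trans (integral_indic_eball_le c M0 r0); apply: ge0_le_integral => //.
- exact/measurable_EFinP/measurableT_comp.
- apply/measurable_EFinP; apply: measurable_funM => //.
  by apply: measurable_indic; exact: measurable_eball.
- move=> x _; rewrite lee_fin indicE.
  have [xr|/negP xr] := boolP (x \in eball c r); first by rewrite mulr1.
  by rewrite mulr0 fr ?normr0//; rewrite inE in xr.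
Qed.

Lemma normr_Rintegral_le (f : V -> R) (M : R) (c : V) (r : R) :
  0 < r -> measurable_fun setT (f : X -> R) ->
  (forall x, `|f x| <= M) -> supp_in (eball c r) f ->
  `|\int[mu]_x f x| <= M * (Lam * r `^ s).
Proof.
move=> r0 mf fM fr; have [jf fle] := Rintegrable_bounded r0 mf fM fr.
exact: le_trans (le_normr_Rintegral measurableT jf) fle.
Qed.

Lemma Cc_Rintegrable (f : V -> R) : Cc f -> Rintegrable mu f.
Proof.
move=> Cf; have [N N0 fN] := Cc_support 0 Cf; have [M _ fM] := Cc_bounded Cf.
by have [] := Rintegrable_bounded N0 (Cc_measurable Cf) fM fN.
Qed.

Lemma Cc_square_integrable (f : V -> R) : Cc f -> square_integrable mu f.
Proof. by move=> Cf; split; [exact: Cc_measurable|exact: Cc_Rintegrable (Cc_sqr Cf)]. Qed.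

Lemma Cc_linear_Rintegral (g : V -> R) : Cc g -> Cc_linear (fun f => \int[mu]_x (g x * f x)).
Proof.
move=> Cg; have igM f : Cc f -> Rintegrable mu (fun x => g x * f x).
  by move=> Cf; apply: Cc_Rintegrable; apply: CcMl => //; exact: Cc_continuous.
split=> [f h Cf Ch|a f Cf].
  rewrite -(RintegralD measurableT (igM f Cf) (igM h Ch)).
  by apply: eq_Rintegral => x _; rewrite mulrDr.
rewrite -(RintegralZl a measurableT (igM f Cf)).
by apply: eq_Rintegral => x _; rewrite mulrCA.
Qed.

(* Dominate [F] by the sum of the [m k] over the balls of radius [rho k]. *)
Lemma Rintegrable_shells (F : V -> R) (x : V) (rho m : nat -> R) (c q : R) :
  measurable_fun setT (F : X -> R) -> (forall k, 0 < rho k) ->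
  (forall k, 0 <= m k) -> 0 <= c -> 0 < q < 1 ->
  (forall k, m k * (Lam * rho k `^ s) <= c * q ^+ k) ->
  (forall y, F y != 0 -> exists k, eball x (rho k) y /\ `|F y| <= m k) ->
  Rintegrable mu F /\ \int[mu]_y `|F y| <= c / (1 - q).
Proof.
move=> mF rho0 m0 c0 /andP[q0 q1] mc Fm; apply: Rintegrable_norm_le => //.
pose g k (y : X) := (m k * \1_(eball x (rho k) : set X) y)%:E.
have g0 k y : (0 <= g k y)%E by rewrite lee_fin mulr_ge0.
have mg k : measurable_fun setT (g k).
  apply/measurable_EFinP; apply: measurable_funM => //.
  by apply: measurable_indic; exact: measurable_eball.
apply: (@le_trans _ _ (\int[mu]_y (\sum_(k <oo) g k y))%E).
  apply: ge0_le_integral => //.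
  - exact/measurable_EFinP/measurableT_comp.
  - by apply: ge0_emeasurable_sum => // k y _ _; exact: g0.
  - move=> y _; have [F0|F0] := eqVneq (F y) 0.
      by rewrite F0 normr0; apply: nneseries_ge0 => k _ _; exact: g0.
    have [k [yk Fk]] := Fm y F0.
    apply: (@le_trans _ _ (g k y)); first by rewrite lee_fin indicE mem_set// mulr1.
    rewrite (@nneseriesD1 _ _ k xpredT)// ?leeDl//.
    by apply: nneseries_ge0 => j _ _; exact: g0.
rewrite integral_nneseries//; apply: lime_le.
  by apply: is_cvg_nneseries => k _ _; apply: integral_ge0 => y _; exact: g0.
apply: nearW => n; apply: (@le_trans _ _ (series (geometric c q) n)%:E); last first.
  by rewrite lee_fin; apply: geometric_le_lim => //; rewrite ger0_norm// ltW.
rewrite /series/= -sumEFin; apply: lee_sum => k _.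
by apply: (le_trans (integral_indic_eball_le x (m0 k) (rho0 k))); rewrite lee_fin.
Qed.

Definition far_const (b : R) : R := Lam * 2 `^ s / (1 - 2 `^ (- b)).

Lemma far_const_ge0 b : 0 < b -> 0 <= far_const b.
Proof.
by move=> b0; rewrite divr_ge0 ?mulr_ge0 ?powR_ge0 ?nice_ge0// subr_ge0 ltW// powR2N_lt1.
Qed.

Lemma Rintegrable_far (F : V -> R) (x : V) (A b rho : R) :
  measurable_fun setT (F : X -> R) -> 0 <= A -> 0 < b -> 0 < rho -> 0 <= s ->
  (forall y, `|F y| <= A * Num.max rho (enorm (y - x)) `^ (- (s + b))) ->
  Rintegrable mu F /\ \int[mu]_y `|F y| <= A * (far_const b * rho `^ (- b)).
Proof.
move=> mF A0 b0 r0 s0 FA.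
have p2 k : 0 < 2 ^+ k * rho by rewrite mulr_gt0// exprn_gt0.
rewrite (_ : A * _ = A * (Lam * 2 `^ s * rho `^ (- b)) / (1 - 2 `^ (- b))); last first.
  by rewrite /far_const; ring.
apply: (@Rintegrable_shells F x (fun k => 2 ^+ k.+1 * rho)
    (fun k => A * (2 ^+ k * rho) `^ (- (s + b)))) => //.
- by move=> k; rewrite mulr_ge0// powR_ge0.
- by rewrite !mulr_ge0// ?powR_ge0// nice_ge0.
- by rewrite powR_gt0// powR2N_lt1.
- move=> k; rewrite exprS -(mulrA 2) (@powRM _ 2)// ?(ltW (p2 _))//.
  rewrite (_ : _ * _ = A * Lam * 2 `^ s *
      ((2 ^+ k * rho) `^ (- (s + b)) * (2 ^+ k * rho) `^ s)); last by ring.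
  rewrite powRND// powRM ?exprn_ge0 ?(ltW r0)// powR_exprn//.
  by rewrite [leRHS](_ : _ = A * Lam * 2 `^ s * (2 `^ (- b) ^+ k * rho `^ (- b)))//; ring.
- move=> y _; have := FA y; set n := Num.max _ _ => Fn.
  have rn : rho <= n by rewrite le_max lexx.
  have [|k /andP[kn nk]] := @exists_dyadic R (n / rho); first by rewrite ler_pdivlMr// mul1r.
  rewrite ler_pdivlMr// in kn; rewrite ltr_pdivrMr// in nk.
  exists k; split; first by apply: le_lt_trans nk; rewrite le_max lexx orbT.
  by apply: (le_trans Fn); rewrite ler_wpM2l// ler_powRN// addr_ge0// ltW.
Qed.

Definition near_const : R := Lam * 4 `^ s * 2.

Lemma near_const_ge0 : 0 <= near_const.
Proof. by rewrite !mulr_ge0 ?powR_ge0 ?nice_ge0. Qed.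

Lemma Rintegrable_near (F : V -> R) (x : V) (A rho : R) :
  measurable_fun setT (F : X -> R) -> 0 <= A -> 0 < rho -> 0 <= s ->
  supp_in (eball x rho) F -> F x = 0 ->
  (forall y, 0 < enorm (y - x) ->
     `|F y| <= A * (enorm (y - x) * enorm (y - x) `^ (- s))) ->
  Rintegrable mu F /\ \int[mu]_y `|F y| <= A * (near_const * rho).
Proof.
move=> mF A0 r0 s0 Frho Fx FA.
have p2 k : 0 < 2^-1 ^+ k * rho by rewrite mulr_gt0// exprn_gt0.
rewrite (_ : A * _ = A * (Lam * 4 `^ s * rho) / (1 - 2^-1)); last first.
  by rewrite /near_const; field.
apply: (@Rintegrable_shells F x (fun k => 4 * (2^-1 ^+ k.+1 * rho))
    (fun k => A * (2^-1 ^+ k * rho * (2^-1 ^+ k.+1 * rho) `^ (- s)))) => //.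
- by move=> k; rewrite mulr_gt0.
- by move=> k; rewrite !mulr_ge0// ?powR_ge0// ?exprn_ge0// ltW.
- by rewrite !mulr_ge0// ?powR_ge0 ?nice_ge0// ltW.
- by lra.
- move=> k; rewrite (@powRM _ 4)// ?(ltW (p2 _))//.
  rewrite (_ : _ * (Lam * _) = A * (Lam * 4 `^ s * rho) * 2^-1 ^+ k *
    ((2^-1 ^+ k.+1 * rho) `^ (- s) * (2^-1 ^+ k.+1 * rho) `^ s)); last by ring.
  by rewrite powR_mulNl// mulr1.
- move=> y Fy; have yr : enorm (y - x) < rho.
    by rewrite ltNge; apply: contra Fy => /eball_ge/Frho ->.
  have u0 : 0 < enorm (y - x).
    by apply: enorm_gt0; apply: contra Fy; rewrite subr_eq0 => /eqP ->; rewrite Fx.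
  have [|k /andP[kr rk]] := @exists_dyadic R (rho / enorm (y - x)).
    by rewrite ler_pdivlMr// mul1r ltW.
  rewrite ler_pdivlMr// in kr; rewrite ltr_pdivrMr// in rk.
  have yk : enorm (y - x) <= 2^-1 ^+ k * rho.
    by rewrite exprVn mulrC ler_pdivlMr ?exprn_gt0// mulrC.
  have ky : 2^-1 ^+ k.+1 * rho < enorm (y - x).
    by rewrite exprVn mulrC ltr_pdivrMr ?exprn_gt0// mulrC.
  exists k; split.
    rewrite /eball/=; apply: (le_lt_trans yk); rewrite exprS.
    by have := p2 k; move: (2^-1 ^+ k) => t; nra.
  apply: (le_trans (FA y u0)); rewrite ler_wpM2l//.
  by apply: ler_pM => //; rewrite ?powR_ge0// ?(ltW u0)// ler_powRN// ltW.
Qed.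

End nice_measure.

(* Conversion is prohibitively slow if it can unfold [Rintegral] and the kernels below. *)
Opaque Rintegral.

(** * Scalar kernels *)

Section exponential_estimates.
Context {R : realType}.

Lemma normr_1BexpR_le (u : R) : `|1 - expR u| <= `|u| * expR `|u|.
Proof.
have expR_ge1 (x : R) : 0 <= x -> 1 <= expR x by move=> x0; rewrite -(@expR0 R) ler_expR.
have [u0|u0] := leP 0 u.
  rewrite (ger0_norm u0) ler0_norm ?subr_le0 ?expR_ge1// opprB.
  have := ler_wpM2r (expR_ge0 u) (expR_ge1Dx (- u)).
  by rewrite -expRD addNr expR0; lra.
rewrite (ltr0_norm u0) ger0_norm; last first.
  by rewrite subr_ge0 -(@expR0 R) ler_expR ltW.
have := expR_ge1Dx u; have : 1 <= expR (- u) by rewrite expR_ge1// oppr_ge0 ltW.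
by nra.
Qed.

Lemma normr_ln_le (t : R) : 2^-1 <= t -> `|ln t| <= 2 * `|t - 1|.
Proof.
move=> t2; have t0 : 0 < t by lra.
have ln_le (x : R) : 0 < x -> ln x <= x - 1.
  by move=> x0; have := @le_ln1Dx R (x - 1); rewrite (addrC 1) subrK; apply; lra.
have [t1|t1] := leP 1 t.
  rewrite ger0_norm ?ln_ge0// ger0_norm ?subr_ge0//.
  by have := ln_le t t0; lra.
rewrite ler0_norm ?ln_le0 ?(ltW t1)// ltr0_norm ?subr_lt0// -lnV ?posrE//.
have tV0 : 0 < t^-1 by rewrite invr_gt0.
apply: (le_trans (ln_le _ tV0)).
have tV2 : t^-1 <= 2 by rewrite invf_ple ?posrE.
by rewrite (_ : t^-1 - 1 = t^-1 * (1 - t)); [nra|field; rewrite gt_eqF].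
Qed.

Lemma normr_1BpowR_le (s t : R) : 0 < s -> 2^-1 <= t <= 2 ->
  `|1 - t `^ (- s)| <= 2 `^ s * (2 * s) * `|t - 1|.
Proof.
move=> s0 /andP[tge tle]; have t0 : 0 < t by lra.
have lnt : `|ln t| <= ln 2.
  rewrite ler_norml -lnV ?posrE//.
  by rewrite !ler_ln ?posrE ?invr_gt0// tge.
have lnt1 := normr_ln_le tge.
rewrite {1}/powR gt_eqF//; apply: (le_trans (normr_1BexpR_le _)).
rewrite normrM normrN (gtr0_norm s0) mulrC -!mulrA; apply: ler_pM.
- exact: expR_ge0.
- by rewrite mulr_ge0// ltW.
- by rewrite /powR gt_eqF// ler_expR ler_pM2l.
- by rewrite mulrCA ler_pM2l.
Qed.

End exponential_estimates.

Section kernel.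
Context (R : realType) (d : nat).
Local Notation V := 'rV[R]_d.
Local Notation X := (Rd R d).
Variables (s alpha : R).

Definition CZ_kernel (om : V -> R) (x : V) : R := (enorm x `^ (s + 1))^-1 * om x.

Definition CZ_trunc (om : V -> R) (delta : R) (x : V) : R :=
  (Num.max delta (enorm x) `^ (s + 1))^-1 * om x.

Definition CZ_profile (om : V -> R) : Prop :=
  [/\ 0 < alpha <= 1, forall l x, om (l *: x) = l * om x,
      forall x, `|om x| <= enorm x &
      forall x x', enorm x = 1 -> enorm x' = 1 ->
        `|om x - om x'| <= enorm (x - x') `^ alpha].

Variable om : V -> R.
Hypotheses (s0 : 0 < s) (omP : CZ_profile om).

Let a0 : 0 < alpha. Proof. by case: omP => /andP[]. Qed.
Let a1 : alpha <= 1. Proof. by case: omP => /andP[]. Qed.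
Let omZ l x : om (l *: x) = l * om x. Proof. by case: omP. Qed.
Let om_le x : `|om x| <= enorm x. Proof. by case: omP. Qed.

Lemma profileN (x : V) : om (- x) = - om x.
Proof. by rewrite -scaleN1r omZ mulN1r. Qed.

Lemma profile0 : om 0 = 0.
Proof. by rewrite -(scale0r 0) omZ mul0r. Qed.

Lemma CZ_truncN (delta : R) (x : V) : CZ_trunc om delta (- x) = - CZ_trunc om delta x.
Proof. by rewrite /CZ_trunc enormN profileN mulrN. Qed.

Lemma CZ_trunc0 (delta : R) : CZ_trunc om delta 0 = 0.
Proof. by rewrite /CZ_trunc profile0 mulr0. Qed.

Lemma CZ_trunc_far (delta : R) (x : V) :
  delta <= enorm x -> CZ_trunc om delta x = CZ_kernel om x.
Proof. by move=> dx; rewrite /CZ_trunc max_r. Qed.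

Lemma CZ_trunc_le (delta : R) (x : V) : 0 < delta ->
  `|CZ_trunc om delta x| <= Num.max delta (enorm x) `^ (- s).
Proof.
move=> d0; set m := Num.max _ _.
have m0 : 0 < m by rewrite lt_max d0.
rewrite /CZ_trunc normrM (ger0_norm (x := _^-1)) ?invr_ge0 ?powR_ge0// mulrC.
rewrite ler_pdivrMr ?powR_gt0// -powRD; last by rewrite (gt_eqF m0) implybT.
rewrite addKr powRr1 ?(ltW m0)//; apply: (le_trans (om_le x)).
by rewrite le_max lexx orbT.
Qed.

Lemma CZ_trunc_le_enorm (delta : R) (x : V) : 0 < delta -> 0 < enorm x ->
  `|CZ_trunc om delta x| <= enorm x `^ (- s).
Proof.
move=> d0 x0; apply: (le_trans (CZ_trunc_le x d0)).
by apply: ler_powRN; rewrite ?(ltW s0)// le_max lexx orbT.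
Qed.

Lemma CZ_trunc_scale (delta r : R) (x : V) : 0 < r -> 0 < delta ->
  CZ_trunc om (r * delta) (r *: x) = r `^ (- s) * CZ_trunc om delta x.
Proof.
move=> r0 d0; rewrite /CZ_trunc enormZ_gt0// -maxr_pMr ?(ltW r0)//.
have m0 : 0 < Num.max delta (enorm x) by rewrite lt_max d0.
have rs1 : r `^ (s + 1) = r `^ s * r.
  by rewrite powRD ?powRr1 ?(ltW r0)// (gt_eqF r0) implybT.
rewrite powRM ?(ltW r0) ?(ltW m0)// omZ powRN rs1.
have := powR_gt0 s r0; have := powR_gt0 (s + 1) m0.
move: (r `^ s) (_ `^ (s + 1)) => u v v0 u0.
by field; rewrite !gt_eqF.
Qed.

Lemma CZ_kernel_scale (r : R) (x : V) : 0 < r ->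
  CZ_kernel om (r *: x) = r `^ (- s) * CZ_kernel om x.
Proof.
move=> r0; have [->|x0] := eqVneq x 0.
  by rewrite scaler0 /CZ_kernel profile0 !mulr0.
have e0 := enorm_gt0 x0.
rewrite -(@CZ_trunc_far (enorm x) x)// -(CZ_trunc_scale x r0 e0) CZ_trunc_far//.
by rewrite enormZ_gt0.
Qed.

Lemma CZ_kernel_unit (x : V) : enorm x = 1 -> CZ_kernel om x = om x.
Proof. by move=> x1; rewrite /CZ_kernel x1 powR1 invr1 mul1r. Qed.

(* Polar coordinates near a unit vector [u]: [t] is the norm of [v] and [v'] its direction. *)
Lemma profile_radial (u v : V) : enorm u = 1 -> enorm (u - v) <= 2^-1 ->
  exists (t : R) (v' : V), [/\ 2^-1 <= t <= 2, `|t - 1| <= enorm (u - v),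
    v = t *: v', enorm v' = 1 & `|om u - om v'| <= 2 * enorm (u - v) `^ alpha].
Proof.
move=> u1 uv; pose t := enorm v.
have t1 : `|t - 1| <= enorm (u - v).
  by rewrite -u1 -enormB; have := enorm_dist v u.
have /andP[t_ge t_le] : - enorm (u - v) <= t - 1 <= enorm (u - v) by rewrite -ler_norml.
have t0 : 0 < t by lra.
have v0 : v != 0 by apply: contraTneq t0 => v0; rewrite /t v0 enorm0 ltxx.
exists t, (t^-1 *: v); have v1 := enorm_unit v0.
split=> //.
- by apply/andP; split; lra.
- by rewrite scalerA mulfV ?scale1r// gt_eqF.
have [_ _ _ /(_ u (t^-1 *: v) u1 v1)] := omP; move/le_trans; apply.
apply: (@le_trans _ _ ((2 * enorm (u - v)) `^ alpha)).
  apply: ge0_ler_powR2; rewrite ?enorm_ge0 ?(ltW a0)//.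
  apply: (le_trans (enorm_triangle v _ _)).
  rewrite (_ : v - t^-1 *: v = (1 - t^-1) *: v); last by rewrite scalerBl scale1r.
  rewrite enormZ -/t -{2}(gtr0_norm t0) -normrM mulrBl mulVf ?gt_eqF// mul1r; lra.
rewrite powRM ?enorm_ge0// ler_wpM2r ?powR_ge0//.
by apply: ler1_powR => //; lra.
Qed.

Lemma le_powR_alpha (e : R) : 0 <= e <= 1 -> e <= e `^ alpha.
Proof.
move=> /andP[]; rewrite le_eqVlt => /predU1P[<-|e0] e1; first exact: powR_ge0.
by apply: ger1_powR => //; rewrite e0.
Qed.

Lemma profile_holder_unit (u v : V) : enorm u = 1 -> enorm (u - v) <= 2^-1 ->
  `|om u - om v| <= 3 * enorm (u - v) `^ alpha.
Proof.
move=> u1 uv; have [t [v' [_ t1 E v'1 uv']]] := profile_radial u1 uv.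
have e0 := enorm_ge0 (u - v); set e := enorm (u - v) in uv t1 uv' e0 *.
have ea : e <= e `^ alpha by apply: le_powR_alpha; lra.
rewrite E omZ (_ : _ - _ = (om u - om v') + (1 - t) * om v'); last by ring.
apply: (le_trans (ler_normD _ _)); rewrite normrM (distrC 1).
have ov := om_le v'; rewrite v'1 in ov.
by have := ler_pM (normr_ge0 _) (normr_ge0 _) t1 ov; lra.
Qed.

Lemma profile_continuous : continuous om.
Proof.
apply/continuous_eballP => u e e0.
have [->|u0] := eqVneq u 0.
  by exists e => // v; rewrite subr0 profile0 subr0; exact: le_lt_trans.
have n0 := enorm_gt0 u0; set n := enorm u in n0.
have en0 : 0 < e / (4 * n) by rewrite divr_gt0// mulr_gt0.
pose q := (e / (4 * n)) `^ alpha^-1; have q0 : 0 < q by exact: powR_gt0.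
have qa : q `^ alpha = e / (4 * n) by rewrite /q -powRrM mulVf ?gt_eqF// powRr1 ?(ltW en0).
exists (n * Num.min 2^-1 q); first by rewrite mulr_gt0// lt_min q0 andbT.
move=> v; rewrite enormB -(@ltr_pdivrMl _ _ _ _ n0) -[n^-1 * _]enormZ_gt0 ?invr_gt0//.
rewrite scalerBr lt_min => /andP[uv2 uvq].
have holder := profile_holder_unit (enorm_unit u0) (ltW uv2).
have -> : om v - om u = - (n * (om (n^-1 *: u) - om (n^-1 *: v))).
  by rewrite !omZ; field; rewrite gt_eqF.
rewrite normrN normrM gtr0_norm// -ltr_pdivlMl//; apply: (le_lt_trans holder).
have := ge0_ler_powR2 (ltW a0) (enorm_ge0 _) (ltW uvq); rewrite qa.
have -> : n^-1 * e = 4 * (e / (4 * n)) by field; rewrite gt_eqF.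
lra.
Qed.

Lemma CZ_trunc_continuous (delta : R) : 0 < delta -> continuous (CZ_trunc om delta).
Proof.
move=> d0; rewrite /CZ_trunc; under eq_fun do rewrite -powRN.
apply: continuous_funM profile_continuous; apply: continuous_fun_powR.
  by move=> x; rewrite lt_max d0.
by apply: continuous_fun_max; [exact: cst_continuous|exact: enorm_continuous].
Qed.

Lemma CZ_truncB_continuous (delta : R) : 0 < delta ->
  continuous (fun p : V * V => CZ_trunc om delta (p.1 - p.2)).
Proof.
move=> d0 p; apply: (@continuous_comp _ _ _ (fun p : V * V => p.1 - p.2)).
  exact: (@sub_continuous V p).
exact: CZ_trunc_continuous.
Qed.

Lemma CZ_truncBr_continuous (delta : R) (x : V) : 0 < delta ->
  continuous (fun y : V => CZ_trunc om delta (x - y)).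
Proof.
move=> d0; apply/continuous_eballP => y e e0.
have /continuous_eballP/(_ (x - y) e e0)[r r0 near_xy] := CZ_trunc_continuous d0.
by exists r => // z zy; apply: near_xy; rewrite opprB [_ + (y - x)]addrC addrA subrK enormB.
Qed.

Lemma CZ_truncBl_continuous (delta : R) (y : V) : 0 < delta ->
  continuous (fun x : V => CZ_trunc om delta (x - y)).
Proof.
move=> d0; have := continuous_funN (CZ_truncBr_continuous (x := y) d0).
by under eq_fun do rewrite -CZ_truncN opprB.
Qed.

Lemma measurable_CZ_truncB (delta : R) : 0 < delta ->
  measurable_fun setT (fun p : X * X => CZ_trunc om delta (p.1 - p.2)).
Proof. by move=> d0; exact: (continuous_prod_measurable (CZ_truncB_continuous d0)). Qed.

Lemma measurable_CZ_truncBr (delta : R) (x : V) : 0 < delta ->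
  measurable_fun setT (fun y : X => CZ_trunc om delta (x - y)).
Proof. by move=> d0; apply: continuous_measurable_Rd; exact: CZ_truncBr_continuous. Qed.

Definition regularity_const : R := 2 + 2 `^ s * (2 * s).

Lemma regularity_const_gt0 : 0 < regularity_const.
Proof. by rewrite ltr_wpDr// mulr_ge0 ?powR_ge0// mulr_ge0// ltW. Qed.

Lemma CZ_kernel_regular_unit (u v : V) : enorm u = 1 -> enorm (u - v) <= 2^-1 ->
  `|CZ_kernel om u - CZ_kernel om v| <= regularity_const * enorm (u - v) `^ alpha.
Proof.
move=> u1 uv; have [t [v' [t12 t1 E v'1 uv']]] := profile_radial u1 uv.
have e0 := enorm_ge0 (u - v); set e := enorm (u - v) in uv t1 uv' e0 *.
have ea : e <= e `^ alpha by apply: le_powR_alpha; lra.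
have t0 : 0 < t by case/andP: t12 => t12 _; lra.
rewrite E CZ_kernel_scale// !CZ_kernel_unit//.
rewrite (_ : _ - _ = (om u - om v') + (1 - t `^ (- s)) * om v'); last by ring.
apply: (le_trans (ler_normD _ _)); rewrite normrM.
have ov := om_le v'; rewrite v'1 in ov.
have tail : `|1 - t `^ (- s)| * `|om v'| <= 2 `^ s * (2 * s) * e `^ alpha * 1.
  apply: ler_pM => //; apply: (le_trans (normr_1BpowR_le s0 t12)); rewrite ler_wpM2l//.
    by rewrite mulr_ge0 ?powR_ge0// mulr_ge0// ltW.
  exact: le_trans ea.
by rewrite /regularity_const; lra.
Qed.

Lemma CZ_kernel_regular (u v : V) : 0 < enorm u -> enorm (u - v) <= enorm u / 2 ->
  `|CZ_kernel om u - CZ_kernel om v| <=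
    regularity_const * (enorm (u - v) `^ alpha * enorm u `^ (- (s + alpha))).
Proof.
set n := enorm u => n0 uv; have nV0 : 0 < n^-1 by rewrite invr_gt0.
have u0 : u != 0 by apply: contraTneq n0 => u0; rewrite /n u0 enorm0 ltxx.
have euv : enorm (n^-1 *: u - n^-1 *: v) = n^-1 * enorm (u - v).
  by rewrite -scalerBr enormZ_gt0.
have [uE vE] : u = n *: (n^-1 *: u) /\ v = n *: (n^-1 *: v).
  by rewrite !scalerA mulfV ?scale1r// gt_eqF.
have := @CZ_kernel_regular_unit (n^-1 *: u) (n^-1 *: v) (enorm_unit u0).
rewrite euv => /(_ ltac:(by rewrite ler_pdivrMl)) regular.
have -> : CZ_kernel om u - CZ_kernel om v =
    n `^ (- s) * (CZ_kernel om (n^-1 *: u) - CZ_kernel om (n^-1 *: v)).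
  by rewrite mulrBr -!CZ_kernel_scale// -uE -vE.
rewrite normrM (ger0_norm (powR_ge0 _ _)).
apply: (le_trans (ler_wpM2l (powR_ge0 _ _) regular)).
rewrite powRM ?enorm_ge0 ?(ltW nV0)// -(powR_inv1 (ltW n0)) -powRrM mulN1r.
rewrite opprD powRD; last by rewrite (gt_eqF n0) implybT.
move: (n `^ (- s)) (n `^ (- alpha)) (_ `^ alpha) => p q e.
by rewrite [leRHS](_ : _ = p * (regularity_const * (q * e)))//; ring.
Qed.

End kernel.

Lemma CZ_truncE (R : realType) (d : nat) (s : R) (om : 'rV[R]_d -> R) (delta : R) (x : 'rV[R]_d) :
  CZ_trunc s om delta x = (Num.max delta (enorm x) `^ (s + 1))^-1 * om x.
Proof. by []. Qed.

Lemma CZ_kernelE (R : realType) (d : nat) (s : R) (om : 'rV[R]_d -> R) (x : 'rV[R]_d) :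
  CZ_kernel s om x = (enorm x `^ (s + 1))^-1 * om x.
Proof. by []. Qed.

Opaque CZ_trunc CZ_kernel.

(** * The truncated operator and its pairing *)

Section truncated_operator.
Context (R : realType) (d : nat).
Local Notation V := 'rV[R]_d.
Local Notation X := (Rd R d).
Variables (s : R) (om : V -> R).

Definition CZ_op (mu : bmeasure R d) (delta : R) (f : V -> R) (x : V) : R :=
  \int[mu]_y (f y * CZ_trunc s om delta (x - y)).

Definition CZ_pair (mu : bmeasure R d) (delta : R) (f g : V -> R) : R :=
  \int[mu]_x (g x * CZ_op mu delta f x).

Definition CZ_bounded_Cc (Lg : R) (mu : bmeasure R d) : Prop :=
  forall (delta : R) (f : V -> R), 0 < delta -> Cc f ->
    (\int[mu]_x (CZ_op mu delta f x ^+ 2)%:E <=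
      (Lg ^+ 2)%:E * \int[mu]_x (f x ^+ 2)%:E)%E.

Definition kernel_weight (delta : R) (x y : V) : R :=
  Num.max delta (enorm (y - x)) `^ (- s).

Variables (alpha Lam : R) (mu : bmeasure R d).
Hypotheses (s0 : 0 < s) (omP : CZ_profile alpha om) (nmu : nice s Lam mu).

Definition weight_const (delta : R) : R := far_const s Lam s * delta `^ (- s).

Lemma kernel_weight_sqr (delta : R) (x : V) : 0 < delta ->
  Rintegrable mu (fun y => kernel_weight delta x y ^+ 2) /\
  \int[mu]_y (kernel_weight delta x y ^+ 2) <= weight_const delta.
Proof.
move=> d0; have m0 (y : V) : 0 < Num.max delta (enorm (y - x)) by rewrite lt_max d0.
have cw : continuous (kernel_weight delta x).
  apply: continuous_fun_powR => //.
  by apply: continuous_fun_max; [exact: cst_continuous|exact: enormB_continuous].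
have mw := continuous_measurable_Rd (continuous_funM cw cw).
have sqr y : `|kernel_weight delta x y ^+ 2| = kernel_weight delta x y ^+ 2.
  by rewrite ger0_norm ?sqr_ge0.
have [|jw wle] := @Rintegrable_far _ _ s Lam mu nmu _ x 1 s delta mw ler01 s0 d0 (ltW s0).
  move=> y; rewrite sqr mul1r /kernel_weight expr2 -powRD ?opprD//.
  by rewrite (gt_eqF (m0 y)) implybT.
by split=> //; rewrite mul1r in wle; under eq_Rintegral do rewrite -sqr.
Qed.

Lemma CZ_trunc_le_weight (delta : R) (x y : V) : 0 < delta ->
  `|CZ_trunc s om delta (x - y)| <= kernel_weight delta x y.
Proof. by move=> d0; rewrite /kernel_weight enormB; exact: (CZ_trunc_le s omP _ d0). Qed.

Lemma square_integrable_CZ_trunc (delta : R) (x : V) : 0 < delta ->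
  square_integrable mu (fun y => CZ_trunc s om delta (x - y)).
Proof.
move=> d0; have mK := measurable_CZ_truncBr s omP x d0; split=> //.
have [jw _] := kernel_weight_sqr x d0; apply: (le_Rintegrable _ jw).
  exact: measurable_funM.
move=> y; rewrite normrX lerXn2r ?nnegrE ?powR_ge0//.
exact: CZ_trunc_le_weight.
Qed.

Lemma normrM_le_sqrD (a b c : R) : `|b| <= c -> `|a * b| <= a ^+ 2 + c ^+ 2.
Proof.
move=> bc; rewrite normrM -(real_normK (num_real a)).
have : `|a| * `|b| <= `|a| * c by rewrite ler_wpM2l.
by have := sqr_ge0 (`|a| - c); have := sqr_ge0 c; have := sqr_ge0 `|a|; nra.
Qed.

Lemma CZ_op_integrable (delta : R) (f : V -> R) (x : V) :
  0 < delta -> square_integrable mu f ->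
  Rintegrable mu (fun y => f y * CZ_trunc s om delta (x - y)).
Proof. by move=> d0 Lf; apply: Rintegrable_mul => //; exact: square_integrable_CZ_trunc. Qed.

Lemma CZ_op_norm_le (delta : R) (f : V -> R) (x : V) :
  0 < delta -> square_integrable mu f ->
  \int[mu]_y `|f y * CZ_trunc s om delta (x - y)| <=
    \int[mu]_y (f y ^+ 2) + weight_const delta.
Proof.
move=> d0 Lf; have [jw wle] := kernel_weight_sqr x d0.
apply: (@le_trans _ _ (\int[mu]_y (f y ^+ 2 + kernel_weight delta x y ^+ 2))).
  apply: le_Rintegral => //.
  - by apply: Rintegrable_norm; exact: CZ_op_integrable.
  - exact: RintegrableD Lf.2 jw.
  - by move=> y _; apply: normrM_le_sqrD; exact: CZ_trunc_le_weight.
by rewrite (RintegralD measurableT Lf.2 jw) lerD2l.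
Qed.

Lemma kernel_weight_doubling (delta : R) (x x' y : V) : 0 < delta -> enorm (x' - x) < 1 ->
  kernel_weight delta x' y <= (1 + delta^-1) `^ s * kernel_weight delta x y.
Proof.
move=> d0 xx'; have := enorm_triangle x' y x; rewrite /kernel_weight.
set a := enorm (y - x'); set b := enorm (y - x) => tri.
have a0 : 0 < Num.max delta a by rewrite lt_max d0.
have b0 : 0 < Num.max delta b by rewrite lt_max d0.
have D0 : 0 <= 1 + delta^-1 by rewrite addr_ge0// invr_ge0 ltW.
have ba : Num.max delta b <= (1 + delta^-1) * Num.max delta a.
  have da : delta <= Num.max delta a by rewrite le_max lexx.
  have aa : a <= Num.max delta a by rewrite le_max lexx orbT.
  have : 1 <= delta^-1 * Num.max delta a by rewrite mulrC ler_pdivlMr// mul1r.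
  by rewrite ge_max => ?; apply/andP; split; lra.
rewrite !powRN ler_pdivlMr ?powR_gt0// mulrC ler_pdivrMr ?powR_gt0//.
rewrite -powRM ?(ltW a0)//; apply: ge0_ler_powR2 => //; exact: ltW.
Qed.

Lemma CZ_op_continuous (delta : R) (f : V -> R) : 0 < delta -> square_integrable mu f ->
  continuous (CZ_op mu delta f).
Proof.
move=> d0 Lf; pose C := (1 + delta^-1) `^ s.
apply: (@continuous_Rintegral _ X R d mu (fun x y => f y * CZ_trunc s om delta (x - y))
  (fun x y => f y ^+ 2 + C ^+ 2 * kernel_weight delta x y ^+ 2)).
- by move=> x; exact: Rintegrable_measurable (CZ_op_integrable x d0 Lf).
- move=> x; have [jw _] := kernel_weight_sqr x d0.
  exact: RintegrableD Lf.2 (RintegrableZl _ jw).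
- move=> y; apply: continuous_funM; first exact: cst_continuous.
  exact: (CZ_truncBl_continuous omP).
- move=> x x' y xx'; rewrite -exprMn; apply: normrM_le_sqrD.
  by apply: (le_trans (CZ_trunc_le_weight x' y d0)); exact: kernel_weight_doubling.
Qed.

Lemma CZ_opB (delta : R) (f g : V -> R) (x : V) : 0 < delta ->
  square_integrable mu f -> square_integrable mu g ->
  CZ_op mu delta (fun y => f y - g y) x = CZ_op mu delta f x - CZ_op mu delta g x.
Proof.
move=> d0 Lf Lg; rewrite /CZ_op; under eq_Rintegral do rewrite mulrBl.
by rewrite RintegralB//; exact: CZ_op_integrable.
Qed.

Lemma Cc_mul_CZ_op (delta : R) (f g : V -> R) : 0 < delta -> square_integrable mu f ->
  Cc g -> Cc (fun x => g x * CZ_op mu delta f x).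
Proof. by move=> d0 Lf Cg; apply: CcMr => //; exact: CZ_op_continuous. Qed.

Lemma CZ_pair_integrable (delta : R) (f g : V -> R) : 0 < delta -> square_integrable mu f ->
  Cc g -> Rintegrable mu (fun x => g x * CZ_op mu delta f x).
Proof. by move=> d0 Lf Cg; apply: (Cc_Rintegrable nmu); exact: Cc_mul_CZ_op. Qed.

Lemma CZ_pairBl (delta : R) (f1 f2 g : V -> R) : 0 < delta ->
  square_integrable mu f1 -> square_integrable mu f2 -> Cc g ->
  CZ_pair mu delta (fun y => f1 y - f2 y) g = CZ_pair mu delta f1 g - CZ_pair mu delta f2 g.
Proof.
move=> d0 Lf1 Lf2 Cg; rewrite /CZ_pair; under eq_Rintegral do rewrite CZ_opB// mulrBr.
by rewrite RintegralB//; exact: CZ_pair_integrable.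
Qed.

Lemma Cc_linear_CZ_pair (delta : R) (f : V -> R) : 0 < delta -> square_integrable mu f ->
  Cc_linear (CZ_pair mu delta f).
Proof.
move=> d0 Lf; split=> [g h Cg Ch|a g Cg]; rewrite /CZ_pair.
  under eq_Rintegral do rewrite mulrDl.
  by rewrite RintegralD//; exact: CZ_pair_integrable.
under eq_Rintegral do rewrite -mulrA.
by rewrite RintegralZl//; exact: CZ_pair_integrable.
Qed.

Lemma CZ_pair_antisym (delta : R) (f g : V -> R) : 0 < delta ->
  square_integrable mu f -> Cc g ->
  CZ_pair mu delta f g = \int[mu]_y (f y * - CZ_op mu delta g y).
Proof.
move=> d0 Lf Cg; have Lg := Cc_square_integrable nmu Cg.
pose F x y := g x * (f y * CZ_trunc s om delta (x - y)).
have iF x : Rintegrable mu (F x) by apply: RintegrableZl; exact: CZ_op_integrable.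
have FE x y : F x y = - f y * (g x * CZ_trunc s om delta (y - x)).
  by rewrite /F -opprB (CZ_truncN _ omP); ring.
have iF' y : Rintegrable mu (F^~ y).
  rewrite (_ : F^~ y = fun x => - f y * (g x * CZ_trunc s om delta (y - x))).
    by apply: RintegrableZl; exact: CZ_op_integrable.
  by apply/funext => x.
have mF : measurable_fun setT (fun p : X * X => F p.1 p.2).
  apply: measurable_funM; first exact: (measurableT_comp Lg.1 measurable_fst).
  apply: measurable_funM; first exact: (measurableT_comp Lf.1 measurable_snd).
  exact: (measurable_CZ_truncB s omP d0).
pose Q := \int[mu]_y (f y ^+ 2) + weight_const delta.
have iQ : Rintegrable mu (fun x => Q * `|g x|).
  by apply: RintegrableZl; apply: Rintegrable_norm; exact: (Cc_Rintegrable nmu Cg).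
have FQ x : \int[mu]_y `|F x y| <= Q * `|g x|.
  under eq_Rintegral do rewrite normrM.
  rewrite RintegralZl//; last by apply: Rintegrable_norm; exact: CZ_op_integrable.
  by rewrite mulrC ler_wpM2r//; exact: CZ_op_norm_le.
transitivity (\int[mu]_x \int[mu]_y F x y).
  by apply: eq_Rintegral => x _; rewrite /F RintegralZl//; exact: CZ_op_integrable.
rewrite (Rintegral_fubini (nice_sigma_finite nmu) mF iF iQ FQ iF').
apply: eq_Rintegral => y _; under eq_Rintegral do rewrite FE.
by rewrite RintegralZl//; [rewrite mulrN mulNr|exact: CZ_op_integrable].
Qed.

Lemma CZ_pair_le (Lg delta : R) (f g : V -> R) : CZ_bounded_Cc Lg mu -> 0 < delta ->
  Cc f -> Cc g ->
  CZ_pair mu delta f g ^+ 2 <=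
    Lg ^+ 2 * \int[mu]_x (f x ^+ 2) * \int[mu]_x (g x ^+ 2).
Proof.
move=> bounded d0 Cf Cg.
have [Lf Lg2] := (Cc_square_integrable nmu Cf, Cc_square_integrable nmu Cg).
have mT := continuous_measurable_Rd (CZ_op_continuous d0 Lf).
have := bounded delta f d0 Cf; rewrite -(EFin_Rintegral Lf.2) -EFinM.
move=> /(Rintegrable_ge0_le (measurable_funM mT mT) (fun x => sqr_ge0 _))[jT Tle].
apply: (le_trans (Rintegral_cauchy_schwarz Lg2 (conj mT jT))).
by rewrite mulrC ler_wpM2r// Rintegral_sqr_ge0.
Qed.

Definition CZ_commutator (delta : R) (f g : V -> R) (x : V) : R :=
  g x * CZ_op mu delta f x - f x * CZ_op mu delta g x.

Lemma CZ_commutator_integrable (delta : R) (f g : V -> R) : 0 < delta -> Cc f -> Cc g ->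
  Rintegrable mu (CZ_commutator delta f g).
Proof.
by move=> d0 Cf Cg; apply: RintegrableB; apply: CZ_pair_integrable => //;
  exact: (Cc_square_integrable nmu).
Qed.

Lemma CZ_pair_commutator (delta : R) (f g : V -> R) : 0 < delta -> Cc f -> Cc g ->
  CZ_pair mu delta f g = 2^-1 * \int[mu]_x CZ_commutator delta f g x.
Proof.
move=> d0 Cf Cg; have [Lf Lg] := (Cc_square_integrable nmu Cf, Cc_square_integrable nmu Cg).
have jf := CZ_pair_integrable d0 Lf Cg; have jg := CZ_pair_integrable d0 Lg Cf.
have : \int[mu]_x CZ_commutator delta f g x = CZ_pair mu delta f g + CZ_pair mu delta f g.
  rewrite {2}(CZ_pair_antisym d0 Lf Cg) (RintegralB measurableT jf jg).
  congr (_ + _); rewrite -mulN1r -(RintegralZl (-1) measurableT jg).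
  by apply: eq_Rintegral => x _; rewrite mulrN mulN1r.
by move=> ->; move: (CZ_pair _ _ _ _) => p; field.
Qed.

Lemma CZ_commutatorE (delta : R) (f g : V -> R) (x : V) : 0 < delta ->
  square_integrable mu f -> square_integrable mu g ->
  let H y := CZ_trunc s om delta (x - y) * (g x * f y - f x * g y) in
  Rintegrable mu H /\ \int[mu]_y H y = CZ_commutator delta f g x.
Proof.
move=> d0 Lf Lg H; have jf := CZ_op_integrable x d0 Lf; have jg := CZ_op_integrable x d0 Lg.
have HE : H = fun y => g x * (f y * CZ_trunc s om delta (x - y)) -
    f x * (g y * CZ_trunc s om delta (x - y)).
  by apply/funext => y; rewrite /H; ring.
have [jgf jfg] := (RintegrableZl (g x) jf, RintegrableZl (f x) jg).
rewrite HE; split; first exact: RintegrableB.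
by rewrite (RintegralB measurableT jgf jfg) !RintegralZl.
Qed.

Lemma CZ_commutator_kernel_le (delta delta' L M : R) (f g : V -> R) (x y : V) :
  0 < delta -> 0 < delta' -> (forall x, `|f x| <= M) -> (forall x, `|g x| <= M) ->
  elipschitz L f -> elipschitz L g -> 0 < enorm (y - x) ->
  `|(CZ_trunc s om delta (x - y) - CZ_trunc s om delta' (x - y)) * (g x * f y - f x * g y)|
    <= 4 * L * M * (enorm (y - x) * enorm (y - x) `^ (- s)).
Proof.
move=> d0 d'0 fM gM fL gL; rewrite enormB => xy0.
have kernel_le : `|CZ_trunc s om delta (x - y) - CZ_trunc s om delta' (x - y)| <=
    2 * enorm (x - y) `^ (- s).
  rewrite mulr_natl mulr2n; apply: (le_trans (ler_normB _ _)); apply: lerD;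
    exact: (CZ_trunc_le_enorm s0 omP).
have fg_le : `|g x * f y - f x * g y| <= 2 * L * M * enorm (x - y).
  rewrite (_ : _ - _ = (g x - g y) * f y + g y * (f y - f x)); last by ring.
  apply: (le_trans (ler_normD _ _)); rewrite !normrM.
  have := ler_pM (normr_ge0 _) (normr_ge0 _) (gL x y) (fM y).
  have := ler_pM (normr_ge0 _) (normr_ge0 _) (gM y) (fL y x).
  by rewrite (enormB y x); move: (enorm _) => e; lra.
rewrite normrM; apply: (le_trans (ler_pM (normr_ge0 _) (normr_ge0 _) kernel_le fg_le)).
by move: (enorm _) (_ `^ _) => e p; rewrite [leLHS](_ : _ = 4 * L * M * (e * p))//; ring.
Qed.

Lemma CZ_commutator_diff_le (delta delta' L M : R) (f g : V -> R) (x : V) :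
  0 < delta' -> delta' <= delta -> 0 <= L -> Cc f -> Cc g ->
  (forall x, `|f x| <= M) -> (forall x, `|g x| <= M) ->
  elipschitz L f -> elipschitz L g ->
  `|CZ_commutator delta f g x - CZ_commutator delta' f g x| <=
    4 * L * M * (near_const s Lam * delta).
Proof.
move=> d'0 dd' L0 Cf Cg fM gM fL gL; have d0 : 0 < delta by exact: lt_le_trans dd'.
have M0 : 0 <= M by apply: le_trans (fM 0).
have [Lf Lg] := (Cc_square_integrable nmu Cf, Cc_square_integrable nmu Cg).
have [jH <-] := CZ_commutatorE x d0 Lf Lg; have [jH' <-] := CZ_commutatorE x d'0 Lf Lg.
rewrite -(RintegralB measurableT jH jH').
under eq_Rintegral do rewrite -mulrBl.
have := RintegrableB jH jH'; under [X in Rintegrable _ X]eq_fun do rewrite -mulrBl.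
move=> jHH'; apply: (le_trans (le_normr_Rintegral measurableT jHH')).
apply: (Rintegrable_near nmu (Rintegrable_measurable jHH') (x := x) _ d0 (ltW s0) _ _ _).2.
- by rewrite !mulr_ge0.
- move=> y /eball_ge; rewrite enormB => xy; rewrite !CZ_trunc_far ?subrr ?mul0r//.
  exact: le_trans xy.
- by rewrite subrr !(CZ_trunc0 _ omP) subrr mul0r.
- by move=> y xy0; exact: CZ_commutator_kernel_le.
Qed.

(* Antisymmetrizing the kernel gains a factor [|x - y|], which makes the
   contribution of the region [|x - y| < delta] absolutely convergent. *)
Lemma CZ_pair_truncation (delta delta' N L M : R) (f g : V -> R) :
  0 < delta' -> delta' <= delta -> 0 < N -> 0 <= L -> Cc f -> Cc g ->
  supp_in (eball 0 N) f -> supp_in (eball 0 N) g ->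
  (forall x, `|f x| <= M) -> (forall x, `|g x| <= M) ->
  elipschitz L f -> elipschitz L g ->
  `|CZ_pair mu delta f g - CZ_pair mu delta' f g| <=
    2 * L * M * (near_const s Lam * delta) * (Lam * N `^ s).
Proof.
move=> d'0 dd' N0 L0 Cf Cg fN gN fM gM fL gL.
have d0 : 0 < delta by exact: lt_le_trans dd'.
have jW := CZ_commutator_integrable d0 Cf Cg; have jW' := CZ_commutator_integrable d'0 Cf Cg.
rewrite (CZ_pair_commutator d0 Cf Cg) (CZ_pair_commutator d'0 Cf Cg) -mulrBr.
rewrite -(RintegralB measurableT jW jW') normrM (@ger0_norm _ 2^-1)//.
have : `|\int[mu]_x (CZ_commutator delta f g x - CZ_commutator delta' f g x)| <=
    4 * L * M * (near_const s Lam * delta) * (Lam * N `^ s).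
  apply: (normr_Rintegral_le nmu (c := 0) N0).
  - exact: Rintegrable_measurable (RintegrableB jW jW').
  - by move=> x; exact: CZ_commutator_diff_le.
  - move=> x xN; rewrite /CZ_commutator (fN x xN) (gN x xN).
    by move: (CZ_op _ _ _ _) (CZ_op _ _ _ _) => p q; rewrite !mul0r !subr0.
by move: (near_const _ _ * _) (_ * _ `^ _) `|_| => p q t; lra.
Qed.

End truncated_operator.

(** * Riesz representation *)

Section inner_radius.
Context (R : realType) (d : nat).
Local Notation V := 'rV[R]_d.
Implicit Types (O : set V) (x y : V).

Let radii O x := [set r : R | 0 <= r <= 1 /\ eball x r `<=` O].

Definition inner_radius O x : R := sup (radii O x).

Let has_sup_radii O x : has_sup (radii O x).
Proof.
split; last by exists 1 => r [/andP[]].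
exists 0; split; first by rewrite lexx ler01.
by move=> y; rewrite /eball/= ltNge enorm_ge0.
Qed.

Lemma inner_radius_ge0 O x : 0 <= inner_radius O x.
Proof.
apply: (ub_le_sup (has_sup_radii O x).2); split; first by rewrite lexx ler01.
by move=> y; rewrite /eball/= ltNge enorm_ge0.
Qed.

Lemma inner_radius_supp O : supp_in O (inner_radius O).
Proof.
move=> x Ox; apply/eqP; rewrite eq_le inner_radius_ge0 andbT.
apply: (ge_sup (has_sup_radii O x).1) => r [_ xrO].
by rewrite leNgt; apply/negP => r0; apply: Ox; apply: xrO; exact: eballxx.
Qed.

Lemma inner_radius_gt0 O x : open O -> O x -> 0 < inner_radius O x.
Proof.
move=> oO Ox; have /nbhs_eballP[r r0 rO] : nbhs x O by apply: open_nbhs_nbhs.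
have m0 : 0 < Num.min r 1 by rewrite lt_min r0 ltr01.
apply: (lt_le_trans m0); apply: (ub_le_sup (has_sup_radii O x).2).
split; first by rewrite (ltW m0) ge_min lexx orbT.
by apply: subset_trans rO; apply: sub_eball; rewrite ge_min lexx.
Qed.

Lemma inner_radius_triangle O x y : inner_radius O x <= inner_radius O y + enorm (y - x).
Proof.
apply: (ge_sup (has_sup_radii O x).1) => r [/andP[r0 r1] xrO].
rewrite -lerBlDr; have [ry|ry] := leP 0 (r - enorm (y - x)); last first.
  by apply: (le_trans (ltW ry)); exact: inner_radius_ge0.
apply: (ub_le_sup (has_sup_radii O y).2); split.
  by rewrite ry/= (le_trans _ r1)// gerBl enorm_ge0.
by move=> z yz; apply: xrO; rewrite /eball/= in yz *; have := enorm_triangle y z x; lra.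
Qed.

Lemma inner_radius_lip O : elipschitz 1 (inner_radius O).
Proof.
move=> x y; have := inner_radius_triangle O x y; have := inner_radius_triangle O y x.
by rewrite (enormB y x) mul1r ler_norml; lra.
Qed.

Lemma inner_radius_continuous O : continuous (inner_radius O).
Proof. exact: elipschitz_continuous ltr01 (@inner_radius_lip O). Qed.

End inner_radius.

Section subordinate.
Context (R : realType) (d : nat).
Local Notation V := 'rV[R]_d.
Implicit Types (O W : set V) (f g : V -> R).

(* Rudin's [f \prec O], except that only [f = 0] off [O] is required of the support. *)
Definition subordinate O f : Prop :=
  [/\ Cc f, forall x, 0 <= f x <= 1 & supp_in O f].

Lemma subordinate0 O : subordinate O (fun=> 0).
Proof. by split=> // [|x]; [exact: Cc0|rewrite lexx ler01]. Qed.

Lemma subordinateS O W f : O `<=` W -> subordinate O f -> subordinate W f.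
Proof. by move=> OW [Cf f01 fO]; split=> //; exact: supp_inS fO. Qed.

(* Subtracting [eta] moves the support of [f] inside the closed set [eta <= f]. *)
Lemma subordinate_add W O f g (eta : R) : 0 < eta -> subordinate (W `&` O) f ->
  subordinate (W `&` [set x | f x < eta]) g ->
  subordinate W (fun x => f x - Num.min (f x) eta + g x).
Proof.
move=> eta0 [Cf f01 fWO] [Cg g01 gW].
have Cmin : Cc (fun x => Num.min (f x) eta).
  by apply: Cc_min_ge0 => // [|x]; [exact: cst_continuous|exact: ltW].
split=> [|x|x Wx]; first by apply: CcD => //; exact: CcB.
- have /andP[f0 f1] := f01 x; have /andP[g0 g1] := g01 x.
  have [fe|fe] := ltP (f x) eta; first by rewrite subrr add0r g0.
  rewrite (gW x) => [|[_] /=]; last by rewrite ltNge fe.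
  lra.
- rewrite gW => [|[]//]; rewrite fWO => [|[]//].
  by rewrite min_l ?(ltW eta0)// subrr addr0.
Qed.

(* Dini: on the compact set [f >= eta] the increasing functions
   [n * \sum_(i < n) inner_radius (O i)] eventually exceed 1. *)
Lemma subordinate_cover (O : nat -> set V) f (eta : R) : (forall i, open (O i)) ->
  subordinate (\bigcup_i O i) f -> 0 < eta ->
  exists n : nat, forall x, eta <= f x -> 1 <= n%:R * \sum_(i < n) inner_radius (O i) x.
Proof.
move=> oO [Cf _ fO] eta0.
have cK : compact [set x | eta <= f x].
  have [N [_ fN]] : exists N, 0 < N /\ supp_in (eball 0 N) f.
    by have [N] := Cc_support 0 Cf; exists N.
  apply: (@closed_bounded_compact _ _ N).
    by have := Cc_continuous Cf; rewrite continuous_closedP => /(_ _ (@closed_ge R eta)).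
  move=> x /= etaf; rewrite leNgt -[x]subr0; apply/negP => /ltW/eball_ge/fN fx.
  by rewrite fx leNgt eta0 in etaf.
have /compact_near_coveringP cover := cK.
have [|n _ /(_ n (leqnn n))] :=
    cover nat \oo (fun n x => 1 <= n%:R * \sum_(i < n) inner_radius (O i) x) _;
  last by move=> nf; exists n.
move=> x /= etafx; have [i _ Oix] : (\bigcup_i O i) x.
  by apply: contrapT => /fO fx; rewrite fx leNgt eta0 in etafx.
set r := inner_radius (O i) x.
have r0 : 0 < r by exact: inner_radius_gt0.
pose n0 := maxn i.+1 (Num.truncn (2 / r)).+1.
exists (eball x (r / 2), [set n | (n0 <= n)%N]) => /=.
  by split; [apply: nbhs_eball; rewrite divr_gt0|exists n0].
move=> [x' n] [/= xx' n0n]; have i_lt_n : (i < n)%N by apply: leq_trans n0n; rewrite leq_maxl.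
have r2 : r / 2 <= inner_radius (O i) x'.
  by rewrite /eball/= in xx'; have := inner_radius_triangle (O i) x x'; rewrite -/r; lra.
have n2 : 2 / r <= n%:R.
  apply: (le_trans (ltW (truncnS_gt _))); rewrite ler_nat.
  by apply: leq_trans n0n; rewrite leq_maxr.
rewrite [leLHS](_ : _ = 2 / r * (r / 2)); last by field; rewrite gt_eqF.
apply: ler_pM => //; [by rewrite divr_ge0// ltW|by rewrite divr_ge0// ltW|].
apply: (le_trans r2); rewrite (bigD1 (Ordinal i_lt_n))//= lerDl sumr_ge0// => j _.
exact: inner_radius_ge0.
Qed.

Lemma subordinate_partition (O : nat -> set V) f n : subordinate setT f ->
  exists F : nat -> V -> R, (forall i, subordinate (O i) (F i)) /\
    forall x, \sum_(i < n) F i x =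
      Num.min (f x) (n%:R * \sum_(i < n) inner_radius (O i) x).
Proof.
move=> [Cf f01 _]; pose S i x := n%:R * \sum_(j < i) inner_radius (O j) x.
have S_ge0 i x : 0 <= S i x by rewrite mulr_ge0// sumr_ge0// => j _; exact: inner_radius_ge0.
have S_recr i x : S i.+1 x = S i x + n%:R * inner_radius (O i) x.
  by rewrite /S big_ord_recr mulrDr.
have Cmin i : Cc (fun x => Num.min (f x) (S i x)).
  apply: Cc_min_ge0 => //; apply: continuous_funM; first exact: cst_continuous.
  by apply: continuous_fun_sum => j; exact: inner_radius_continuous.
exists (fun i x => Num.min (f x) (S i.+1 x) - Num.min (f x) (S i x)); split=> [i|x].
  split; first exact: CcB.
  - move=> x; have /andP[f0 f1] := f01 x; have Si := S_ge0 i x.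
    have : S i x <= S i.+1 x by rewrite S_recr lerDl mulr_ge0// inner_radius_ge0.
    by rewrite !minEle; case: (leP (f x) (S i.+1 x)) => ?; case: (leP (f x) (S i x)) => ?; lra.
  - by move=> x /inner_radius_supp Ox; rewrite S_recr Ox mulr0 addr0 subrr.
rewrite -(big_mkord xpredT (fun i => Num.min (f x) (S i.+1 x) - Num.min (f x) (S i x))).
rewrite (telescope_sumr (fun i => Num.min (f x) (S i x)))// /S big_ord0 mulr0.
by have /andP[f0 _] := f01 x; rewrite (min_r f0) subr0.
Qed.

Lemma subordinate_bigcup (O : nat -> set V) f (eta : R) : (forall i, open (O i)) ->
  subordinate (\bigcup_i O i) f -> 0 < eta ->
  exists n (F : nat -> V -> R), (forall i, subordinate (O i) (F i)) /\
    forall x, f x <= \sum_(i < n) F i x + eta.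
Proof.
move=> oO Of eta0; have [n nO] := subordinate_cover oO Of eta0.
have [F [FO sumF]] := subordinate_partition O n (subordinateS (@subsetT _ _) Of).
exists n, F; split=> // x; have [_ /(_ x)/andP[f0 f1] _] := Of; rewrite sumF.
have [fx|fx] := leP eta (f x); last first.
  apply: (le_trans (ltW fx)); rewrite lerDr le_min f0 mulr_ge0// sumr_ge0// => i _.
  exact: inner_radius_ge0.
by rewrite min_l ?lerDl ?(ltW eta0)// (le_trans f1)// nO.
Qed.

End subordinate.

Section slices.
Context {R : realType}.
Variable n : nat.

(* The part of [u] lying between [k / n.+1] and [k.+1 / n.+1], rescaled to height 1. *)
Definition slice (k : nat) (u : R) : R :=
  n.+1%:R * (Num.min u (k.+1%:R / n.+1%:R) - Num.min u (k%:R / n.+1%:R)).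

Let levelS k : k.+1%:R / n.+1%:R = k%:R / n.+1%:R + n.+1%:R^-1 :> R.
Proof. by rewrite -natr1 mulrDl mul1r. Qed.

Lemma slice_itv01 k u : 0 <= slice k u <= 1.
Proof.
have n0 : 0 < n.+1%:R^-1 :> R by rewrite invr_gt0.
rewrite /slice levelS -[X in _ && (_ <= X)](@mulfV _ n.+1%:R)// ler_pM2l// mulr_ge0//=;
  move: n.+1%:R^-1 n0 (k%:R / _) => t t0 v; rewrite !minEle;
  by case: (leP u (v + t)) => ?; case: (leP u v) => ?; lra.
Qed.

Lemma slice0 k u : u <= k%:R / n.+1%:R -> slice k u = 0.
Proof.
by move=> uk; rewrite /slice !min_l ?subrr ?mulr0// levelS (le_trans uk)// lerDl invr_ge0.
Qed.

Lemma slice1 k u : k.+1%:R / n.+1%:R <= u -> slice k u = 1.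
Proof.
move=> ku; rewrite /slice !min_r//; first by rewrite levelS addrAC subrr add0r mulfV.
by apply: le_trans ku; rewrite levelS lerDl invr_ge0.
Qed.

Lemma sum_slice u : 0 <= u <= 1 -> \sum_(k < n.+1) slice k u = n.+1%:R * u.
Proof.
move=> /andP[u0 u1]; rewrite -mulr_sumr; congr (_ * _).
rewrite -(big_mkord xpredT (fun k => Num.min u (k.+1%:R / n.+1%:R) - Num.min u (k%:R / n.+1%:R))).
rewrite (telescope_sumr (fun k => Num.min u (k%:R / n.+1%:R)))// mul0r (min_r u0) subr0.
by rewrite mulfV// min_l.
Qed.

Lemma Cc_slice (d : nat) (f : 'rV[R]_d -> R) k : Cc f -> Cc (fun x => slice k (f x)).
Proof.
move=> Cf; have Cmin (t : R) : 0 <= t -> Cc (fun x => Num.min (f x) t).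
  by move=> t0; apply: Cc_min_ge0 => //; exact: cst_continuous.
by apply: CcZ; apply: CcB; apply: Cmin; rewrite divr_ge0.
Qed.

End slices.

Section riesz.
Context (R : realType) (d : nat).
Local Notation V := 'rV[R]_d.
Local Notation X := (Rd R d).
Implicit Types (O W A : set V) (f g : V -> R).

Definition Cc_positive (l : (V -> R) -> R) : Prop :=
  Cc_linear l /\ forall f, Cc f -> (forall x, 0 <= f x) -> 0 <= l f.

Variable lam : (V -> R) -> R.
Hypothesis posl : Cc_positive lam.

Let linl : Cc_linear lam. Proof. by case: posl. Qed.

Lemma Cc_positive_le f g : Cc f -> Cc g -> (forall x, f x <= g x) -> lam f <= lam g.
Proof.
move=> Cf Cg fg; rewrite -subr_ge0 -(Cc_linearB linl)//.
by case: posl => _; apply=> [|x]; [exact: CcB|rewrite subr_ge0].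
Qed.

Lemma Cc_positive_approx f (e : R) : Cc f -> 0 < e ->
  exists2 eta : R, 0 < eta & forall g, Cc g -> (forall x, 0 <= g x) ->
    (forall x, f x <= g x + eta) -> lam f <= lam g + e.
Proof.
move=> Cf e0; have [N N0 fN] := Cc_support 0 Cf.
have Cchi := cutoff_Cc (0 : V) N0; set C := lam (cutoff 0 N).
have C0 : 0 <= C by case: posl => _; apply=> // x; exact: cutoff_ge0.
have C1 : 0 < C + 1 by lra.
exists (e / (C + 1)); first by rewrite divr_gt0.
move=> g Cg g0 fg; apply: (@le_trans _ _ (lam g + e / (C + 1) * C)); last first.
  by rewrite lerD2l mulrAC ler_pdivrMr// ler_wpM2l ?(ltW e0)//; lra.
rewrite /C -(Cc_linearZ linl)// -(Cc_linearD linl)//; last exact: CcZ.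
apply: Cc_positive_le => //; first by apply: CcD => //; exact: CcZ.
move=> x; have [xN|/ltW/eball_ge/fN ->] := leP (enorm (x - 0)) N.
  by rewrite cutoff1// mulr1.
by rewrite addr_ge0// mulr_ge0 ?cutoff_ge0// divr_ge0// ltW.
Qed.

Definition riesz_content O : \bar R := ereal_sup [set (lam f)%:E | f in subordinate O].

Definition riesz_outer A : \bar R :=
  ereal_inf [set riesz_content O | O in [set O | open O /\ A `<=` O]].

Lemma riesz_content_ge O f : subordinate O f -> ((lam f)%:E <= riesz_content O)%E.
Proof. by move=> Of; apply: ereal_sup_ubound; exists f. Qed.

Lemma riesz_content_le O (c : \bar R) :
  (forall f, subordinate O f -> ((lam f)%:E <= c)%E) -> (riesz_content O <= c)%E.
Proof. by move=> Oc; apply: ge_ereal_sup => _ [f /Oc + <-]. Qed.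

Lemma riesz_content_ge0 O : (0 <= riesz_content O)%E.
Proof. by have := riesz_content_ge (subordinate0 O); rewrite (Cc_linear0 linl). Qed.

Lemma riesz_contentS O W : O `<=` W -> (riesz_content O <= riesz_content W)%E.
Proof.
by move=> OW; apply: riesz_content_le => f /(subordinateS OW)/riesz_content_ge.
Qed.

Lemma riesz_content_adherent O (e : R) : (riesz_content O < +oo)%E -> 0 < e ->
  exists2 f, subordinate O f & (riesz_content O <= (lam f + e)%:E)%E.
Proof.
move=> Oy e0; have Ofin : riesz_content O \is a fin_num.
  by rewrite ge0_fin_numE ?riesz_content_ge0.
have [_ [f Of <-]] := ub_ereal_sup_adherent e0 Ofin.
by rewrite lteBlDr// => /ltW; exists f.
Qed.

Lemma riesz_outer_ge0 A : (0 <= riesz_outer A)%E.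
Proof. by apply: le_ereal_inf_tmp => _ [W _ <-]; exact: riesz_content_ge0. Qed.

Lemma riesz_outer_le A O : open O -> A `<=` O -> (riesz_outer A <= riesz_content O)%E.
Proof. by move=> oO AO; apply: ereal_inf_lbound; exists O. Qed.

Lemma riesz_outer_open O : open O -> riesz_outer O = riesz_content O.
Proof.
move=> oO; apply/eqP; rewrite eq_le riesz_outer_le//=.
by apply: le_ereal_inf_tmp => _ [W [_ OW] <-]; exact: riesz_contentS.
Qed.

Lemma riesz_outerS A B : A `<=` B -> (riesz_outer A <= riesz_outer B)%E.
Proof.
move=> AB; apply: le_ereal_inf_tmp => _ [W [oW BW] <-]; apply: riesz_outer_le => //.
exact: subset_trans BW.
Qed.

Lemma riesz_outer0 : riesz_outer set0 = 0%E.
Proof.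
apply/eqP; rewrite eq_le riesz_outer_ge0 andbT riesz_outer_open; last exact: open0.
apply: riesz_content_le => f [_ _ f0]; rewrite lee_fin (_ : f = fun=> 0) ?(Cc_linear0 linl)//.
by apply/funext => x; apply: f0.
Qed.

Lemma riesz_content_bigcup (O : nat -> set V) : (forall i, open (O i)) ->
  (riesz_content (\bigcup_i O i) <= \sum_(i <oo) riesz_content (O i))%E.
Proof.
move=> oO; apply: riesz_content_le => f Of; have [Cf _ _] := Of.
apply/lee_addgt0Pr => e e0; have [eta eta0 feta] := Cc_positive_approx Cf e0.
have [n [F [FO Ff]]] := subordinate_bigcup oO Of eta0.
have CF i : Cc (F i) by case: (FO i).
have F0 i x : 0 <= F i x by case: (FO i) => _ /(_ x)/andP[].
apply: (@le_trans _ _ ((\sum_(i < n) lam (F i))%:E + e%:E)%E).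
  rewrite -EFinD lee_fin -(Cc_linear_sum linl)//; apply: feta => //; first exact: Cc_sum.
  by move=> x; exact: sumr_ge0.
rewrite leeD2r// -sumEFin; apply: (@le_trans _ _ (\sum_(i < n) riesz_content (O i))%E).
  by apply: lee_sum => i _; exact: riesz_content_ge.
rewrite -(big_mkord xpredT (fun i => riesz_content (O i))).
by apply: nneseries_lim_ge => k _ _; exact: riesz_content_ge0.
Qed.

Lemma riesz_outer_sigma_subadditive : sigma_subadditive riesz_outer.
Proof.
move=> A; have [[i ioo]|] := pselect (exists i, riesz_outer (A i) = +oo%E).
  rewrite (eseries_pinfty _ _ ioo) ?leey// => n _.
  by rewrite -ltNye (lt_le_trans _ (riesz_outer_ge0 _)).
rewrite -forallNE => Aoo; apply/lee_addgt0Pr => e e0.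
rewrite (le_trans _ (epsilon_trick _ _ (ltW e0)))//; last first.
  by move=> n; exact: riesz_outer_ge0.
have /choice[G AG] : forall n, exists O, [/\ open O, A n `<=` O &
    (riesz_content O <= riesz_outer (A n) + (e / (2 ^ n.+1)%:R)%:E)%E].
  move=> n; have en0 : 0 < e / (2 ^ n.+1)%:R by rewrite divr_gt0// ltr0n expn_gt0.
  have Anfin : riesz_outer (A n) \is a fin_num.
    by rewrite ge0_fin_numE ?riesz_outer_ge0// ltey; apply/eqP.
  have [_ [W [oW AW] <-] We] := lb_ereal_inf_adherent en0 Anfin.
  by exists W; split=> //; exact: ltW.
apply: (@le_trans _ _ (riesz_content (\bigcup_n G n))).
  apply: riesz_outer_le; first by apply: bigcup_open => n _; case: (AG n).
  by apply: subset_bigcup => n _; case: (AG n).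
apply: (le_trans (riesz_content_bigcup _)); first by move=> n; case: (AG n).
by apply: lee_nneseries => [n _ _|n _]; [exact: riesz_content_ge0|case: (AG n)].
Qed.

Let outer : {outer_measure set V -> \bar R} :=
  HB.pack_for (outer_measure R V) riesz_outer
    (isOuterMeasure.Build R V riesz_outer riesz_outer0 riesz_outer_ge0 riesz_outerS
      riesz_outer_sigma_subadditive).

Lemma riesz_content_setID W O : open W -> open O -> (riesz_content W < +oo)%E ->
  (riesz_outer (W `&` O) + riesz_outer (W `&` ~` O) <= riesz_content W)%E.
Proof.
move=> oW oO Wy; apply/lee_addgt0Pr => e e0; have e30 : 0 < e / 3 by rewrite divr_gt0.
have finI B : (riesz_content (W `&` B) < +oo)%E.
  by apply: le_lt_trans Wy; apply: riesz_contentS; exact: subIsetl.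
have [f Of fO] := riesz_content_adherent (finI O) e30; have [Cf f01 fWO] := Of.
have [eta eta0 feta] := Cc_positive_approx Cf e30.
have [g Wg gW] := riesz_content_adherent (finI [set x | (f x < eta)%R]) e30.
have WfgP := subordinate_add eta0 Of Wg.
have Cmin : Cc (fun x => Num.min (f x) eta).
  by apply: Cc_min_ge0 => // [|x]; [exact: cst_continuous|exact: ltW].
have Cf' : Cc (fun x => f x - Num.min (f x) eta) by exact: CcB.
have f'_ge : lam f <= lam (fun x => f x - Num.min (f x) eta) + e / 3.
  apply: feta => // x; first by rewrite subr_ge0 ge_min lexx.
  by rewrite -addrA lerDl addrC subr_ge0 ge_min lexx orbT.
have WO_le : (riesz_outer (W `&` O) <= riesz_content (W `&` O))%E.
  by apply: riesz_outer_le => //; exact: openI.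
have WnO_le : (riesz_outer (W `&` ~` O) <= riesz_content (W `&` [set x | (f x < eta)%R]))%E.
  apply: riesz_outer_le.
    apply: openI => //; have := Cc_continuous Cf.
    by move=> /continuousP/(_ _ (@open_lt R eta)).
  by move=> x [Wx Ox]; split=> //=; rewrite fWO// => -[].
apply: (le_trans (leeD (le_trans WO_le fO) (le_trans WnO_le gW))).
apply: (le_trans _ (leeD2r _ (riesz_content_ge WfgP))).
rewrite (Cc_linearD linl Cf'); last by case: Wg.
by rewrite -!EFinD lee_fin; move: f'_ge; lra.
Qed.

Lemma riesz_caratheodory_open O : open O -> caratheodory_measurable riesz_outer O.
Proof.
move=> oO; apply: (@le_caratheodory_measurable R V outer) => A /=.
apply: le_ereal_inf_tmp => _ [W [oW AW] <-].
have [Wy|] := ltP (riesz_content W) +oo%E; last by move=> /(le_trans _); apply; exact: leey.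
by apply: le_trans (riesz_content_setID oW oO Wy); apply: leeD;
  apply: riesz_outerS; exact: setSI.
Qed.

Lemma riesz_caratheodory : (@measurable _ X) `<=` caratheodory_measurable riesz_outer.
Proof.
apply: smallest_sub; last by move=> O oO; exact: riesz_caratheodory_open.
exact: (sigma_algebra_measurable (caratheodory_type outer)).
Qed.

Lemma riesz_semi_sigma_additive : semi_sigma_additive (riesz_outer : set X -> \bar R).
Proof.
move=> F mF tF mUF; apply: (@caratheodory_measure_sigma_additive R V outer F) => //.
- by move=> n; exact: riesz_caratheodory.
- exact: riesz_caratheodory.
Qed.

Definition riesz_measure : bmeasure R d :=
  HB.pack_for (bmeasure R d) (riesz_outer : set X -> \bar R)
    (isMeasure.Build _ X R (riesz_outer : set X -> \bar R) riesz_outer0 riesz_outer_ge0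
      riesz_semi_sigma_additive).

Local Notation nu := riesz_measure.

Lemma riesz_measure_ge O f : open O -> subordinate O f -> ((lam f)%:E <= nu O)%E.
Proof. by move=> oO /riesz_content_ge; rewrite -(riesz_outer_open oO). Qed.

Lemma riesz_measure_le O (c : R) : open O ->
  (forall f, subordinate O f -> lam f <= c) -> (nu O <= c%:E)%E.
Proof.
move=> oO Oc; rewrite [nu O](riesz_outer_open oO).
by apply: riesz_content_le => f /Oc; rewrite lee_fin.
Qed.

Lemma riesz_measure_superlevel_lty f (t : R) : Cc f -> 0 <= t ->
  (nu [set x | (t < f x)%R] < +oo)%E.
Proof.
move=> Cf t0; have [N N0 fN] := Cc_support 0 Cf.
apply: le_lt_trans (ltry (lam (cutoff 0 N))).
apply: riesz_measure_le; first by apply: open_superlevel; exact: Cc_continuous.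
move=> g [Cg g01 g0]; apply: Cc_positive_le => //; first exact: cutoff_Cc.
move=> x; have [xN|/ltW/eball_ge/fN fx] := leP (enorm (x - 0)) N.
  by rewrite cutoff1//; case/andP: (g01 x).
by rewrite g0 ?cutoff_ge0//= fx; apply/negP; rewrite -leNgt.
Qed.

Section slice_estimates.
Variables (f : V -> R) (n : nat).
Hypotheses (Cf : Cc f) (f01 : forall x, 0 <= f x <= 1).

Let E k : set X := [set x | k%:R / n.+1%:R < f x].
Let oE k : open (E k). Proof. by apply: open_superlevel; exact: Cc_continuous. Qed.
Let mE k : measurable (E k). Proof. exact: open_measurable_Rd. Qed.
Let Ey k : (nu (E k) < +oo)%E.
Proof. by apply: riesz_measure_superlevel_lty => //; rewrite divr_ge0. Qed.
Let slice_supp k : supp_in (E k) (fun x => slice n k (f x)).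
Proof. by move=> x /negP; rewrite -leNgt; exact: slice0. Qed.

Lemma riesz_slice_lam k :
  fine (nu (E k.+1)) <= lam (fun x => slice n k (f x)) <= fine (nu (E k)).
Proof.
rewrite -!lee_fin !fineK ?ge0_fin_numE//; apply/andP; split; last first.
  apply: riesz_measure_ge => //; split; [exact: Cc_slice|by move=> x; exact: slice_itv01|].
  exact: slice_supp.
apply: riesz_measure_le => // g [Cg g01 gE]; apply: Cc_positive_le => //.
  exact: Cc_slice.
move=> x; have [Ex|/gE ->] := pselect (E k.+1 x); last by case/andP: (slice_itv01 n k (f x)).
by rewrite slice1 ?(ltW Ex)//; case/andP: (g01 x).
Qed.

Lemma riesz_slice_Rintegral k : Rintegrable nu (fun x => slice n k (f x)) /\
  fine (nu (E k.+1)) <= \int[nu]_x slice n k (f x) <= fine (nu (E k)).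
Proof.
have [js sle] := Rintegral_le_measure (mE k) (Ey k)
  (Cc_measurable (Cc_slice n k Cf)) (fun x => slice_itv01 n k (f x)) (@slice_supp k).
split=> //; rewrite sle andbT; apply: measure_le_Rintegral => // x.
  by case/andP: (slice_itv01 n k (f x)).
by move=> /ltW Ex; rewrite slice1.
Qed.

Lemma riesz_slice_approx : Rintegrable nu f ->
  n.+1%:R * `|lam f - \int[nu]_x f x| <= fine (nu [set x | (0 < f x)%R]).
Proof.
move=> jf; rewrite -[X in X * _](@ger0_norm _ n.+1%:R)// -normrM mulrBr.
have -> : n.+1%:R * lam f = \sum_(k < n.+1) lam (fun x => slice n k (f x)).
  rewrite -(Cc_linearZ linl)// -(Cc_linear_sum linl); last by move=> k; exact: Cc_slice.
  by congr lam; apply/funext => x; rewrite sum_slice.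
have -> : n.+1%:R * \int[nu]_x f x = \sum_(k < n.+1) \int[nu]_x slice n k (f x).
  rewrite -(RintegralZl n.+1%:R measurableT jf) -Rintegral_sum; last first.
    by move=> k; case: (riesz_slice_Rintegral k).
  by apply: eq_Rintegral => x _; rewrite sum_slice.
rewrite -sumrB; apply: (le_trans (ler_norm_sum _ _ _)).
apply: (@le_trans _ _ (\sum_(k < n.+1) (fine (nu (E k)) - fine (nu (E k.+1))))).
  apply: ler_sum => k _; have [_] := riesz_slice_Rintegral k; have := riesz_slice_lam k.
  move: (\int[nu]_x _) (lam _) (fine (nu (E k))) (fine (nu (E k.+1))) => p q u v.
  by rewrite ler_norml; lra.
rewrite -(big_mkord xpredT (fun k => fine (nu (E k)) - fine (nu (E k.+1)))).
under eq_bigr do rewrite -opprB.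
rewrite sumrN telescope_sumr// opprB (_ : E 0 = [set x | 0 < f x]); last by rewrite /E mul0r.
by rewrite gerBl fine_ge0.
Qed.

End slice_estimates.

Lemma riesz_measure_itv01 f : Cc f -> (forall x, 0 <= f x <= 1) ->
  Rintegrable nu f /\ \int[nu]_x f x = lam f.
Proof.
move=> Cf f01; have osupp : open [set x | 0 < f x].
  by apply: open_superlevel; exact: Cc_continuous.
have jf : Rintegrable nu f.
  have [] // := Rintegral_le_measure (open_measurable_Rd osupp)
    (riesz_measure_superlevel_lty Cf (lexx 0)) (Cc_measurable Cf) f01.
  move=> x /negP; rewrite -leNgt => fx.
  by apply/eqP; rewrite eq_le fx; case/andP: (f01 x).
split=> //; apply/eqP; rewrite eq_sym -subr_eq0 -normr_eq0; apply/negPn/negP => ne0.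
have pos : 0 < `|lam f - \int[nu]_x f x| by rewrite lt_def ne0 normr_ge0.
pose A := fine (nu [set x | (0 < f x)%R]).
have := riesz_slice_approx (Num.truncn (A / `|lam f - \int[nu]_x f x|)) Cf f01 jf.
by rewrite leNgt -ltr_pdivrMr// truncnS_gt.
Qed.

Lemma riesz_measureE f : Cc f -> \int[nu]_x f x = lam f.
Proof.
move=> Cf; have [M M0 fM] := Cc_bounded Cf.
pose pospart g x := M^-1 * Num.max (g x) 0.
have Cpos g : Cc g -> Cc (pospart g) by move=> Cg; apply/CcZ/Cc_max/Cc0.
have pos01 g : (forall x, `|g x| <= M) -> forall x, 0 <= pospart g x <= 1.
  move=> gM x; rewrite mulr_ge0 ?invr_ge0 ?(ltW M0) ?le_max ?lexx ?orbT//=.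
  rewrite ler_pdivrMl// mulr1 ge_max (ltW M0) andbT.
  exact: le_trans (ler_norm _) (gM x).
have C1 := Cpos f Cf; have C2 := Cpos (fun x => - f x) (CcN Cf).
have [j1 e1] := riesz_measure_itv01 C1 (pos01 f fM).
have [|j2 e2] := riesz_measure_itv01 C2 (pos01 (fun x => - f x) _).
  by move=> x; rewrite normrN.
have fE : f = fun x => M * pospart f x - M * pospart (fun x => - f x) x.
  apply/funext => x; rewrite /pospart !mulrA mulfV ?gt_eqF// !mul1r !maxEle.
  by case: (leP (f x) 0) => ?; case: (leP (- f x) 0) => ?; lra.
rewrite [in RHS]fE (Cc_linearB linl); [|exact: CcZ|exact: CcZ].
rewrite (Cc_linearZ linl M C1) (Cc_linearZ linl M C2) -e1 -e2.
rewrite -(RintegralZl M measurableT j1) -(RintegralZl M measurableT j2).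
rewrite -(RintegralB measurableT (RintegrableZl M j1) (RintegrableZl M j2)).
by apply: eq_Rintegral => x _; rewrite {1}fE.
Qed.

End riesz.

Theorem riesz_representation (R : realType) (d : nat) (lam : ('rV[R]_d -> R) -> R) :
  Cc_positive lam -> exists nu : bmeasure R d,
    (forall f, Cc f -> \int[nu]_x f x = lam f) /\
    forall O (c : R), open O -> (forall f, subordinate O f -> lam f <= c) -> (nu O <= c%:E)%E.
Proof.
move=> posl; exists (riesz_measure posl); split; first exact: riesz_measureE.
exact: riesz_measure_le.
Qed.

(** * Weak limits along an ultrafilter *)

Section ultrafilter_limits.
Context {R : realType}.
Variables (U : set_system nat) (UF : UltraFilter U).

Lemma ultra_fmap (T : Type) (a : nat -> T) : UltraFilter (a @ U).
Proof.
split; first exact: fmap_proper_filter.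
move=> G PG sub; apply/seteqP; split; last exact: sub.
move=> A GA; have [//|UnA] := in_ultra_setVsetC (a @^-1` A) UF.
have GnA : G (~` A) by exact: sub.
have G0 : G set0 by rewrite -(setICr A); exact: filterI.
by exfalso; exact: (filter_not_empty G G0).
Qed.

Lemma ultra_bounded_cvg (a : nat -> R) (M : R) : (forall n, `|a n| <= M) ->
  cvg (a @ U).
Proof.
move=> aM; have := @segment_compact R (- M) M.
rewrite compact_ultra => /(_ (a @ U) (ultra_fmap a)) [|l [_ al]]; last first.
  by apply/cvg_ex; exists l.
apply: (@filterS _ U _ setT) => [n _ /=|]; last exact: filterT.
by rewrite in_itv/= -ler_norml; exact: aM.
Qed.

Lemma Cc_linear_ultralim (d : nat) (l_ : nat -> ('rV[R]_d -> R) -> R) :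
  (forall n, Cc_linear (l_ n)) ->
  (forall f, Cc f -> exists M, forall n, `|l_ n f| <= M) ->
  exists l, Cc_linear l /\ forall f, Cc f -> l_ n f @[n --> U] --> l f.
Proof.
move=> linl bnd; pose l f := lim (l_ n f @[n --> U]).
have cvl f : Cc f -> l_ n f @[n --> U] --> l f.
  by move=> /bnd[M fM]; exact: ultra_bounded_cvg fM.
exists l; split=> //; split=> [f g Cf Cg|a f Cf]; apply: cvg_lim => //.
  under eq_fun do rewrite Cc_linearD//.
  by apply: cvgD; exact: cvl.
under eq_fun do rewrite Cc_linearZ//.
by apply: cvgMr; exact: cvl.
Qed.

End ultrafilter_limits.

Section weak_limit.
Context (R : realType) (d : nat).

Definition weak_cvg (U : set_system nat) (mu_ : nat -> bmeasure R d) (nu : bmeasure R d) : Prop :=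
  forall f, Cc f -> (\int[mu_ j]_x f x) @[j --> U] --> \int[nu]_x f x.

Lemma Cc_linear_Rintegral1 (s Lam : R) (mu : bmeasure R d) : nice s Lam mu ->
  Cc_linear (fun f => \int[mu]_x f x).
Proof.
move=> nmu; split=> [f g Cf Cg|a f Cf].
  exact: (RintegralD measurableT (Cc_Rintegrable nmu Cf) (Cc_Rintegrable nmu Cg)).
exact: (RintegralZl a measurableT (Cc_Rintegrable nmu Cf)).
Qed.

Lemma weak_limit_exists (s Lam : R) (U : set_system nat) (mu_ : nat -> bmeasure R d) :
  UltraFilter U -> (forall j, nice s Lam (mu_ j)) ->
  exists nu : bmeasure R d, nice s Lam nu /\ weak_cvg U mu_ nu.
Proof.
move=> UF nmu; have [f Cf|lam [linl cvl]] :=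
  Cc_linear_ultralim UF (fun j => Cc_linear_Rintegral1 (nmu j)) _.
  have [N N0 fN] := Cc_support 0 Cf; have [M _ fM] := Cc_bounded Cf.
  exists (M * (Lam * N `^ s)) => j.
  exact: (normr_Rintegral_le (nmu j) N0 (Cc_measurable Cf) fM fN).
have posl : Cc_positive lam.
  split=> // f Cf f0; apply: (cvgr_to_ge (cvl f Cf)).
  by apply: nearW => j; apply: Rintegral_ge0 => x _; exact: f0.
have [nu [nuE nu_le]] := riesz_representation posl.
exists nu; split; last by move=> f Cf; rewrite nuE//; exact: cvl.
move=> x r r0; apply: nu_le => [|f [Cf f01 fx]]; first exact: open_eball.
apply: (cvgr_to_le (cvl f Cf)); apply: nearW => j; apply: (le_trans (ler_norm _)).
rewrite -[Lam * _]mul1r.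
apply: (normr_Rintegral_le (nmu j) r0 (Cc_measurable Cf) _ fx) => y.
by have /andP[f0 f1] := f01 y; rewrite ger0_norm.
Qed.

End weak_limit.

Section bounded_operator.
Context (R : realType) (d : nat).
Local Notation V := 'rV[R]_d.
Local Notation X := (Rd R d).
Variables (s Lam : R) (nu : bmeasure R d).
Hypothesis nnu : nice s Lam nu.

Lemma integral_le_cutoff (h : V -> R) (B : R) : continuous h -> (forall x, 0 <= h x) ->
  (forall n, \int[nu]_x (h x * cutoff 0 n.+1%:R x) <= B) ->
  (\int[nu]_x (h x)%:E <= B%:E)%E.
Proof.
move=> ch h0 hB; pose F n x := h x * cutoff 0 n.+1%:R x.
have CF n : Cc (F n) by apply: CcMl => //; apply: cutoff_Cc; rewrite ltr0n.
have F0 n x : 0 <= F n x by rewrite mulr_ge0// cutoff_ge0.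
have cvF x : (F n x)%:E @[n --> \oo] --> (h x)%:E.
  apply: cvg_EFin; first exact: nearW.
  apply/cvgrPdist_le => e e0; exists (Num.truncn (enorm x)) => // n /= xn.
  rewrite /F cutoff1 ?mulr1 ?subrr ?normr0 ?ltW// ?ltr0n//.
  by rewrite subr0 (lt_le_trans (truncnS_gt _))// ler_nat ltnS.
have mF n : measurable_fun setT (fun x : X => (F n x)%:E).
  by apply/measurable_EFinP; exact: (Cc_measurable (CF n)).
have -> : (\int[nu]_x (h x)%:E = \int[nu]_x limn_einf (fun n => (F n x)%:E))%E.
  by apply: eq_integral => x _; rewrite is_cvg_limn_einfE ?(cvg_lim _ (cvF x))//.
apply: (le_trans (fatou nu measurableT mF _)); first by move=> n x _; rewrite lee_fin.
rewrite (_ : (fun n => _) = fun n => (\int[nu]_x F n x)%:E); last first.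
  by apply/funext => n; rewrite EFin_Rintegral//; exact: (Cc_Rintegrable nnu).
rewrite limn_einf_lim; apply: lime_le; first exact: is_cvg_einfs.
apply: nearW => n; apply: (@le_trans _ _ (\int[nu]_x F n x)%:E); last by rewrite lee_fin hB.
by apply: ereal_inf_lbound; exists n => //=.
Qed.

(* Test the continuous function [h] against its own truncations. *)
Lemma integral_sqr_dual_le (h : V -> R) (B : R) : continuous h -> 0 <= B ->
  (forall g, Cc g -> (\int[nu]_x (g x * h x)) ^+ 2 <= B * \int[nu]_x (g x ^+ 2)) ->
  (\int[nu]_x (h x ^+ 2)%:E <= B%:E)%E.
Proof.
move=> ch B0 hB; apply: integral_le_cutoff => [|x|n]; first exact: continuous_funM.
  exact: sqr_ge0.
pose chi := @cutoff R d 0 n.+1%:R; have Cchi : Cc chi by apply: cutoff_Cc; rewrite ltr0n.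
have Ch2 : Cc (fun x => h x ^+ 2 * chi x) by apply: CcMl => //; exact: continuous_funM.
have Chchi : Cc (fun x => h x * chi x) by exact: CcMl.
have := hB _ Chchi; set I := \int[nu]_x (h x ^+ 2 * chi x).
have -> : \int[nu]_x (h x * chi x * h x) = I.
  by apply: eq_Rintegral => x _; rewrite expr2 mulrAC.
have I0 : 0 <= I.
  by apply: Rintegral_ge0 => x _; rewrite mulr_ge0 ?sqr_ge0// cutoff_ge0.
have sqrI : \int[nu]_x ((h x * chi x) ^+ 2) <= I.
  apply: (le_Rintegral measurableT (Cc_Rintegrable nnu (Cc_sqr Chchi)) (Cc_Rintegrable nnu Ch2)).
  move=> x _; rewrite exprMn ler_wpM2l ?sqr_ge0// expr2.
  by rewrite ler_piMr ?cutoff_ge0 ?cutoff_le1.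
move=> IB; have {IB} : I ^+ 2 <= B * I by apply: (le_trans IB); rewrite ler_wpM2l.
by have [->//|I1] := eqVneq I 0; rewrite expr2 ler_pM2r// lt_def I1.
Qed.

Variables (alpha : R) (om : V -> R) (Lg : R).
Hypotheses (s0 : 0 < s) (omP : CZ_profile alpha om).

Definition CZ_bounded (mu : bmeasure R d) : Prop :=
  forall (delta : R) (f : V -> R), 0 < delta -> square_integrable mu f ->
    (\int[mu]_x (CZ_op s om mu delta f x ^+ 2)%:E <=
      (Lg ^+ 2 * \int[mu]_x (f x ^+ 2))%:E)%E.

Let bound_ge0 (f : V -> R) : 0 <= Lg ^+ 2 * \int[nu]_x (f x ^+ 2).
Proof. by rewrite mulr_ge0 ?sqr_ge0 ?Rintegral_sqr_ge0. Qed.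

Lemma CZ_bounded_Cc_bounded : CZ_bounded_Cc s om Lg nu -> CZ_bounded nu.
Proof.
move=> bounded delta f d0 Lf; apply: integral_sqr_dual_le => // [|g Cg].
  exact: (CZ_op_continuous s0 omP nnu d0 Lf).
have Lg2 := Cc_square_integrable nnu Cg.
have mT := continuous_measurable_Rd (CZ_op_continuous s0 omP nnu d0 Lg2).
have := bounded delta g d0 Cg; rewrite -(EFin_Rintegral Lg2.2) -EFinM.
move=> /(Rintegrable_ge0_le (measurable_funM mT mT) (fun x => sqr_ge0 _))[jT Tle].
have LT := square_integrableN (conj mT jT).
have := CZ_pair_antisym s0 omP nnu d0 Lf Cg; rewrite /CZ_pair => ->.
apply: (le_trans (Rintegral_cauchy_schwarz Lf LT)).
rewrite [leRHS]mulrAC mulrC ler_wpM2r ?Rintegral_sqr_ge0//.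
by under eq_Rintegral do rewrite sqrrN.
Qed.

Lemma CZ_pair_le_bounded_Cc :
  (forall delta f g, 0 < delta -> Cc f -> Cc g -> CZ_pair s om nu delta f g ^+ 2 <=
    Lg ^+ 2 * \int[nu]_x (f x ^+ 2) * \int[nu]_x (g x ^+ 2)) ->
  CZ_bounded_Cc s om Lg nu.
Proof.
move=> pair_le delta f d0 Cf; have Lf := Cc_square_integrable nnu Cf.
rewrite -(EFin_Rintegral Lf.2) -EFinM; apply: integral_sqr_dual_le => // [|g Cg].
  exact: (CZ_op_continuous s0 omP nnu d0 Lf).
exact: pair_le.
Qed.

End bounded_operator.

Section limit_operator.
Context (R : realType) (d : nat).
Local Notation V := 'rV[R]_d.
Variables (s alpha Lam : R) (om : V -> R).
Hypotheses (s0 : 0 < s) (omP : CZ_profile alpha om).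

Lemma CZ_op_equicontinuous (mu : bmeasure R d) (f : V -> R) (M N e delta : R) (x x' : V) :
  nice s Lam mu -> 0 < delta -> Cc f -> 0 < N ->
  (forall y, `|f y| <= M) -> supp_in (eball 0 N) f ->
  (forall y, enorm y <= N ->
    `|CZ_trunc s om delta (x' - y) - CZ_trunc s om delta (x - y)| <= e) ->
  `|CZ_op s om mu delta f x' - CZ_op s om mu delta f x| <= M * e * (Lam * N `^ s).
Proof.
move=> nmu d0 Cf N0 fM fN Ke; have Lf := Cc_square_integrable nmu Cf.
have jx := CZ_op_integrable s0 omP nmu x d0 Lf; have jx' := CZ_op_integrable s0 omP nmu x' d0 Lf.
rewrite /CZ_op -(RintegralB measurableT jx' jx).
have mB := Rintegrable_measurable (RintegrableB jx' jx).
apply: (normr_Rintegral_le nmu N0 mB (c := 0)) => [y|y /fN ->]; last by rewrite !mul0r subrr.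
have M0 : 0 <= M by apply: le_trans (fM 0).
rewrite -mulrBr normrM; have [yN|/ltW yN] := leP (enorm (y - 0)) N.
  by apply: ler_pM => //; apply: Ke; rewrite subr0 in yN.
rewrite (fN y) ?normr0 ?mul0r ?mulr_ge0//; last exact/eball_ge.
by apply: le_trans (Ke 0 _); rewrite ?enorm0 ?(ltW N0).
Qed.

Variables (U : set_system nat) (FU : ProperFilter U).
Variables (mu_ : nat -> bmeasure R d) (nu : bmeasure R d).
Hypothesis nmu : forall j, nice s Lam (mu_ j).
Hypothesis nnu : nice s Lam nu.
Hypothesis mu_nu : weak_cvg U mu_ nu.

Lemma CZ_op_cvg (delta : R) (f : V -> R) (x : V) : 0 < delta -> Cc f ->
  CZ_op s om (mu_ j) delta f x @[j --> U] --> CZ_op s om nu delta f x.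
Proof.
by move=> d0 Cf; apply: mu_nu; apply: CcMr => //; exact: (CZ_truncBr_continuous omP).
Qed.

Lemma CZ_op_cvg_unif (delta N e : R) (f : V -> R) : 0 < delta -> Cc f -> 0 < e ->
  \forall j \near U, forall x, cball 0 N x ->
    `|CZ_op s om (mu_ j) delta f x - CZ_op s om nu delta f x| <= e.
Proof.
move=> d0 Cf e0; have /compact_near_coveringP cover := @compact_cball R d N.
apply: (cover nat U (fun j x =>
  `|CZ_op s om (mu_ j) delta f x - CZ_op s om nu delta f x| <= e)) => x _.
have [Nf Nf0 fN] := Cc_support 0 Cf; have [M M0 fM] := Cc_bounded Cf.
pose C := M * (Lam * Nf `^ s) + 1.
have C0 : 0 < C by rewrite ltr_wpDl// mulr_ge0 ?mulr_ge0 ?powR_ge0 ?(ltW M0) ?(nice_ge0 nnu).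
have e30 : 0 < e / 3 by rewrite divr_gt0.
have Knear := near_unif_cball x Nf (CZ_truncB_continuous (s := s) omP d0) (divr_gt0 e30 C0).
have /cvgrPdist_le/(_ _ e30) Tnear := CZ_op_cvg (x := x) d0 Cf.
exists ([set x' | forall y, enorm y <= Nf ->
    `|CZ_trunc s om delta (x' - y) - CZ_trunc s om delta (x - y)| < e / 3 / C],
  [set j | `|CZ_op s om nu delta f x - CZ_op s om (mu_ j) delta f x| <= e / 3]) => //.
move=> [x' j] [/= xx' Tj].
have equi mu : nice s Lam mu ->
    `|CZ_op s om mu delta f x' - CZ_op s om mu delta f x| <= e / 3.
  move=> nmu'; have := CZ_op_equicontinuous nmu' d0 Cf Nf0 fM fN (fun y yN => ltW (xx' y yN)).
  move=> /le_trans; apply; rewrite [leLHS](_ : _ = e / 3 / C * (M * (Lam * Nf `^ s))); last by ring.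
  by rewrite mulrAC ler_pdivrMr// ler_pM2l// /C lerDl.
move: (equi _ (nmu j)) (equi _ nnu) Tj.
move: (CZ_op s om (mu_ j) delta f x') (CZ_op s om (mu_ j) delta f x)
  (CZ_op s om nu delta f x') (CZ_op s om nu delta f x) => p q t u.
by rewrite !ler_norml; lra.
Qed.

Lemma CZ_pair_cvg (delta : R) (f g : V -> R) : 0 < delta -> Cc f -> Cc g ->
  CZ_pair s om (mu_ j) delta f g @[j --> U] --> CZ_pair s om nu delta f g.
Proof.
move=> d0 Cf Cg; apply/cvgrPdist_le => e e0.
have [N N0 gN] := Cc_support 0 Cg; have [M M0 gM] := Cc_bounded Cg.
pose C := M * (Lam * N `^ s) + 1.
have C0 : 0 < C by rewrite ltr_wpDl// mulr_ge0 ?mulr_ge0 ?powR_ge0 ?(ltW M0) ?(nice_ge0 nnu).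
have e20 : 0 < e / 2 by rewrite divr_gt0.
have CgT := Cc_mul_CZ_op s0 omP nnu d0 (Cc_square_integrable nnu Cf) Cg.
have /cvgrPdist_le/(_ _ e20) gTnear := mu_nu CgT.
have Tunif := CZ_op_cvg_unif N d0 Cf (divr_gt0 e20 C0).
apply: filterS2 Tunif gTnear => j Tj gTj.
have jg := CZ_pair_integrable s0 omP (nmu j) d0 (Cc_square_integrable (nmu j) Cf) Cg.
have jgT := Cc_Rintegrable (nmu j) CgT.
have : `|CZ_pair s om (mu_ j) delta f g - \int[mu_ j]_x (g x * CZ_op s om nu delta f x)| <= e / 2.
  rewrite /CZ_pair -(RintegralB measurableT jg jgT).
  have mB := Rintegrable_measurable (RintegrableB jg jgT).
  apply: (@le_trans _ _ (M * (e / 2 / C) * (Lam * N `^ s))).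
    apply: (normr_Rintegral_le (nmu j) N0 mB (c := 0)) => [y|y /gN ->].
      rewrite -mulrBr normrM; have [yN|/ltW/eball_ge/gN ->] := leP (enorm (y - 0)) N.
        by apply: ler_pM => //; exact: Tj.
      by rewrite normr0 mul0r mulr_ge0 ?divr_ge0 ?(ltW M0) ?(ltW C0) ?(ltW e0).
    by move: (CZ_op _ _ _ _ _ _) (CZ_op _ _ _ _ _ _) => p q; rewrite !mul0r subrr.
  rewrite [leLHS](_ : _ = e / 2 / C * (M * (Lam * N `^ s))); last by ring.
  by rewrite mulrAC ler_pdivrMr// ler_pM2l// /C lerDl.
move: gTj; rewrite /CZ_pair.
move: (\int[nu]_x _) (\int[mu_ j]_x (g x * CZ_op s om nu delta f x)) (\int[mu_ j]_x _) => p q t.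
by rewrite !ler_norml; lra.
Qed.

Lemma weak_limit_bounded (Lg : R) : (forall j, CZ_bounded_Cc s om Lg (mu_ j)) ->
  CZ_bounded s om Lg nu.
Proof.
move=> bounded; apply: (CZ_bounded_Cc_bounded nnu s0 omP).
apply: (CZ_pair_le_bounded_Cc nnu s0 omP) => delta f g d0 Cf Cg.
have cvpair := CZ_pair_cvg d0 Cf Cg.
have cvf := mu_nu (Cc_sqr Cf); have cvg := mu_nu (Cc_sqr Cg).
have cvlhs : (CZ_pair s om (mu_ j) delta f g ^+ 2) @[j --> U] -->
    CZ_pair s om nu delta f g ^+ 2.
  by rewrite expr2; under eq_fun do rewrite expr2; exact: cvgM.
have cvrhs : (Lg ^+ 2 * \int[mu_ j]_x f x ^+ 2 * \int[mu_ j]_x g x ^+ 2) @[j --> U] -->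
    Lg ^+ 2 * \int[nu]_x f x ^+ 2 * \int[nu]_x g x ^+ 2.
  by apply: cvgM => //; exact: cvgMr.
apply: (ler_cvg_to cvlhs cvrhs); apply: nearW => j.
exact: (CZ_pair_le s0 omP (nmu j) (bounded j) d0 Cf Cg).
Qed.

End limit_operator.

(** * Lebesgue points of a bounded functional *)

Section vitali.
Context (R : realType) (d : nat).
Local Notation V := 'rV[R]_d.

Definition separated (p q : V * R) : bool := p.2 + q.2 <= enorm (p.1 - q.1).

Lemma separated_disjoint (p q : V * R) (x : V) :
  separated p q -> eball p.1 p.2 x -> eball q.1 q.2 x -> False.
Proof.
rewrite /separated /eball/= => pq px qx.
by have := enorm_triangle x p.1 q.1; rewrite (enormB p.1 x); lra.
Qed.

Lemma not_separated_sub (p q : V * R) : ~~ separated q p -> p.2 <= q.2 ->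
  eball p.1 p.2 `<=` eball q.1 (3 * q.2).
Proof.
rewrite /separated -ltNge => qp pq y; rewrite /eball/= => py.
by have := enorm_triangle p.1 y q.1; rewrite (enormB p.1 q.1); lra.
Qed.

Lemma seq_argmax (T : eqType) (f : T -> R) (l : seq T) : l != [::] ->
  exists2 m, m \in l & forall p, p \in l -> f p <= f m.
Proof.
case: l => // a l _; elim: l a => [|b l ih] a.
  by exists a; rewrite ?mem_head// => p; rewrite inE => /eqP ->.
have [m ml mmax] := ih b; have [am|am] := leP (f a) (f m).
  exists m; first by rewrite inE ml orbT.
  by move=> p; rewrite inE => /orP[/eqP ->//|/mmax].
exists a; first by rewrite mem_head.
by move=> p; rewrite inE => /orP[/eqP ->//|/mmax pm]; exact: le_trans pm (ltW am).
Qed.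

Lemma vitali_finite (l : seq (V * R)) : (forall p, p \in l -> 0 < p.2) ->
  exists t : seq (V * R), [/\ {subset t <= l}, pairwise separated t &
    forall p, p \in l -> exists2 q, q \in t & eball p.1 p.2 `<=` eball q.1 (3 * q.2)].
Proof.
move: {2}(size l).+1 (ltnSn (size l)) => n; elim: n l => // n ih l ln l0.
have [->|l_neq0] := eqVneq l [::]; first by exists [::].
have [m ml mmax] := seq_argmax snd l_neq0.
have mm : ~~ separated m m.
  by rewrite /separated subrr enorm0 -ltNge addr_gt0 ?l0.
have [||t [tl tsep tcov]] := ih [seq p <- l | separated m p].
- rewrite -ltnS; apply: leq_ltn_trans ln; rewrite size_filter.
  rewrite -(count_predC (separated m) l) -[X in (X < _)%N]addn0 ltn_add2l -has_count.
  by apply/hasP; exists m.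
- by move=> p; rewrite mem_filter => /andP[_ /l0].
exists (m :: t); split.
- by move=> p; rewrite inE => /orP[/eqP ->//|/tl]; rewrite mem_filter => /andP[].
- by rewrite /= tsep andbT; apply/allP => q /tl; rewrite mem_filter => /andP[].
- move=> p pl; have [mp|mp] := boolP (separated m p); last first.
    by exists m; rewrite ?mem_head//; apply: not_separated_sub => //; exact: mmax.
  have [|q qt pq] := tcov p; first by rewrite mem_filter mp.
  by exists q => //; rewrite inE qt orbT.
Qed.

Variables (s Lam : R) (mu : bmeasure R d).
Hypothesis nmu : nice s Lam mu.
Variables (D : set (V * R)) (S : R).
Hypothesis D0 : forall p, D p -> 0 < p.2.
Hypothesis sumS : forall t : seq (V * R), (forall p, p \in t -> D p) ->
  pairwise separated t -> \sum_(p <- t) p.2 `^ s <= S.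

Let mball (p : V * R) : measurable (eball p.1 p.2 : set (Rd R d)).
Proof. exact: measurable_eball. Qed.

Lemma vitali_measure_finite (l : seq (V * R)) : (forall p, p \in l -> D p) ->
  (mu (\big[setU/set0]_(p <- l) eball p.1 p.2) <= (Lam * 3 `^ s * S)%:E)%E.
Proof.
move=> lD; have [|t [tl tsep tcov]] := @vitali_finite l; first by move=> p /lD/D0.
have tD p : p \in t -> D p by move=> /tl/lD.
have ball3 (q : V * R) : 0 < q.2 ->
    (mu (eball q.1 (3 * q.2)) <= (Lam * 3 `^ s * q.2 `^ s)%:E)%E.
  move=> q0; have q3 : 0 < 3 * q.2 by rewrite mulr_gt0.
  by apply: (le_trans (nmu _ q3)); rewrite lee_fin powRM ?(ltW q0)// mulrA.
apply: (@le_trans _ _ (\sum_(p <- t) (Lam * 3 `^ s * p.2 `^ s)%:E)%E); last first.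
  rewrite sumEFin lee_fin -mulr_sumr ler_wpM2l ?sumS//.
  by rewrite mulr_ge0 ?powR_ge0 ?(nice_ge0 nmu).
have mU (u : seq (V * R)) (c : R) :
    measurable (\big[setU/set0]_(q <- u) (eball q.1 (c * q.2) : set (Rd R d))).
  by apply: bigsetU_measurable => q _; exact: measurable_eball.
apply: (@le_trans _ _ (mu (\big[setU/set0]_(p <- t) eball p.1 (3 * p.2)))).
  apply: le_measure; rewrite ?inE//; first exact: bigsetU_measurable.
  move=> x; rewrite -!bigcup_seq => -[p /tcov[q qt pq] px]; exists q => //.
  exact: pq.
have {tD} : forall p, p \in t -> 0 < p.2 by move=> p /tD/D0.
elim: t {tl tsep tcov} => [|p u ih] u0; first by rewrite !big_nil measure0.
rewrite !big_cons; apply: (le_trans (measureU2 _ (measurable_eball _ _) (mU u 3))).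
apply: leeD; first by apply: ball3; apply: u0; rewrite mem_head.
by apply: ih => q qu; apply: u0; rewrite inE qu orbT.
Qed.

Lemma vitali_measure :
  (mu (\bigcup_(p in D) eball p.1 p.2) <= (Lam * 3 `^ s * S)%:E)%E.
Proof.
have [E [ED ->]] := @lindelof R d (V * R)%type D (fun p => eball p.1 p.2)
  (fun p _ => @open_eball R d p.1 p.2).
have mE n : measurable (E n : set (Rd R d)).
  by have [->|[p _ ->]] := ED n; [exact: measurable0|exact: mball].
pose F n : set (Rd R d) := \big[setU/set0]_(i < n) E i.
have -> : \bigcup_n E n = \bigcup_n F n.
  apply/seteqP; split=> [x [n _ Ex]|x [n _]].
    by exists n.+1 => //; rewrite /F big_ord_recr/=; right.
  by rewrite /F -bigcup_mkord => -[i _ Eix]; exists i.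
apply: measure_nondecreasing_bigcup_le => [n||n].
- by apply: bigsetU_measurable => i _; exact: mE.
- apply/nondecreasing_seqP => n; apply/subsetPset; rewrite /F [X in _ `<=` X]big_ord_recr/=.
  exact: subsetUl.
have [l [lD ->]] : exists l : seq (V * R), (forall p, p \in l -> D p) /\
    F n = \big[setU/set0]_(p <- l) eball p.1 p.2.
  elim: n => [|n [l [lD Fl]]]; first by exists [::]; split=> //; rewrite /F big_ord0 big_nil.
  rewrite /F big_ord_recr/= -/(F n) Fl; have [->|[p Dp ->]] := ED n.
    by exists l; rewrite setU0.
  exists (p :: l); rewrite big_cons setUC; split=> // q.
  by rewrite inE => /orP[/eqP ->//|/lD].
exact: vitali_measure_finite.
Qed.

End vitali.

Section bounded_functional.
Context (R : realType) (d : nat).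
Local Notation V := 'rV[R]_d.
Local Notation X := (Rd R d).
Variables (s Lam : R) (mu : bmeasure R d).
Hypothesis nmu : nice s Lam mu.
Implicit Types l : (V -> R) -> R.

Definition L2_bounded (Q : R) l : Prop :=
  forall h, Cc h -> l h ^+ 2 <= Q * \int[mu]_x (h x ^+ 2).

Definition bump (x : V) (r : R) (psi : V -> R) : Prop :=
  [/\ Cc psi, forall y, `|psi y| <= 1 & supp_in (eball x r) psi].

Lemma bump0 (x : V) (r : R) : bump x r (fun=> 0).
Proof. by split=> // [|y]; [exact: Cc0|rewrite normr0]. Qed.

(* A Riesz representative of the bounded functional [l] in [L^2], up to a small
   error, obtained as a near-minimizer of [\int g^2 - 2 l g]. *)
Lemma L2_bounded_representative l (Q e : R) : Cc_linear l -> 0 <= Q -> 0 < e ->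
  L2_bounded Q l ->
  exists2 g, Cc g & L2_bounded e (fun h => l h - \int[mu]_x (g x * h x)).
Proof.
move=> linl Q0 e0 lQ; pose Phi g := \int[mu]_x (g x ^+ 2) - 2 * l g.
have Phi_ge g : Cc g -> - Q <= Phi g.
  move=> Cg; have := lQ g Cg; rewrite /Phi; have := Rintegral_sqr_ge0 mu g.
  move: (\int[mu]_x _) (l g) => I p I0 pQI; rewrite leNgt; apply/negP => IpQ.
  have : (Q + I) ^+ 2 < (2 * p) ^+ 2 by rewrite ltr_pXn2r ?nnegrE ?addr_ge0//; lra.
  by have := sqr_ge0 (Q - I); nra.
have infPhi : has_inf [set Phi g | g in @Cc R d].
  split; first by exists (Phi (fun=> 0)); exists (fun=> 0) => //; exact: Cc0.
  by exists (- Q) => _ [g Cg <-]; exact: Phi_ge.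
have [_ [g Cg <-] g_min] := inf_adherent e0 infPhi.
exists g => // h Ch; rewrite -sqrrN opprB; apply: sqr_le_quadratic => t.
have Cgth : Cc (fun x => g x + t * h x) by apply: CcD => //; exact: CcZ.
have : inf [set Phi g | g in @Cc R d] <= Phi (fun x => g x + t * h x).
  by apply: (ge_inf infPhi.2); exists (fun x => g x + t * h x).
have -> : Phi (fun x => g x + t * h x) =
    Phi g + 2 * t * (\int[mu]_x (g x * h x) - l h) + t ^+ 2 * \int[mu]_x (h x ^+ 2).
  rewrite /Phi (Cc_linearD linl Cg (CcZ t Ch)) (Cc_linearZ linl t Ch).
  rewrite (Rintegral_sqrD t (Cc_square_integrable nmu Cg) (Cc_square_integrable nmu Ch)).
  by ring.
by move: g_min; move: (inf _) (Phi g) (\int[mu]_x _ - _) (t ^+ 2 * _) => p q u v; lra.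
Qed.

Lemma sqr_sum_separated_le (psi : V * R -> V -> R) (c : V * R -> R) (t : seq (V * R)) x :
  (forall p, supp_in (eball p.1 p.2) (psi p)) -> (forall p, `|c p| <= 1) ->
  pairwise (@separated R d) t ->
  (\sum_(p <- t) c p * psi p x) ^+ 2 <= \sum_(p <- t) psi p x ^+ 2.
Proof.
move=> psi_supp c1; elim: t => [|p t ih] /=; first by rewrite !big_nil expr0n.
move=> /andP[/allP pt tsep]; rewrite !big_cons sqrrD.
have -> : c p * psi p x * \sum_(q <- t) c q * psi q x = 0.
  rewrite mulr_sumr big_seq big1// => q qt.
  have [px|/psi_supp ->] := pselect (eball p.1 p.2 x); last by rewrite mulr0 mul0r.
  have [qx|/psi_supp ->] := pselect (eball q.1 q.2 x); last by rewrite !mulr0.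
  by case: (separated_disjoint (pt q qt) px qx).
rewrite mul0rn addr0 exprMn lerD ?ih// ler_piMl ?sqr_ge0//.
by rewrite -real_normK ?num_real// expr_le1.
Qed.

(* The signed sum [h] of the bumps [psi p] satisfies [l h >= kap * S], while the
   disjointness of the supports gives [\int h^2 <= Lam * S], [S] being the sum to bound. *)
Lemma separated_sum_le l (e kap : R) (psi : V * R -> V -> R) (t : seq (V * R)) :
  Cc_linear l -> L2_bounded e l -> 0 < kap -> 0 <= e ->
  (forall p, bump p.1 p.2 (psi p)) ->
  (forall p, p \in t -> 0 < p.2 /\ kap * p.2 `^ s <= `|l (psi p)|) ->
  pairwise (@separated R d) t ->
  \sum_(p <- t) p.2 `^ s <= e * Lam / kap ^+ 2.
Proof.
move=> linl le kap0 e0 psiP t_large tsep.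
have Cpsi p : Cc (psi p) by case: (psiP p).
pose h x := \sum_(p <- t) Num.sg (l (psi p)) * psi p x.
have Ch : Cc h by apply: Cc_sum => p; exact: CcZ.
set S := \sum_(p <- t) p.2 `^ s.
have S0 : 0 <= S by apply: sumr_ge0 => p _; exact: powR_ge0.
have lh_ge : kap * S <= l h.
  rewrite /h (Cc_linear_sum linl) => [|p]; last exact: CcZ.
  rewrite mulr_sumr big_seq_cond [leRHS]big_seq_cond; apply: ler_sum => p.
  rewrite andbT => pt; rewrite (Cc_linearZ linl)// -normrEsg.
  by case: (t_large p pt).
have int_h_le : \int[mu]_x (h x ^+ 2) <= Lam * S.
  apply: (@le_trans _ _ (\int[mu]_x (\sum_(p <- t) psi p x ^+ 2))).
    apply: le_Rintegral => //; first exact: (Cc_Rintegrable nmu (Cc_sqr Ch)).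
      by apply: Rintegrable_sum => p; exact: (Cc_Rintegrable nmu (Cc_sqr (Cpsi p))).
    move=> x _; apply: sqr_sum_separated_le => // p; first by case: (psiP p).
    by rewrite normr_sg lern1 leq_b1.
  rewrite Rintegral_sum => [|p]; last exact: (Cc_Rintegrable nmu (Cc_sqr (Cpsi p))).
  rewrite mulr_sumr big_seq_cond [leRHS]big_seq_cond; apply: ler_sum => p.
  rewrite andbT => pt; have [p0 _] := t_large p pt; have [_ psi1 psi0] := psiP p.
  rewrite -[leRHS]mul1r; apply: (le_trans (ler_norm _)).
  apply: (normr_Rintegral_le nmu p0 (Cc_measurable (Cc_sqr (Cpsi p)))) => x.
    by rewrite normrX expr_le1.
  by move=> /psi0 ->; rewrite expr0n.
have kS : (kap * S) ^+ 2 <= e * (Lam * S).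
  apply: (@le_trans _ _ (l h ^+ 2)); last by apply: (le_trans (le h Ch)); rewrite ler_wpM2l.
  by rewrite lerXn2r ?nnegrE ?mulr_ge0 ?(ltW kap0)//; apply: le_trans lh_ge;
    rewrite mulr_ge0 ?(ltW kap0).
rewrite ler_pdivlMr ?exprn_gt0//.
have [->|S1] := eqVneq S 0; first by rewrite mul0r mulr_ge0 ?(nice_ge0 nmu).
have Spos : 0 < S by rewrite lt_def S1.
by rewrite -(ler_pM2r Spos) -!mulrA (_ : S * _ = (kap * S) ^+ 2)//; ring.
Qed.

Definition large_bump_set l (kap : R) : set X :=
  \bigcup_(p in [set p : V * R | 0 < p.2 /\
    exists2 psi, bump p.1 p.2 psi & kap * p.2 `^ s < `|l psi|]) eball p.1 p.2.

Lemma measurable_large_bump_set l (kap : R) : measurable (large_bump_set l kap).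
Proof.
by apply: open_measurable_Rd; apply: bigcup_open => p _; exact: open_eball.
Qed.

Lemma measure_large_bump_set l (e kap : R) : Cc_linear l -> L2_bounded e l ->
  0 < kap -> 0 <= e ->
  (mu (large_bump_set l kap) <= (Lam * 3 `^ s * (e * Lam / kap ^+ 2))%:E)%E.
Proof.
move=> linl le kap0 e0; rewrite /large_bump_set; set D := (X in \bigcup_(p in X) _).
have /choice[psi psiP] : forall p, exists psi, bump p.1 p.2 psi /\
    (D p -> kap * p.2 `^ s < `|l psi|).
  move=> p; have [[p0 [psi psiP lpsi]]|nD] := pselect (D p); first by exists psi.
  by exists (fun=> 0); split=> //; exact: bump0.
apply: (vitali_measure nmu) => [p []//|t tD tsep].
apply: (separated_sum_le (psi := psi) linl le kap0 e0 _ _ tsep) => [p|p /tD Dp].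
  by case: (psiP p).
by split; [case: Dp|case: (psiP p) => _ /(_ Dp)/ltW].
Qed.

Definition mean0_small l (x : V) (kap r : R) : Prop :=
  forall psi, bump x r psi -> \int[mu]_y psi y = 0 -> `|l psi| <= kap * r `^ s.

Lemma mean0_small_le l (x : V) (kap kap' r : R) : kap <= kap' ->
  mean0_small l x kap r -> mean0_small l x kap' r.
Proof.
move=> kk small psi psiP psiI; apply: (le_trans (small psi psiP psiI)).
by rewrite ler_wpM2r// powR_ge0.
Qed.

Lemma mean0_small_Rintegral (g : V -> R) (x : V) (kap : R) : Cc g -> 0 < kap ->
  exists2 rho : R, 0 < rho & forall r : R, 0 < r -> r < rho ->
    mean0_small (fun psi => \int[mu]_y (g y * psi y)) x kap r.
Proof.
move=> Cg k0; have Lam1 : 0 < Lam + 1 by rewrite ltr_wpDl// (nice_ge0 nmu).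
have /continuous_eballP/(_ x _ (divr_gt0 k0 Lam1))[rho rho0 gx] := Cc_continuous Cg.
exists rho => // r r0 rrho psi [Cpsi psi1 psi0] psiI.
have jpsi := Cc_Rintegrable nmu Cpsi.
have jgpsi : Rintegrable mu (fun y => g y * psi y).
  by apply: (Cc_Rintegrable nmu); apply: CcMl => //; exact: Cc_continuous.
have -> : \int[mu]_y (g y * psi y) = \int[mu]_y (g y * psi y - g x * psi y).
  rewrite (RintegralB measurableT jgpsi (RintegrableZl (g x) jpsi)).
  by rewrite (RintegralZl (g x) measurableT jpsi) psiI mulr0 subr0.
have mB := Rintegrable_measurable (RintegrableB jgpsi (RintegrableZl (g x) jpsi)).
apply: (@le_trans _ _ (kap / (Lam + 1) * (Lam * r `^ s))); last first.
  rewrite mulrA ler_wpM2r ?powR_ge0// mulrAC ler_pdivrMr// ler_pM2l//.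
  by rewrite lerDl.
apply: (normr_Rintegral_le nmu r0 mB) => [y|y /psi0 ->]; last by rewrite !mulr0 subrr.
have k'0 : 0 <= kap / (Lam + 1) by rewrite divr_ge0// ltW.
rewrite -mulrBl normrM; have [yr|/psi0 ->] := pselect (eball x r y); last first.
  by rewrite normr0 mulr0.
rewrite -[leRHS]mulr1; apply: ler_pM => //; apply: ltW; apply: gx.
exact: lt_trans yr rrho.
Qed.

Lemma mean0_small_off_large_bump_set l (g : V -> R) (x : V) (kap : R) :
  Cc g -> 0 < kap ->
  ~ large_bump_set (fun h => l h - \int[mu]_y (g y * h y)) (kap / 2) x ->
  exists2 rho : R, 0 < rho & forall r : R, 0 < r -> r < rho -> mean0_small l x kap r.
Proof.
move=> Cg k0 xW; have k20 : 0 < kap / 2 by rewrite divr_gt0.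
have [rho rho0 small] := mean0_small_Rintegral x Cg k20.
exists rho => // r r0 rrho psi psiP psiI.
have := small r r0 rrho psi psiP psiI.
have : `|l psi - \int[mu]_y (g y * psi y)| <= kap / 2 * r `^ s.
  rewrite leNgt; apply/negP => large; apply: xW; exists (x, r); last exact: eballxx.
  by split=> //; exists psi.
move: (\int[mu]_y _) (r `^ s) => p q; rewrite !ler_norml.
by have -> : kap * q = kap / 2 * q + kap / 2 * q; [field|lra].
Qed.

Lemma lebesgue_point_at l (Q kap : R) : Cc_linear l -> 0 <= Q -> L2_bounded Q l ->
  0 < kap -> {ae mu, forall x : V, exists2 rho : R, 0 < rho &
    forall r : R, 0 < r -> r < rho -> mean0_small l x kap r}.
Proof.
move=> linl Q0 lQ k0; have k20 : 0 < kap / 2 by rewrite divr_gt0.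
have e0 n : 0 < n.+1%:R^-1 :> R by rewrite invr_gt0.
have /choice[g gP] : forall n, exists g, Cc g /\
    L2_bounded n.+1%:R^-1 (fun h => l h - \int[mu]_x (g x * h x)).
  by move=> n; have [g Cg lg] := L2_bounded_representative linl Q0 (e0 n) lQ; exists g.
pose W n := large_bump_set (fun h => l h - \int[mu]_x (g n x * h x)) (kap / 2).
have mW n : measurable (W n) by exact: measurable_large_bump_set.
exists (\bigcap_n W n); split; first exact: bigcap_measurable.
- apply: (measure0_le_natSinv (C := Lam * 3 `^ s * (Lam / (kap / 2) ^+ 2))) => n.
  apply: (@le_trans _ _ (mu (W n))).
    apply: le_measure; rewrite ?inE//; last exact: bigcap_inf.
    exact: bigcap_measurable.
  apply: (le_trans (measure_large_bump_set _ (gP n).2 k20 (ltW (e0 n)))).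
    exact: Cc_linear_sub linl _ (Cc_linear_Rintegral nmu (gP n).1).
  by rewrite lee_fin [leLHS](_ : _ = Lam * 3 `^ s * (Lam / (kap / 2) ^+ 2) * n.+1%:R^-1)//; ring.
- move=> x /= not_small n _; apply: contrapT => xW; apply: not_small.
  exact: (mean0_small_off_large_bump_set (gP n).1 k0 xW).
Qed.

Lemma lebesgue_point l (Q : R) : Cc_linear l -> 0 <= Q -> L2_bounded Q l ->
  {ae mu, forall (x : V) (kap : R), 0 < kap -> exists2 rho : R, 0 < rho &
    forall r : R, 0 < r -> r < rho -> mean0_small l x kap r}.
Proof.
move=> linl Q0 lQ; have e0 n : 0 < n.+1%:R^-1 :> R by rewrite invr_gt0.
apply: negligibleS (negligible_bigcup (fun n => lebesgue_point_at linl Q0 lQ (e0 n))).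
move=> x /= /existsNP[kap /not_implyP[k0 not_small]].
have [n nk] := exists_natSinv_lt k0; exists n => // -[rho rho0 small]; apply: not_small.
by exists rho => // r r0 rrho; apply: mean0_small_le (small r r0 rrho); exact: ltW.
Qed.

End bounded_functional.

(** * Upper density *)

Section diameter.
Context (R : realType) (d : nat).
Local Notation V := 'rV[R]_d.
Variables (U : set V) (delta : R).
Hypothesis Udelta : forall x y, U x -> U y -> enorm (x - y) <= delta.

Lemma le_ediam (x y : V) : U x -> U y -> enorm (x - y) <= ediam U.
Proof.
move=> Ux Uy; apply: ub_le_sup; last by exists x, y.
by exists delta => _ [u [v [Uu [Uv ->]]]]; exact: Udelta.
Qed.

Lemma ediam_le (x : V) : U x -> ediam U <= delta.
Proof.
move=> Ux; apply: ge_sup; first by exists (enorm (x - x)), x, x.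
by move=> _ [u [v [Uu [Uv ->]]]]; exact: Udelta.
Qed.

Lemma ediam_ge0 (x : V) : U x -> 0 <= ediam U.
Proof. by move=> Ux; apply: le_trans (enorm_ge0 (x - x)) (le_ediam Ux Ux). Qed.

End diameter.

Section density.
Context (R : realType) (d : nat).
Local Notation V := 'rV[R]_d.
Local Notation X := (Rd R d).
Variable mu : bmeasure R d.

Lemma msupp_ae : {ae mu, forall x, msupp mu x}.
Proof.
pose D : set (V * R) := [set p | mu (eball p.1 p.2) = 0%E].
have [E [ED EU]] := @lindelof R d (V * R)%type D (fun p => eball p.1 p.2)
  (fun p _ => @open_eball R d p.1 p.2).
have negE n : mu.-negligible (E n).
  apply/negligibleP.
    by have [->|[p _ ->]] := ED n; [exact: measurable0|exact: measurable_eball].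
  by have [->|[p Dp ->]] := ED n; [exact: measure0|exact: Dp].
apply: negligibleS (negligible_bigcup negE); rewrite -EU => x /=.
move=> /existsNP[r /not_implyP[r0 xr]]; exists (x, r) => /=; last exact: eballxx.
by apply/eqP; rewrite -measure_le0 leNgt; apply/negP.
Qed.

Lemma open_measure_eball_gt (r t : R) : open [set x : V | (t%:E < mu (eball x r))%E].
Proof.
rewrite openE => x /= tx.
have bigcup_eball : \bigcup_n eball x (r - n.+1%:R^-1) = eball x r.
  apply/seteqP; split=> [y [n _]|y xy]; first by apply: sub_eball; rewrite gerBl invr_ge0.
  have [n ny] := exists_natSinv_lt (e := r - enorm (y - x)) ltac:(by rewrite subr_gt0).
  by exists n => //; rewrite /eball/= ltrBrDr -ltrBrDl.
have [n tn] : exists n, (t%:E < mu (eball x (r - n.+1%:R^-1)))%E.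
  apply: contrapT => /forallNP le_t; move: tx; rewrite -bigcup_eball ltNge => /negP; apply.
  apply: measure_nondecreasing_bigcup_le => [n||n]; first exact: measurable_eball.
    apply/nondecreasing_seqP => n; apply/subsetPset; apply: sub_eball.
    by rewrite lerD2l lerN2 lef_pV2 ?posrE// ler_nat.
  by rewrite leNgt; apply/negP; exact: le_t.
apply/nbhs_eballP; exists n.+1%:R^-1; first by rewrite invr_gt0.
move=> y xy; apply: (lt_le_trans tn); apply: le_measure; rewrite ?inE; [exact: measurable_eball..|].
move=> z; rewrite /eball/= in xy * => xz; have := enorm_triangle x z y.
by rewrite (enormB x y); move: n.+1%:R^-1 xy xz => u; lra.
Qed.

Variable s : R.

Definition positive_upper_density (x : V) : Prop :=
  exists2 c : R, 0 < c & forall rho : R, 0 < rho ->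
    exists r : R, [/\ 0 < r, r < rho & ((c * r `^ s)%:E < mu (eball x r))%E].

Definition thin (c rho : R) : set V :=
  [set x | forall r : R, 0 < r -> r < rho -> (mu (eball x r) <= (c * r `^ s)%:E)%E].

Lemma measurable_thin (c rho : R) : measurable (thin c rho : set X).
Proof.
rewrite -[thin c rho]setCK; apply: measurableC; apply: open_measurable_Rd.
rewrite (_ : ~` _ = \bigcup_(r in [set r : R | 0 < r < rho])
    [set x : V | ((c * r `^ s)%:E < mu (eball x r))%E]).
  by apply: bigcup_open => r _; exact: open_measure_eball_gt.
apply/seteqP; split=> [x /= /existsNP[r /not_implyP[r0 /not_implyP[rrho /negP]]]|x].
  by rewrite -ltNge => xr; exists r => //=; rewrite r0.
by move=> [r /andP[r0 rrho] /= xr] /(_ r r0 rrho); rewrite leNgt xr.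
Qed.

Lemma thin_le (c rho rho' : R) : rho <= rho' -> thin c rho' `<=` thin c rho.
Proof. by move=> rr x thinx r r0 /lt_le_trans-/(_ _ rr); exact: thinx. Qed.

Variable Lam : R.
Hypotheses (s0 : 0 < s) (nmu : nice s Lam mu).

Lemma nice_set1 (x : V) : mu (cball x 0) = 0%E.
Proof.
apply: (measure0_le_natSinv (C := Lam)) => n.
have r0 : 0 < n.+1%:R^-1 `^ s^-1 :> R by rewrite powR_gt0// invr_gt0.
apply: (@le_trans _ _ (mu (eball x (n.+1%:R^-1 `^ s^-1)))).
  apply: le_measure; rewrite ?inE; [exact: measurable_cball|exact: measurable_eball|].
  by move=> y; rewrite /cball /eball/= => /le_lt_trans; exact.
apply: (le_trans (nmu _ r0)); rewrite -powRrM mulVf ?gt_eqF//.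
by rewrite powRr1// invr_ge0.
Qed.

(* Covering sets that meet [thin c rho] can be replaced by balls of comparable diameter
   and small measure. *)
Lemma thin_cover1 (c rho delta : R) (U : set V) : 0 <= c -> 0 <= delta -> 2 * delta < rho ->
  (forall x y, U x -> U y -> enorm (x - y) <= delta) ->
  exists C : set X, [/\ measurable C, thin c rho `&` U `<=` C &
    (mu C <= (c * 2 `^ s * ediam U `^ s)%:E)%E].
Proof.
move=> c0 delta0 delta_rho Udelta; have bound0 : 0 <= c * 2 `^ s * ediam U `^ s.
  by rewrite !mulr_ge0 ?powR_ge0.
have [[x [thinx Ux]]|none] := pselect (exists x, thin c rho x /\ U x); last first.
  exists set0; split; rewrite ?measure0 ?lee_fin//.
  by move=> y [thiny Uy]; apply: none; exists y.
exists (cball x (ediam U)); split; first exact: measurable_cball.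
  by move=> y [_ Uy]; exact: le_ediam Udelta _ _ Uy Ux.
have [->|D1] := eqVneq (ediam U) 0; first by rewrite nice_set1 lee_fin mulr_ge0 ?mulr_ge0 ?powR_ge0.
have D0 : 0 < ediam U by rewrite lt_def D1 (ediam_ge0 Udelta Ux).
have D20 : 0 < 2 * ediam U by rewrite mulr_gt0.
apply: (@le_trans _ _ (mu (eball x (2 * ediam U)))).
  apply: le_measure; rewrite ?inE; [exact: measurable_cball|exact: measurable_eball|].
  by move=> y; rewrite /cball /eball/=; lra.
rewrite -mulrA -powRM ?(ltW D0)//; apply: thinx => //.
by apply: le_lt_trans delta_rho; rewrite ler_pM2l// (ediam_le Udelta Ux).
Qed.

Lemma measure_thin_le (H c rho : R) : 0 <= c -> 0 < rho ->
  (hausdorff s (msupp mu) < H%:E)%E -> (mu (thin c rho) <= (c * 2 `^ s * H)%:E)%E.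
Proof.
move=> c0 rho0 hH; have rho40 : 0 < rho / 4 by rewrite divr_gt0.
have : (Hdelta s (rho / 4) (msupp mu) < H%:E)%E.
  by apply: le_lt_trans hH; apply: ereal_sup_ubound; exists (rho / 4).
move=> /ereal_inf_lt[_ [U [suppU Udelta] <-] sumU].
have /choice[C CU] : forall i, exists C : set X, [/\ measurable C, thin c rho `&` U i `<=` C &
    (mu C <= (c * 2 `^ s * ediam (U i) `^ s)%:E)%E].
  by move=> i; apply: (thin_cover1 c0 (ltW rho40) _ (Udelta i)); lra.
have mC i : measurable (C i) by case: (CU i).
have [N [mN muN suppN]] := msupp_ae.
have sub : thin c rho `\` N `<=` \bigcup_i C i.
  move=> y [thiny Ny]; have [|i _ Uy] := suppU y; last first.
    by exists i => //; case: (CU i) => _ sub _; exact: sub.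
  by apply: contrapT => /suppN.
have mD : measurable (thin c rho `\` N : set X).
  by apply: measurableD => //; exact: measurable_thin.
have -> : mu (thin c rho) = mu (thin c rho `\` N : set X).
  apply/eqP; rewrite eq_le; apply/andP; split; last first.
    by apply: le_measure; rewrite ?inE//; exact: measurable_thin.
  apply: (@le_trans _ _ (mu ((thin c rho `\` N) `|` N : set X))).
    apply: le_measure; rewrite ?inE//; [exact: measurable_thin|exact: measurableU|].
    by move=> y thiny; have [Ny|Ny] := pselect (N y); [right|left].
  apply: (@le_trans _ _ (mu (thin c rho `\` N : set X) + mu N)%E); first exact: measureU2.
  by rewrite muN adde0.
apply: (le_trans (@measure_sigma_subadditive _ _ _ mu _ _ mC mD sub)).
apply: (@le_trans _ _ (\sum_(0 <= i <oo) ((c * 2 `^ s)%:E * (ediam (U i) `^ s)%:E))%E).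
  apply: lee_nneseries => i _; rewrite ?measure_ge0// -EFinM.
  by case: (CU i).
rewrite nneseriesZl; last by move=> i _; rewrite lee_fin powR_ge0.
by rewrite (EFinM (c * 2 `^ s) H) lee_wpmul2l ?lee_fin ?mulr_ge0 ?powR_ge0// ltW.
Qed.

Lemma ae_positive_upper_density : (hausdorff s (msupp mu) < +oo)%E ->
  {ae mu, forall x, positive_upper_density x}.
Proof.
move=> hoo; have [H hH] : exists H : R, (hausdorff s (msupp mu) < H%:E)%E.
  move: hoo; case: (hausdorff _ _) => [h _|//|_]; last by exists 0; rewrite ltNyr.
  by exists (h + 1); rewrite lte_fin ltrDl.
have e0 n : 0 < n.+1%:R^-1 :> R by rewrite invr_gt0.
pose B k : set X := \bigcup_m thin k.+1%:R^-1 m.+1%:R^-1.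
have mB k : measurable (B k) by apply: bigcup_measurable => m _; exact: measurable_thin.
have muB k : (mu (B k) <= (2 `^ s * H * k.+1%:R^-1)%:E)%E.
  apply: measure_nondecreasing_bigcup_le => [m||m]; first exact: measurable_thin.
    apply/nondecreasing_seqP => m; apply/subsetPset; apply: thin_le.
    by rewrite lef_pV2 ?posrE// ler_nat.
  apply: (le_trans (measure_thin_le (ltW (e0 k)) (e0 m) hH)).
  by rewrite lee_fin -mulrA mulrC.
exists (\bigcap_k B k); split; first exact: bigcap_measurable.
- apply: (measure0_le_natSinv (C := 2 `^ s * H)) => k; apply: le_trans (muB k).
  apply: le_measure; rewrite ?inE//; last exact: bigcap_inf.
  exact: bigcap_measurable.
- move=> x /= low k _; apply: contrapT => Bx; apply: low; exists k.+1%:R^-1 => // rho rho0.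
  have [m mrho] := exists_natSinv_lt rho0.
  apply: contrapT => no_r; apply: Bx; exists m => // r r0 rm.
  rewrite leNgt; apply/negP => xr; apply: no_r; exists r; split=> //.
  exact: lt_trans rm mrho.
Qed.

End density.

(** * Blow-ups *)

Section blowup_map.
Context (R : realType) (d : nat).
Local Notation V := 'rV[R]_d.
Implicit Types (x y u : V) (r : R).

Definition blowup x r y : V := r^-1 *: (y - x).

Lemma blowupK x r y : 0 < r -> x + r *: blowup x r y = y.
Proof.
by move=> r0; rewrite /blowup scalerA mulfV ?gt_eqF// scale1r addrC subrK.
Qed.

Lemma blowupB x r y u : 0 < r -> blowup x r y - u = r^-1 *: (y - (x + r *: u)).
Proof.
move=> r0; rewrite /blowup opprD addrA [in RHS]scalerBr scalerA.
by rewrite mulVf ?gt_eqF// scale1r.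
Qed.

Lemma enorm_blowupB x r y u : 0 < r ->
  enorm (blowup x r y - u) = r^-1 * enorm (y - (x + r *: u)).
Proof. by move=> r0; rewrite blowupB// enormZ_gt0// invr_gt0. Qed.

Lemma enorm_blowup x r y : 0 < r -> enorm (blowup x r y) = r^-1 * enorm (y - x).
Proof. by move=> r0; rewrite /blowup enormZ_gt0// invr_gt0. Qed.

Lemma blowup_eball x r u (t : R) : 0 < r ->
  blowup x r @^-1` eball u t = eball (x + r *: u) (r * t).
Proof.
by move=> r0; apply/seteqP; split=> y; rewrite /eball/= enorm_blowupB// ltr_pdivrMl.
Qed.

Lemma blowup_continuous x r : continuous (blowup x r).
Proof.
move=> y; apply: (cvg_comp _ _ (cvgB cvg_id (cvg_cst x))).
exact: (@scaler_continuous _ _ r^-1 (y - x)).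
Qed.

Lemma measurable_blowup x r : measurable_fun setT (blowup x r : Rd R d -> Rd R d).
Proof. by apply: continuous_measurable_RdRd; exact: blowup_continuous. Qed.

Lemma supp_in_blowup x r (N : R) (f : V -> R) : 0 < r -> supp_in (eball 0 N) f ->
  supp_in (eball x (N * r)) (fun y => f (blowup x r y)).
Proof.
move=> r0 fN y /eball_ge yN; apply: fN; apply/eball_ge.
by rewrite subr0 enorm_blowup// ler_pdivlMl// mulrC.
Qed.

Lemma Cc_blowup x r (f : V -> R) : 0 < r -> Cc f -> Cc (fun y => f (blowup x r y)).
Proof.
move=> r0 [cf [N fN]]; apply: supp_in_Cc (supp_in_blowup r0 fN).
by move=> y; apply: continuous_comp; [exact: blowup_continuous|exact: cf].
Qed.

End blowup_map.

Section blowup_measure.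
Context (R : realType) (d : nat).
Local Notation V := 'rV[R]_d.
Local Notation X := (Rd R d).
Variables (s : R) (mu : bmeasure R d) (x : V) (r : R).

(* The measure structure of a push-forward depends on a proof of measurability, hence is
   given explicitly. *)
Definition blowup_measure : bmeasure R d :=
  mscale (NngNum (powR_ge0 r (- s)))
    (measure_function_pushforward__canonical__measure_function_Measure mu
      (measurable_blowup x r)).
Local Notation m := blowup_measure.

Lemma ge0_integral_blowup (f : X -> \bar R) :
  measurable_fun setT f -> (forall y, (0 <= f y)%E) ->
  (\int[m]_y f y = (r `^ (- s))%:E * \int[mu]_y f (blowup x r y))%E.
Proof.
move=> mf f0; rewrite ge0_integral_mscale//; congr (_ * _)%E.
by rewrite ge0_integral_pushforward//; exact: measurable_blowup.
Qed.

Hypothesis r0 : 0 < r.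

Lemma blowup_measure_eball (u : V) (t : R) :
  m (eball u t) = ((r `^ (- s))%:E * mu (eball (x + r *: u) (r * t)))%E.
Proof. by rewrite -blowup_eball. Qed.

Variable Lam : R.
Hypothesis nmu : nice s Lam mu.

Lemma blowup_nice : nice s Lam m.
Proof.
move=> u t t0; rewrite blowup_measure_eball.
have rt : 0 < r * t by rewrite mulr_gt0.
apply: (le_trans (lee_wpmul2l _ (nmu _ rt))); first by rewrite lee_fin powR_ge0.
rewrite -EFinM lee_fin powRM ?(ltW r0) ?(ltW t0)//.
by rewrite mulrCA [_ * (r `^ s * _)]mulrA powR_mulNl// mul1r.
Qed.

Lemma Rintegral_blowup (f : V -> R) : Cc f ->
  \int[m]_y f y = r `^ (- s) * \int[mu]_y f (blowup x r y).
Proof.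
move=> Cf; have Cfb := Cc_blowup x r0 Cf.
have ifb := Cc_Rintegrable nmu Cfb.
have mf : measurable_fun setT (EFin \o (f : X -> R)).
  by apply/measurable_EFinP; exact: Cc_measurable.
apply: EFin_inj; rewrite EFinM (EFin_Rintegral (Cc_Rintegrable blowup_nice Cf)).
rewrite (EFin_Rintegral ifb) integralE [in RHS]integralE.
rewrite muleBr//; last first.
  by apply: fin_num_adde_defl; rewrite fin_numN (integrable_neg_fin_num measurableT ifb).
congr (_ - _)%E.
- rewrite (ge0_integral_blowup (measurable_funepos mf))//; congr (_ * _)%E.
  by apply: eq_integral => y _; rewrite !funeposE.
- rewrite (ge0_integral_blowup (measurable_funeneg mf))//; congr (_ * _)%E.
  by apply: eq_integral => y _; rewrite !funenegE.
Qed.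

Lemma Rintegral_blowup_eq0 (f : V -> R) : Cc f -> \int[m]_y f y = 0 ->
  \int[mu]_y f (blowup x r y) = 0.
Proof.
move=> Cf; rewrite (Rintegral_blowup Cf) => /eqP.
by rewrite mulf_eq0 gt_eqF ?powR_gt0//= => /eqP.
Qed.

Variables (alpha : R) (om : V -> R).
Hypotheses (s0 : 0 < s) (omP : CZ_profile alpha om).

Lemma CZ_op_blowup (delta : R) (f : V -> R) (u : V) : 0 < delta -> Cc f ->
  CZ_op s om m delta f u =
    CZ_op s om mu (r * delta) (fun y => f (blowup x r y)) (x + r *: u).
Proof.
move=> d0 Cf.
have Ck := CcMr (CZ_truncBr_continuous (s := s) (x := u) omP d0) Cf.
rewrite /CZ_op (Rintegral_blowup Ck).
rewrite -(RintegralZl _ measurableT (Cc_Rintegrable nmu (Cc_blowup x r0 Ck))).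
apply: eq_Rintegral => y _; rewrite mulrCA; congr (_ * _).
rewrite -(CZ_trunc_scale s omP _ r0 d0); congr CZ_trunc.
by rewrite scalerBr -[y in RHS](blowupK x y r0) opprD addrACA subrr add0r.
Qed.

Lemma CZ_pair_blowup (delta : R) (f g : V -> R) : 0 < delta -> Cc f -> Cc g ->
  CZ_pair s om m delta f g = r `^ (- s) *
    CZ_pair s om mu (r * delta) (fun y => f (blowup x r y)) (fun y => g (blowup x r y)).
Proof.
move=> d0 Cf Cg; have Lf := Cc_square_integrable blowup_nice Cf.
rewrite /CZ_pair (Rintegral_blowup (Cc_mul_CZ_op s0 omP blowup_nice d0 Lf Cg)).
congr (_ * _); apply: eq_Rintegral => y _.
by rewrite (CZ_op_blowup _ d0 Cf) blowupK.
Qed.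

Lemma CZ_bounded_Cc_blowup (Lg : R) : CZ_bounded_Cc s om Lg mu -> CZ_bounded_Cc s om Lg m.
Proof.
move=> bmu delta f d0 Cf; have rd : 0 < r * delta by rewrite mulr_gt0.
have cT : continuous (CZ_op s om m delta f).
  exact: (CZ_op_continuous s0 omP blowup_nice d0 (Cc_square_integrable blowup_nice Cf)).
rewrite [leLHS]ge0_integral_blowup; last by move=> y; rewrite lee_fin sqr_ge0.
  rewrite [in leRHS]ge0_integral_blowup; last by move=> y; rewrite lee_fin sqr_ge0.
    rewrite muleCA; apply: lee_wpmul2l; first by rewrite lee_fin powR_ge0.
    under eq_integral do rewrite (CZ_op_blowup _ d0 Cf) blowupK//.
    exact: (bmu _ _ rd (Cc_blowup x r0 Cf)).
  by apply/measurable_EFinP; apply: measurable_funX; exact: Cc_measurable.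
by apply/measurable_EFinP; apply: measurable_funX; exact: continuous_measurable_Rd.
Qed.

End blowup_measure.

(** * Action on functions of mean zero *)

Section far_field.
Context (R : realType) (d : nat).
Local Notation V := 'rV[R]_d.
Local Notation X := (Rd R d).
Variables (s alpha Lam : R) (mu : bmeasure R d) (om : V -> R).
Hypotheses (s0 : 0 < s) (omP : CZ_profile alpha om) (nmu : nice s Lam mu).

Definition far_weight (c : V) (rho : R) (w : V -> R) : Prop :=
  [/\ measurable_fun setT (w : X -> R), forall y, `|w y| <= 1 &
      forall y, eball c rho y -> w y = 0].

Definition far_kernel (c : V) (delta : R) (w : V -> R) (u y : V) : R :=
  w y * (CZ_trunc s om delta (u - y) - CZ_trunc s om delta (c - y)).

Definition far_potential (c : V) (delta : R) (w : V -> R) (u : V) : R :=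
  \int[mu]_y far_kernel c delta w u y.

Definition far_field_const (rho1 rho2 : R) : R :=
  regularity_const s * rho1 `^ alpha * (far_const s Lam alpha * rho2 `^ (- alpha)).

Let a0 : 0 < alpha. Proof. by case: omP => /andP[]. Qed.

Lemma far_field_const_ge0 (rho1 rho2 : R) : 0 <= far_field_const rho1 rho2.
Proof.
have C0 := ltW (regularity_const_gt0 s0); have F0 := far_const_ge0 nmu a0.
by rewrite /far_field_const; do !apply: mulr_ge0 => //; exact: powR_ge0.
Qed.

Lemma far_field_const_scale (rho1 rho2 r : R) : 0 < rho1 -> 0 < rho2 -> 0 < r ->
  far_field_const (rho1 * r) (rho2 * r) = far_field_const rho1 rho2.
Proof.
move=> rho10 rho20 r0; rewrite -[RHS]mulr1 -(powR_mulNl alpha r0).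
rewrite /far_field_const !powRM ?ltW//.
by move: (r `^ alpha) (r `^ - alpha) => p q; ring.
Qed.

Lemma near_far_field_const_le (rho e : R) : 0 < e ->
  \forall M \near +oo, far_field_const rho M <= e.
Proof.
move=> e0; pose C := regularity_const s * rho `^ alpha * far_const s Lam alpha.
have C0 : 0 <= C.
  apply: mulr_ge0; last exact: (far_const_ge0 nmu a0).
  by apply: mulr_ge0; [exact/ltW/regularity_const_gt0|exact: powR_ge0].
have C1 : 0 < C + 1 by rewrite ltr_wpDl.
have eC : 0 < e / (C + 1) by rewrite divr_gt0.
near=> M.
have MM : (e / (C + 1)) `^ (- alpha^-1) <= M by near: M; exact: nbhs_pinfty_ge.
have Ma : M `^ (- alpha) <= e / (C + 1).
  apply: le_trans (ler_powRN (ltW a0) (powR_gt0 _ eC) MM) _.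
  by rewrite -powRrM mulrNN mulVf ?gt_eqF// powRr1// ltW.
rewrite /far_field_const mulrA -/C; apply: (@le_trans _ _ ((C + 1) * M `^ (- alpha))).
  by rewrite ler_wpM2r ?powR_ge0// lerDl.
by rewrite mulrC -ler_pdivlMr.
Unshelve. all: end_near. Qed.

Variables (c : V) (rho1 rho2 delta : R).
Hypotheses (rho10 : 0 < rho1) (rho12 : 2 * rho1 <= rho2).
Hypotheses (d0 : 0 < delta) (drho : delta <= rho1).

Let rho20 : 0 < rho2.
Proof. by apply: lt_le_trans rho12; rewrite mulr_gt0. Qed.

Section weight.
Variable w : V -> R.
Hypothesis wP : far_weight c rho2 w.

Let w_measurable : measurable_fun setT (w : X -> R). Proof. by case: wP. Qed.
Let w_le1 y : `|w y| <= 1. Proof. by case: wP. Qed.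
Let w0 y : eball c rho2 y -> w y = 0. Proof. by case: wP => _ _; exact. Qed.

Lemma far_kernel_le (u y : V) : enorm (u - c) <= rho1 ->
  `|far_kernel c delta w u y| <=
    regularity_const s * rho1 `^ alpha * Num.max rho2 (enorm (y - c)) `^ (- (s + alpha)).
Proof.
move=> uc; have C0 := ltW (regularity_const_gt0 s0).
rewrite /far_kernel; have [yc|yc] := ltP (enorm (y - c)) rho2.
  by rewrite (w0 yc) mul0r normr0 !mulr_ge0 ?powR_ge0.
rewrite normrM -[leRHS]mul1r; apply: ler_pM => //.
have uy : delta <= enorm (u - y).
  by rewrite (enormB u); move: (enorm_triangle u y c) drho rho12 yc uc; lra.
have cy : 2 * rho1 <= enorm (c - y) by rewrite (enormB c); exact: le_trans yc.
have cy0 : 0 < enorm (c - y) by apply: lt_le_trans cy; rewrite mulr_gt0.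
rewrite !CZ_trunc_far//; last by apply: le_trans cy; move: drho rho10; lra.
have shift : (c - y) - (u - y) = c - u by rewrite opprB addrA subrK.
rewrite distrC; apply: (le_trans (CZ_kernel_regular s0 omP cy0 _)).
  by rewrite shift (enormB c u); move: cy uc; lra.
rewrite shift (enormB c y) (enormB c u) -mulrA ler_wpM2l// ler_wpM2r ?powR_ge0//.
exact: (ge0_ler_powR2 (ltW a0) (enorm_ge0 _)).
Qed.

Lemma measurable_far_kernel (u : V) : measurable_fun setT (far_kernel c delta w u : X -> R).
Proof.
apply: measurable_funM => //.
by apply: measurable_funB; exact: (measurable_CZ_truncBr s omP _ d0).
Qed.

Lemma far_kernel_integrable (u : V) : enorm (u - c) <= rho1 ->
  Rintegrable mu (far_kernel c delta w u) /\
  \int[mu]_y `|far_kernel c delta w u y| <= far_field_const rho1 rho2.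
Proof.
move=> uc; have C0 : 0 <= regularity_const s * rho1 `^ alpha.
  by apply: mulr_ge0; [exact/ltW/regularity_const_gt0|exact: powR_ge0].
have fu := fun y => far_kernel_le y uc.
exact: (Rintegrable_far nmu (measurable_far_kernel u) C0 a0 rho20 (ltW s0) fu).
Qed.

Lemma far_potential_le (u : V) : enorm (u - c) <= rho1 ->
  `|far_potential c delta w u| <= far_field_const rho1 rho2.
Proof.
move=> /far_kernel_integrable[ik le_const].
exact: le_trans (le_normr_Rintegral measurableT ik) le_const.
Qed.

Variables (psi : V -> R) (B : R).
Hypothesis mpsi : measurable_fun setT (psi : X -> R).
Hypothesis psiB : forall u, `|psi u| <= B.
Hypothesis psi_supp : supp_in (eball c rho1) psi.

Lemma far_potential_integrable : Rintegrable mu (fun u => psi u * far_potential c delta w u).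
Proof.
pose F u y := psi u * far_kernel c delta w u y.
have Fcase u : F u = (fun=> 0) \/
    Rintegrable mu (far_kernel c delta w u) /\
    \int[mu]_y `|far_kernel c delta w u y| <= far_field_const rho1 rho2.
  have [uc|uc] := pselect (eball c rho1 u).
    by right; exact: far_kernel_integrable (ltW uc).
  by left; apply/funext => y; rewrite /F psi_supp// mul0r.
have iF u : Rintegrable mu (F u).
  by have [->|[ik _]] := Fcase u; [exact: Rintegrable0|exact: RintegrableZl].
have F_le u : \int[mu]_y `|F u y| <= far_field_const rho1 rho2 * `|psi u|.
  have [->|[ik k_le]] := Fcase u.
    under eq_Rintegral do rewrite normr0.
    by rewrite Rintegral_cst// mul0r mulr_ge0// far_field_const_ge0.
  under eq_Rintegral do rewrite normrM.
  by rewrite (RintegralZl _ measurableT (Rintegrable_norm ik)) mulrC ler_wpM2r.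
have mF : measurable_fun setT (fun p : X * X => F p.1 p.2).
  apply: measurable_funM; first exact: (measurableT_comp mpsi measurable_fst).
  apply: measurable_funM; first exact: (measurableT_comp w_measurable measurable_snd).
  apply: measurable_funB; first exact: (measurable_CZ_truncB s omP d0).
  exact: (measurableT_comp (measurable_CZ_truncBr s omP c d0) measurable_snd).
have [ipsi _] := Rintegrable_bounded nmu rho10 mpsi psiB psi_supp.
have ig := RintegrableZl (far_field_const rho1 rho2) (Rintegrable_norm ipsi).
have := Rintegrable_Rintegral (nice_sigma_finite nmu) mF iF ig F_le.
congr Rintegrable; apply/funext => u; rewrite /F /far_potential.
have [uc|uc] := pselect (eball c rho1 u).
  by rewrite (RintegralZl _ measurableT (far_kernel_integrable (ltW uc)).1).
rewrite psi_supp// mul0r; under eq_Rintegral do rewrite mul0r.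
by rewrite Rintegral_cst// mul0r.
Qed.

Lemma far_potential_Rintegral_le :
  `|\int[mu]_u (psi u * far_potential c delta w u)| <=
    B * far_field_const rho1 rho2 * (Lam * rho1 `^ s).
Proof.
have B0 : 0 <= B := le_trans (normr_ge0 _) (psiB 0).
have mpot := Rintegrable_measurable far_potential_integrable.
apply: (normr_Rintegral_le (c := c) nmu rho10 mpot) => u.
  have [uc|uc] := pselect (eball c rho1 u); last first.
    by rewrite psi_supp// mul0r normr0 mulr_ge0// far_field_const_ge0.
  by rewrite normrM; apply: ler_pM => //; exact: far_potential_le (ltW uc).
by move=> uc; rewrite psi_supp// mul0r.
Qed.

End weight.

Lemma CZ_pair_far_potential (w psi : V -> R) : far_weight c rho2 w ->
  square_integrable mu w -> Cc psi -> supp_in (eball c rho1) psi -> \int[mu]_u psi u = 0 ->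
  CZ_pair s om mu delta w psi = \int[mu]_u (psi u * far_potential c delta w u).
Proof.
move=> wP Lw Cpsi psi_supp psi_mean0; have [B _ psiB] := Cc_bounded Cpsi.
have ifar := far_potential_integrable wP (Cc_measurable Cpsi) psiB psi_supp.
have ipsi := Cc_Rintegrable nmu Cpsi.
have op_c0 : \int[mu]_u (CZ_op s om mu delta w c * psi u) = 0.
  by rewrite (RintegralZl _ measurableT ipsi) psi_mean0 mulr0.
have iop := RintegrableZl (CZ_op s om mu delta w c) ipsi.
rewrite -[RHS]addr0 -op_c0 -(RintegralD measurableT ifar iop) /CZ_pair.
apply: eq_Rintegral => u _; rewrite [_ * psi u]mulrC -mulrDr; congr (_ * _).
have iu := CZ_op_integrable s0 omP nmu u d0 Lw.
have ic := CZ_op_integrable s0 omP nmu c d0 Lw.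
apply/eqP; rewrite -subr_eq -(RintegralB measurableT iu ic); apply/eqP.
by apply: eq_Rintegral => y _; rewrite -mulrBr.
Qed.

End far_field.

Section vanishing_points.
Context (R : realType) (d : nat).
Local Notation V := 'rV[R]_d.
Variables (s : R) (om : V -> R) (mu : bmeasure R d).

Definition vanishing (chi : V -> R) (x : V) (kap r : R) : Prop :=
  forall (psi : V -> R) (eta0 : R), bump x r psi -> \int[mu]_y psi y = 0 -> 0 < eta0 ->
  exists eta : R, [/\ 0 < eta, eta < eta0 & `|CZ_pair s om mu eta chi psi| <= kap * r `^ s].

Definition vanishing_point (chi : V -> R) (x : V) : Prop :=
  forall kap : R, 0 < kap -> exists2 rho : R, 0 < rho &
    forall r : R, 0 < r -> r < rho -> vanishing chi x kap r.

Variables (alpha Lam Lg : R).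
Hypotheses (s0 : 0 < s) (omP : CZ_profile alpha om) (nmu : nice s Lam mu).
Hypothesis bmu : CZ_bounded_Cc s om Lg mu.

Lemma CZ_pair_ultralimit (U : set_system nat) (chi : V -> R) : UltraFilter U -> Cc chi ->
  exists l, [/\ Cc_linear l, L2_bounded mu (Lg ^+ 2 * \int[mu]_x (chi x ^+ 2)) l &
    forall f, Cc f -> CZ_pair s om mu n.+1%:R^-1 chi f @[n --> U] --> l f].
Proof.
move=> UF Cchi; have n0 n : 0 < n.+1%:R^-1 :> R by rewrite invr_gt0.
have pair_le n f (Cf : Cc f) := CZ_pair_le s0 omP nmu bmu (n0 n) Cchi Cf.
have [n|f Cf|l [linl cvl]] :=
    Cc_linear_ultralim UF (l_ := fun n => CZ_pair s om mu n.+1%:R^-1 chi).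
- exact: (Cc_linear_CZ_pair s0 omP nmu (n0 n) (Cc_square_integrable nmu Cchi)).
- exists (Lg ^+ 2 * \int[mu]_x (chi x ^+ 2) * \int[mu]_x (f x ^+ 2) + 1) => n.
  have := pair_le n f Cf; move: (CZ_pair _ _ _ _ _ _) (_ * \int[mu]_x (f x ^+ 2)) => p q.
  rewrite -real_normK ?num_real// => pq; have := sqr_ge0 (`|p| - 1); rewrite sqrrB.
  by move: (normr_ge0 p) pq; move: `|p| => t; nra.
exists l; split=> // f Cf.
have cv_sqr : CZ_pair s om mu n.+1%:R^-1 chi f ^+ 2 @[n --> U] --> l f ^+ 2.
  by rewrite expr2; under eq_fun do rewrite expr2; apply: cvgM; exact: cvl.
rewrite -(cvg_lim _ cv_sqr)//; apply: limr_le; first exact: cvgP cv_sqr.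
by apply: nearW => n; exact: pair_le.
Qed.

Lemma ae_vanishing_point (chi : V -> R) : Cc chi ->
  {ae mu, forall x, vanishing_point chi x}.
Proof.
move=> Cchi; have [U [UF ooU]] := ultraFilterLemma (F := \oo) _.
have FU : ProperFilter U by exact: ultra_proper.
have [l [linl bndl cvl]] := CZ_pair_ultralimit UF Cchi.
have Q0 : 0 <= Lg ^+ 2 * \int[mu]_x (chi x ^+ 2) by rewrite mulr_ge0 ?sqr_ge0 ?Rintegral_sqr_ge0.
apply: negligibleS (lebesgue_point nmu linl Q0 bndl) => x.
apply: contra_not => small kap kap0.
have kap20 : 0 < kap / 2 by rewrite divr_gt0.
have [rho rho0 small_r] := small _ kap20; exists rho => // r r0 rrho psi eta0 bpsi psi0 eta00.
have l_le := small_r r r0 rrho psi bpsi psi0.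
have kr0 : 0 < kap / 2 * r `^ s by rewrite mulr_gt0// powR_gt0.
have [Cpsi _ _] := bpsi.
have /cvgrPdist_le/(_ _ kr0) near_l := cvl psi Cpsi.
have near_eta : \forall n \near U, n.+1%:R^-1 < eta0.
  by apply: ooU; exact: near_infty_natSinv_lt (PosNum eta00).
have [n [pair_l n_eta]] := filter_ex (filterI near_l near_eta).
exists n.+1%:R^-1; split=> //.
move: l_le pair_l; move: (l psi) (CZ_pair _ _ _ _ _ _) (r `^ s) => p q t.
by rewrite !ler_norml => /andP[? ?] /andP[? ?]; apply/andP; split; lra.
Qed.

End vanishing_points.

Section blowup_estimate.
Context (R : realType) (d : nat).
Local Notation V := 'rV[R]_d.
Implicit Types psi : V -> R.

Definition lip_test (N B L : R) psi : Prop :=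
  [/\ elipschitz L psi, forall y, `|psi y| <= B & supp_in (eball 0 N) psi].

Lemma lip_test_Cc (N B L : R) psi : 0 < L -> lip_test N B L psi -> Cc psi.
Proof.
by move=> L0 [psiL _ psiN]; exact: supp_in_Cc (elipschitz_continuous L0 psiL) psiN.
Qed.

Lemma lip_test_cutoff (N : R) : 0 < N -> lip_test (2 * N) 1 N^-1 (cutoff 0 N).
Proof.
move=> N0; split; [exact: cutoff_lip|exact: normr_cutoff_le1|exact: cutoff_supp].
Qed.

Lemma lip_test_le (N N' B B' L L' : R) psi : N <= N' -> B <= B' -> L <= L' ->
  lip_test N B L psi -> lip_test N' B' L' psi.
Proof.
move=> NN BB LL [psiL psiB psiN]; split.
- exact: elipschitz_le LL psiL.
- by move=> y; exact: le_trans (psiB y) BB.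
- exact: supp_inS (sub_eball NN) psiN.
Qed.

Lemma lip_testB (N B B' L L' a : R) psi psi' : `|a| <= 1 ->
  lip_test N B L psi -> lip_test N B' L' psi' ->
  lip_test N (B + B') (L + L') (fun y => psi y - a * psi' y).
Proof.
move=> a1 [psiL psiB psiN] [psiL' psiB' psiN']; split.
- move=> y z; rewrite (_ : _ - _ = (psi y - psi z) - a * (psi' y - psi' z)); last by ring.
  apply: (le_trans (ler_normB _ _)); rewrite mulrDl lerD// normrM -[leRHS]mul1r.
  exact: ler_pM.
- move=> y; apply: (le_trans (ler_normB _ _)); rewrite lerD// normrM -[leRHS]mul1r.
  exact: ler_pM.
- by move=> y yN; rewrite psiN// psiN'// mulr0 subrr.
Qed.

Variables (s alpha Lam : R) (mu : bmeasure R d) (om : V -> R).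
Hypotheses (s0 : 0 < s) (omP : CZ_profile alpha om) (nmu : nice s Lam mu).
Variables (x : V) (K r : R).
Hypotheses (xK : enorm x < K) (r0 : 0 < r).
Local Notation chi := (@cutoff R d 0 (K + 1)).
Local Notation m := (blowup_measure s mu x r).

Let Cchi : Cc chi.
Proof. by apply: cutoff_Cc; rewrite addr_gt0// (le_lt_trans _ xK)// enorm_ge0. Qed.

Lemma far_weight_blowup_cutoff (M : R) : 0 < M -> M * r <= 1 ->
  far_weight x (M * r) (fun y => chi y - cutoff 0 M (blowup x r y)).
Proof.
move=> M0 Mr; have K0 : 0 < K by exact: le_lt_trans (enorm_ge0 x) xK.
split.
- apply: Cc_measurable; apply: (CcB Cchi).
  by apply: (Cc_blowup x r0); exact: cutoff_Cc.
- move=> y; have := cutoff_itv01 0 (K + 1) y; have := cutoff_itv01 0 M (blowup x r y).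
  by rewrite ler_norml; move: (cutoff _ _ _) (cutoff _ _ _) => p q; lra.
- rewrite /eball/= => y yx; have y0 := enorm_triangle x y 0.
  rewrite !cutoff1 ?subrr ?subr0 ?addr_gt0//.
    by rewrite enorm_blowup// ler_pdivrMl// mulrC ltW.
  by move: y0 yx Mr xK; rewrite !subr0; lra.
Qed.

Lemma CZ_pair_chi_blowup_le (N M B eta : R) psi : 0 < N -> 2 * N <= M -> M * r <= 1 ->
  0 < eta -> eta <= N * r -> Cc psi -> (forall y, `|psi y| <= B) ->
  supp_in (eball 0 N) psi -> \int[m]_y psi y = 0 ->
  `|CZ_pair s om mu eta chi (fun y => psi (blowup x r y)) -
    CZ_pair s om mu eta (fun y => cutoff 0 M (blowup x r y)) (fun y => psi (blowup x r y))| <=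
    B * far_field_const s alpha Lam N M * (Lam * (N * r) `^ s).
Proof.
move=> N0 NM Mr eta0 etaN Cpsi psiB psiN psi0.
have M0 : 0 < M by move: N0 NM; lra.
have wP := far_weight_blowup_cutoff M0 Mr.
have CPhi : Cc (fun y => cutoff 0 M (blowup x r y)) by exact/(Cc_blowup x r0)/cutoff_Cc.
have CPsi := Cc_blowup x r0 Cpsi.
have [Lchi LPhi] := (Cc_square_integrable nmu Cchi, Cc_square_integrable nmu CPhi).
have Psi_supp := @supp_in_blowup _ _ x _ _ _ r0 psiN.
have Psi0 := Rintegral_blowup_eq0 r0 nmu Cpsi psi0.
have Nr0 : 0 < N * r by rewrite mulr_gt0.
have NMr : 2 * (N * r) <= M * r by rewrite mulrA ler_pM2r.
rewrite -(CZ_pairBl s0 omP nmu eta0 Lchi LPhi CPsi).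
rewrite (CZ_pair_far_potential s0 omP nmu Nr0 NMr eta0 etaN wP _ CPsi Psi_supp Psi0).
  rewrite -(far_field_const_scale s alpha Lam N0 M0 r0).
  exact: (far_potential_Rintegral_le s0 omP nmu Nr0 NMr eta0 etaN wP
    (Cc_measurable CPsi) (fun y => psiB _) Psi_supp).
exact: square_integrableB.
Qed.

Lemma vanishing_CZ_pair (B kap rho eta0 : R) psi : 0 < B -> 0 < eta0 ->
  vanishing s om mu chi x kap rho -> Cc psi -> (forall y, `|psi y| <= B) ->
  supp_in (eball x rho) psi -> \int[mu]_y psi y = 0 ->
  exists eta : R, [/\ 0 < eta, eta < eta0 &
    `|CZ_pair s om mu eta chi psi| <= B * (kap * rho `^ s)].
Proof.
move=> B0 eta00 van Cpsi psiB psi_supp psi0.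
have bpsi : bump x rho (fun y => B^-1 * psi y).
  split; [exact: CcZ| |by move=> y yr; rewrite psi_supp// mulr0].
  by move=> y; rewrite normrM gtr0_norm ?invr_gt0// ler_pdivrMl// mulr1.
have [|eta [e0 eeta0 pair_le]] := van _ eta0 bpsi _ eta00.
  by rewrite (RintegralZl _ measurableT (Cc_Rintegrable nmu Cpsi)) psi0 mulr0.
exists eta; split=> //; move: pair_le.
rewrite (Cc_linearZ (Cc_linear_CZ_pair s0 omP nmu e0 (Cc_square_integrable nmu Cchi)))//.
by rewrite normrM gtr0_norm ?invr_gt0// ler_pdivrMl.
Qed.

Lemma vanishing_blowup (N M B kap delta : R) psi : 0 < N -> 2 * N <= M -> M * r <= 1 ->
  0 < B -> 0 < delta -> vanishing s om mu chi x kap (N * r) ->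
  Cc psi -> (forall y, `|psi y| <= B) -> supp_in (eball 0 N) psi -> \int[m]_y psi y = 0 ->
  exists delta' : R, [/\ 0 < delta', delta' <= delta &
    `|CZ_pair s om m delta' (cutoff 0 M) psi| <=
      B * far_field_const s alpha Lam N M * (Lam * N `^ s) + B * (kap * N `^ s)].
Proof.
move=> N0 NM Mr B0 d0 van Cpsi psiB psiN psi0.
have M0 : 0 < M by move: N0 NM; lra.
have CPsi := Cc_blowup x r0 Cpsi.
have min0 : 0 < Num.min (r * delta) (N * r) by rewrite lt_min !mulr_gt0.
have Psi0 := Rintegral_blowup_eq0 r0 nmu Cpsi psi0.
have [eta [e0]] := vanishing_CZ_pair B0 min0 van CPsi (fun y => psiB _)
  (@supp_in_blowup _ _ x _ _ _ r0 psiN) Psi0.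
rewrite lt_min => /andP[er eN] chi_le.
have far_le := CZ_pair_chi_blowup_le N0 NM Mr e0 (ltW eN) Cpsi psiB psiN psi0.
have d'0 : 0 < eta / r by rewrite divr_gt0.
exists (eta / r); split=> //; first by rewrite ler_pdivrMr// mulrC ltW.
rewrite (CZ_pair_blowup x r0 nmu s0 omP d'0 (cutoff_Cc _ M0) Cpsi).
rewrite [r * _]mulrC divfK ?gt_eqF// normrM ger0_norm ?powR_ge0//.
move: chi_le far_le; rewrite /= (powRM _ (ltW N0) (ltW r0)).
have := powR_mulNl s r0; have := powR_ge0 r (- s).
move: (CZ_pair _ _ _ _ _ _) (CZ_pair _ _ _ _ _ _) (B * far_field_const _ _ _ _ _) => p q b.
move: (r `^ _) (r `^ _) (N `^ s) => t u n u0 ut q_le qp_le.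
have p_le : `|p| <= t * (b * (Lam * n) + B * (kap * n)).
  by move: q_le qp_le; rewrite !ler_norml => /andP[? ?] /andP[? ?]; apply/andP; split; lra.
by apply: (le_trans (ler_wpM2l u0 p_le)); rewrite [u * _]mulrA ut mul1r.
Qed.

(* The truncation at [delta] is replaced by a much smaller one by antisymmetry, [cutoff 0 M]
   is replaced by [chi] by the decay of the kernel against functions of mean zero, and what
   remains is small at a vanishing point. *)
Lemma CZ_pair_blowup_measure_le (N M B L kap delta : R) psi : 1 <= N -> 2 * N <= M ->
  M * r <= 1 -> 1 <= B -> 1 <= L -> 0 < delta -> vanishing s om mu chi x kap (N * r) ->
  lip_test N B L psi -> \int[m]_y psi y = 0 ->
  `|CZ_pair s om m delta (cutoff 0 M) psi| <=
    2 * L * B * (near_const s Lam * delta) * (Lam * (2 * M) `^ s) +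
    B * far_field_const s alpha Lam N M * (Lam * N `^ s) + B * (kap * N `^ s).
Proof.
move=> N1 NM Mr B1 L1 d0 van psiP psi0.
have [N0 B0] : 0 < N /\ 0 < B by split; [exact: lt_le_trans N1|exact: lt_le_trans B1].
have L0 : 0 < L by exact: lt_le_trans L1.
have M1 : 1 <= M by move: N1 NM; lra.
have M0 : 0 < M by exact: lt_le_trans M1.
have Cpsi := lip_test_Cc L0 psiP.
have [psiL psiB psi_supp] := psiP.
have [delta' [d'0 d'd pair_le]] := vanishing_blowup N0 NM Mr B0 d0 van Cpsi psiB psi_supp psi0.
have [phiL phiB phi_supp] : lip_test (2 * M) B L (cutoff 0 M : V -> R).
  by apply: lip_test_le (lip_test_cutoff M0); rewrite // (le_trans _ L1)// invf_le1.
have NM2 : N <= 2 * M by move: NM M1; lra.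
have M20 : 0 < 2 * M by rewrite mulr_gt0.
have trunc_le := CZ_pair_truncation s0 omP (blowup_nice x r0 nmu) d'0 d'd M20 (ltW L0)
  (cutoff_Cc 0 M0) Cpsi phi_supp (supp_inS (sub_eball NM2) psi_supp) phiB psiB phiL psiL.
rewrite -addrA; apply: le_trans (lerD trunc_le pair_le).
move: (CZ_pair s om m delta _ _) (CZ_pair s om m delta' _ _) => p q.
by rewrite -{1}(subrK q p) ler_normD.
Qed.

End blowup_estimate.

(** * Tangent measures *)

Definition pairing_decays (R : realType) (d : nat) (s : R) (om : 'rV[R]_d -> R)
    (nu : bmeasure R d) (psi : 'rV[R]_d -> R) : Prop :=
  forall eps : R, 0 < eps -> \forall M \near +oo, \forall delta \near 0^'+,
    `|CZ_pair s om nu delta (cutoff 0 M) psi| <= eps.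

Section tangent.
Context (R : realType) (d : nat).
Local Notation V := 'rV[R]_d.
Variables (s alpha Lam : R) (mu : bmeasure R d) (om : V -> R).
Hypotheses (s0 : 0 < s) (omP : CZ_profile alpha om) (nmu : nice s Lam mu).
Variables (x : V) (K : R).
Hypothesis xK : enorm x < K.
Hypothesis van : vanishing_point s om mu (cutoff 0 (K + 1)) x.
Variables (U : set_system nat) (FU : ProperFilter U) (r_ : nat -> R).
Hypotheses (r0 : forall j, 0 < r_ j) (r_cvg0 : r_ @ U --> (0 : R)).
Local Notation m j := (blowup_measure s mu x (r_ j)).
Variable nu : bmeasure R d.
Hypotheses (nnu : nice s Lam nu) (m_nu : weak_cvg U (fun j => m j) nu).
Hypothesis nu_gt0 : 0 < \int[nu]_y cutoff 0 1 y.

Let nm j : nice s Lam (m j) := blowup_nice x (r0 j) nmu.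
Let Ccut1 : Cc (@cutoff R d 0 1) := cutoff_Cc 0 ltr01.

(* A function of mean zero for the tangent measure [nu] is corrected by a multiple of
   [cutoff 0 1] in order to have mean zero for the blow-up. *)
Definition mean0_coef (psi : V -> R) (j : nat) : R :=
  (\int[m j]_y psi y) / \int[m j]_y cutoff 0 1 y.

Definition mean0_correction (psi : V -> R) (j : nat) (y : V) : R :=
  psi y - mean0_coef psi j * cutoff 0 1 y.

Variable psi : V -> R.
Hypothesis psi_mean0 : \int[nu]_y psi y = 0.

Lemma mean0_coef_cvg0 : Cc psi -> mean0_coef psi @ U --> (0 : R).
Proof.
move=> Cpsi; rewrite -[0 in X in _ --> X](mul0r (\int[nu]_y cutoff 0 1 y)^-1) -psi_mean0.
apply: cvgM; first exact: m_nu.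
by apply: cvgV; [rewrite gt_eqF|exact: m_nu].
Qed.

Lemma near_mean0_correction : Cc psi ->
  \forall j \near U, \int[m j]_y mean0_correction psi j y = 0.
Proof.
move=> Cpsi; apply: filterS (cvgr_gt _ (m_nu Ccut1) _ nu_gt0) => j J0.
have icut a := Cc_Rintegrable (nm j) (CcZ a Ccut1).
rewrite (RintegralB measurableT (Cc_Rintegrable (nm j) Cpsi) (icut _)).
by rewrite (RintegralZl _ measurableT (Cc_Rintegrable (nm j) Ccut1)) divfK ?subrr// gt_eqF.
Qed.

Lemma CZ_pair_mean0_correction_cvg (delta M : R) : Cc psi -> 0 < delta -> 0 < M ->
  CZ_pair s om (m j) delta (cutoff 0 M) (mean0_correction psi j) @[j --> U] -->
    CZ_pair s om nu delta (cutoff 0 M) psi.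
Proof.
move=> Cpsi d0 M0; have CM : Cc (@cutoff R d 0 M) by exact: cutoff_Cc.
have cvg_pair f : Cc f -> CZ_pair s om (m j) delta (cutoff 0 M) f @[j --> U] -->
    CZ_pair s om nu delta (cutoff 0 M) f.
  by move=> Cf; exact: (CZ_pair_cvg s0 omP FU nm nnu m_nu d0 CM Cf).
have lin_pair j := Cc_linear_CZ_pair s0 omP (nm j) d0 (Cc_square_integrable (nm j) CM).
rewrite -[X in _ --> X]subr0 -(mul0r (CZ_pair s om nu delta (cutoff 0 M) (cutoff 0 1))).
rewrite (_ : (fun j => _) = fun j => CZ_pair s om (m j) delta (cutoff 0 M) psi -
    mean0_coef psi j * CZ_pair s om (m j) delta (cutoff 0 M) (cutoff 0 1)).
  apply: cvgB; first exact: cvg_pair.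
  by apply: cvgM; [exact: mean0_coef_cvg0|exact: cvg_pair].
apply/funext => j.
by rewrite -(Cc_linearZ (lin_pair j) _ Ccut1) -(Cc_linearB (lin_pair j) Cpsi (CcZ _ Ccut1)).
Qed.

Lemma near_mean0_correction_le (N M B L kap delta : R) : 2 <= N -> 2 * N <= M ->
  0 <= B -> 0 < L -> 0 < delta -> 0 < kap -> lip_test N B L psi ->
  \forall j \near U,
    `|CZ_pair s om (m j) delta (cutoff 0 M) (mean0_correction psi j)| <=
      2 * (L + 1) * (B + 1) * (near_const s Lam * delta) * (Lam * (2 * M) `^ s) +
      (B + 1) * far_field_const s alpha Lam N M * (Lam * N `^ s) +
      (B + 1) * (kap * N `^ s).
Proof.
move=> N2 NM B0 L0 d0 kap0 psiP.
have N0 : 0 < N by apply: lt_le_trans N2.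
have M0 : 0 < M by move: N0 NM; lra.
have Cpsi := lip_test_Cc L0 psiP.
have [rho rho0 van_rho] := van kap0.
have Minv0 : 0 < M^-1 by rewrite invr_gt0.
near=> j.
have rj_rho : r_ j < rho / N by near: j; exact: (cvgr_lt _ r_cvg0 _ (divr_gt0 rho0 N0)).
have rj_M : r_ j < M^-1 by near: j; exact: (cvgr_lt _ r_cvg0 _ Minv0).
have coef1 : `|mean0_coef psi j| <= 1.
  by near: j; apply: (cvgr_norm_le _ (mean0_coef_cvg0 Cpsi)); rewrite normr0.
apply: (CZ_pair_blowup_measure_le s0 omP nmu xK (r0 j) _ NM) => //.
- by move: N2; lra.
- by rewrite -ler_pdivlMl// mulr1 ltW.
- by rewrite lerDr.
- by rewrite lerDr ltW.
- by apply: van_rho; [rewrite mulr_gt0|rewrite mulrC -ltr_pdivlMr].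
- apply: lip_testB => //; apply: (lip_test_le _ _ _ (lip_test_cutoff d ltr01)) => //.
  + by rewrite mulr1.
  + by rewrite invr1.
- by near: j; exact: near_mean0_correction.
Unshelve. all: end_near. Qed.

Lemma tangent_CZ_pair_le (N M B L delta : R) : 2 <= N -> 2 * N <= M ->
  0 <= B -> 0 < L -> 0 < delta -> lip_test N B L psi ->
  `|CZ_pair s om nu delta (cutoff 0 M) psi| <=
    2 * (L + 1) * (B + 1) * (near_const s Lam * delta) * (Lam * (2 * M) `^ s) +
    (B + 1) * far_field_const s alpha Lam N M * (Lam * N `^ s).
Proof.
move=> N2 NM B0 L0 d0 psiP; apply/ler_addgt0Pr => e e0.
have N0 : 0 < N by apply: lt_le_trans N2.
have M0 : 0 < M by move: N0 NM; lra.
have BN0 : 0 < (B + 1) * N `^ s by rewrite mulr_gt0 ?powR_gt0// ltr_wpDl.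
have near_le := near_mean0_correction_le N2 NM B0 L0 d0 (divr_gt0 e0 BN0) psiP.
have /cvg_norm cvg_pair := CZ_pair_mean0_correction_cvg (lip_test_Cc L0 psiP) d0 M0.
rewrite -(cvg_lim _ cvg_pair)//; apply: limr_le; first exact: cvgP cvg_pair.
by move: near_le; rewrite [(B + 1) * (e / _ * _)]mulrCA divfK// gt_eqF.
Qed.

Lemma tangent_pairing_decays (L : R) : Cc psi -> elipschitz L psi ->
  pairing_decays s om nu psi.
Proof.
move=> Cpsi psiL eps eps0.
have [N N2 psiN] := Cc_support 2 Cpsi; have [B B0 psiB] := Cc_bounded Cpsi.
have L0 : 0 < `|L| + 1 by rewrite ltr_wpDl.
have psiP : lip_test N B (`|L| + 1) psi.
  split=> //; apply: elipschitz_le psiL; apply: le_trans (ler_norm L) _.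
  by rewrite lerDl.
have [L10 B10] : 0 <= `|L| + 1 + 1 /\ 0 <= B + 1 by rewrite !addr_ge0// ltW.
have Lam0 := nice_ge0 nnu; have near0 := near_const_ge0 nnu.
pose farC := (B + 1) * (Lam * N `^ s).
have farC0 : 0 < farC + 1.
  by rewrite ltr_wpDl//; do !apply: mulr_ge0 => //; exact: powR_ge0.
have eps20 : 0 < eps / 2 by rewrite divr_gt0.
near=> M.
have NM : 2 * N <= M by near: M; apply: nbhs_pinfty_ge; exact: num_real.
have : far_field_const s alpha Lam N M <= eps / 2 / (farC + 1).
  by near: M; exact: (near_far_field_const_le s0 omP nnu N (divr_gt0 eps20 farC0)).
rewrite ler_pdivlMr// => far_le.
pose nearC := 2 * (`|L| + 1 + 1) * (B + 1) * near_const s Lam * (Lam * (2 * M) `^ s).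
have nearC0 : 0 < nearC + 1.
  by rewrite ltr_wpDl//; do !apply: mulr_ge0 => //; exact: powR_ge0.
near=> delta; have d0 : 0 < delta by near: delta; exact: nbhs_right_gt.
have : delta <= eps / 2 / (nearC + 1) by near: delta; apply: nbhs_right_le; exact: divr_gt0.
rewrite ler_pdivlMr// => near_le.
apply: (le_trans (tangent_CZ_pair_le (ltW N2) NM (ltW B0) L0 d0 psiP)).
rewrite [leRHS]splitr; apply: lerD.
  apply: le_trans near_le; rewrite [leRHS]mulrDr mulr1 -[leLHS]addr0 lerD ?(ltW d0)//.
  by rewrite le_eqVlt; apply/orP; left; apply/eqP; rewrite /nearC; ring.
apply: le_trans far_le; rewrite [leRHS]mulrDr mulr1 -[leLHS]addr0.
rewrite lerD ?(far_field_const_ge0 s0 omP nnu)//.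
by rewrite le_eqVlt; apply/orP; left; apply/eqP; rewrite /farC; ring.
Unshelve. all: end_near. Qed.

End tangent.

(** * The operator on the constant function *)

Section correction.
Context (R : realType) (d : nat).
Local Notation V := 'rV[R]_d.
Local Notation X := (Rd R d).
Variables (s : R) (om : V -> R) (nu : bmeasure R d).

Definition correction (phi : V -> R) (z u : V) : R :=
  \int[nu]_y ((1 - phi y) * (CZ_kernel s om (u - y) - CZ_kernel s om (z - y))).

Definition admissible (c : V) (r : R) (phi : V -> R) : Prop :=
  [/\ square_integrable nu phi, forall y, eball c (2 * r) y -> phi y = 1 &
      forall y, 0 <= phi y <= 1].

Variables (alpha Lam : R).
Hypotheses (s0 : 0 < s) (omP : CZ_profile alpha om) (nnu : nice s Lam nu).
Variables (c z : V) (r : R) (phi psi : V -> R).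
Hypotheses (r0 : 0 < r) (zc : eball c r z) (phiP : admissible c r phi).
Hypotheses (Cpsi : Cc psi) (psi_supp : supp_in (eball c r) psi).
Hypothesis psi_mean0 : \int[nu]_y psi y = 0.
Local Notation w := (fun y => 1 - phi y).
Local Notation pot delta w := (far_potential s nu om c delta w).

Lemma admissible_far_weight : far_weight c (2 * r) w.
Proof.
have [[mphi _] phi1 phi01] := phiP; split.
- by apply: measurable_funB => //; exact: measurable_cst.
- by move=> y; have := phi01 y; rewrite ler_norml; lra.
- by move=> y /phi1 ->; rewrite subrr.
Qed.

Lemma correctionE (delta : R) (u : V) : 0 < delta -> delta <= r -> eball c r u ->
  correction phi z u = pot delta w u - pot delta w z.
Proof.
move=> d0 dr uc; have wP := admissible_far_weight.
have ik v (vc : eball c r v) :=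
  (far_kernel_integrable s0 omP nnu r0 (lexx _) d0 dr wP (ltW vc)).1.
rewrite /far_potential -(RintegralB measurableT (ik u uc) (ik z zc)).
apply: eq_Rintegral => y _; rewrite /far_kernel.
have [yc|yc] := pselect (eball c (2 * r) y).
  by have [_ phi1 _] := phiP; rewrite phi1// subrr !mul0r subrr.
have far v : eball c r v -> delta <= enorm (v - y).
  move: yc => /eball_ge; rewrite /eball/= (enormB v y) => yc vc.
  by have := enorm_triangle v y c; move: yc vc dr; lra.
by rewrite -(CZ_trunc_far _ _ (far u uc)) -(CZ_trunc_far _ _ (far z zc)); ring.
Qed.

Lemma mul_correctionE (delta : R) (u : V) : 0 < delta -> delta <= r ->
  psi u * correction phi z u = psi u * pot delta w u - pot delta w z * psi u.
Proof.
move=> d0 dr; have [uc|uc] := pselect (eball c r u).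
  by rewrite (correctionE d0 dr uc) mulrBr [pot _ _ z * _]mulrC.
by rewrite psi_supp// !mul0r mulr0 subrr.
Qed.

Lemma far_potential_Cc_integrable (rho delta : R) (v : V -> R) :
  2 * r <= rho -> far_weight c rho v -> 0 < delta -> delta <= r ->
  Rintegrable nu (fun u => psi u * pot delta v u).
Proof.
move=> rrho vP d0 dr; have [B _ psiB] := Cc_bounded Cpsi.
exact: (far_potential_integrable s0 omP nnu r0 rrho d0 dr vP (Cc_measurable Cpsi) psiB psi_supp).
Qed.

Lemma correction_integrable : Rintegrable nu (fun u => psi u * correction phi z u).
Proof.
have wP := admissible_far_weight.
have ipot := far_potential_Cc_integrable (lexx _) wP r0 (lexx r).
have ipsi := RintegrableZl (pot r w z) (Cc_Rintegrable nnu Cpsi).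
by under [X in Rintegrable _ X]eq_fun do rewrite (mul_correctionE _ r0 (lexx r));
  exact: RintegrableB.
Qed.

Lemma Rintegral_correction (delta : R) : 0 < delta -> delta <= r ->
  \int[nu]_u (psi u * correction phi z u) = \int[nu]_u (psi u * pot delta w u).
Proof.
move=> d0 dr; under eq_Rintegral do rewrite (mul_correctionE _ d0 dr).
have ipot := far_potential_Cc_integrable (lexx _) admissible_far_weight d0 dr.
have ipsi := Cc_Rintegrable nnu Cpsi.
rewrite (RintegralB measurableT ipot (RintegrableZl (pot delta w z) ipsi)).
by rewrite (RintegralZl _ measurableT ipsi) psi_mean0 mulr0 subr0.
Qed.

Lemma Rintegral_far_potentialD (rho delta : R) (v1 v2 : V -> R) : 2 * r <= rho ->
  0 < delta -> delta <= r -> far_weight c (2 * r) v1 -> far_weight c rho v2 ->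
  \int[nu]_u (psi u * pot delta (fun y => v1 y + v2 y) u) =
    \int[nu]_u (psi u * pot delta v1 u) + \int[nu]_u (psi u * pot delta v2 u).
Proof.
move=> rrho d0 dr v1P v2P.
have i1 := far_potential_Cc_integrable (lexx _) v1P d0 dr.
have i2 := far_potential_Cc_integrable rrho v2P d0 dr.
rewrite -(RintegralD measurableT i1 i2); apply: eq_Rintegral => u _.
have [uc|uc] := pselect (eball c r u); last by rewrite psi_supp// !mul0r addr0.
have [k1 _] := far_kernel_integrable s0 omP nnu r0 (lexx _) d0 dr v1P (ltW uc).
have [k2 _] := far_kernel_integrable s0 omP nnu r0 rrho d0 dr v2P (ltW uc).
rewrite -mulrDr -(RintegralD measurableT k1 k2); congr (_ * _).
by apply: eq_Rintegral => y _; rewrite /far_kernel mulrDl.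
Qed.

Section cutoff_at_infinity.
Variable M : R.
Hypothesis cM : enorm c + 2 * r <= M.

Let M0 : 0 < M.
Proof. by move: (enorm_ge0 c) r0 cM; lra. Qed.

Let cutoff_near y : eball c (M - enorm c) y -> cutoff 0 M y = 1.
Proof.
rewrite /eball/= => yc; apply: cutoff1 => //.
by have := enorm_triangle c y 0; rewrite !subr0; move: yc; lra.
Qed.

Lemma far_weight_cutoffB : far_weight c (2 * r) (fun y => cutoff 0 M y - phi y).
Proof.
have [[mphi _] phi1 phi01] := phiP; split.
- by apply: measurable_funB => //; apply: Cc_measurable; exact: cutoff_Cc.
- by move=> y; have := phi01 y; have := cutoff_itv01 0 M y; rewrite ler_norml; lra.
- move=> y yc; rewrite phi1// cutoff_near ?subrr//; apply: sub_eball yc.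
  by move: cM; lra.
Qed.

Lemma far_weight_1Bcutoff : far_weight c (M - enorm c) (fun y => 1 - cutoff 0 M y).
Proof.
split.
- apply: measurable_funB; first exact: measurable_cst.
  by apply: Cc_measurable; exact: cutoff_Cc.
- by move=> y; have := cutoff_itv01 0 M y; rewrite ler_norml; lra.
- by move=> y /cutoff_near ->; rewrite subrr.
Qed.

(* Splitting [1 - phi] as [(cutoff 0 M - phi) + (1 - cutoff 0 M)]: the first summand is the
   difference of two pairings, the second contributes [O(M^(-alpha))]. *)
Lemma CZ_pair_correction_le (delta B : R) : 0 < delta -> delta <= r ->
  (forall y, `|psi y| <= B) ->
  `|CZ_pair s om nu delta phi psi + \int[nu]_u (psi u * correction phi z u)| <=
    `|CZ_pair s om nu delta (cutoff 0 M) psi| +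
    B * far_field_const s alpha Lam r (M - enorm c) * (Lam * r `^ s).
Proof.
move=> d0 dr psiB; have [Lphi _ _] := phiP.
have LM := Cc_square_integrable nnu (cutoff_Cc (0 : V) M0).
have rM : 2 * r <= M - enorm c by move: cM; lra.
have far_le := far_potential_Rintegral_le s0 omP nnu r0 rM d0 dr far_weight_1Bcutoff
  (Cc_measurable Cpsi) psiB psi_supp.
have pairB := CZ_pairBl s0 omP nnu d0 LM Lphi Cpsi.
rewrite (CZ_pair_far_potential s0 omP nnu r0 (lexx _) d0 dr far_weight_cutoffB
  (square_integrableB LM Lphi) Cpsi psi_supp psi_mean0) in pairB.
have wE : w = fun y => (cutoff 0 M y - phi y) + (1 - cutoff 0 M y).
  by apply/funext => y; ring.
rewrite (Rintegral_correction d0 dr) [in X in `|_ + X|]wE.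
rewrite (Rintegral_far_potentialD rM d0 dr far_weight_cutoffB far_weight_1Bcutoff) pairB.
rewrite addrA [_ + (_ - _)]addrC subrK.
by apply: (le_trans (ler_normD _ _)); rewrite lerD2l.
Qed.

End cutoff_at_infinity.

Lemma CZ_pair_cvg_correction : pairing_decays s om nu psi ->
  CZ_pair s om nu delta phi psi @[delta --> 0^'+] -->
    - \int[nu]_u (psi u * correction phi z u).
Proof.
move=> decay; apply/cvgrPdist_le => e e0.
have [B B0 psiB] := Cc_bounded Cpsi.
have e20 : 0 < e / 2 by rewrite divr_gt0.
pose C := B * (Lam * r `^ s).
have C0 : 0 < C + 1 by rewrite ltr_wpDl// !mulr_ge0 ?powR_ge0 ?(nice_ge0 nnu)// ltW.
have near_far : \forall M \near +oo,
    far_field_const s alpha Lam r (M - enorm c) <= e / 2 / (C + 1).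
  have [M1 [_ far_small]] := near_far_field_const_le s0 omP nnu r (divr_gt0 e20 C0).
  near=> M; apply: far_small; rewrite ltrBrDr.
  by near: M; apply: nbhs_pinfty_gt; exact: num_real.
near +oo_R => M.
have cM : enorm c + 2 * r <= M by near: M; apply: nbhs_pinfty_ge; exact: num_real.
have : far_field_const s alpha Lam r (M - enorm c) <= e / 2 / (C + 1) by near: M.
rewrite ler_pdivlMr// => far_le.
near=> delta; have d0 : 0 < delta by near: delta; exact: nbhs_right_gt.
have dr : delta <= r by near: delta; exact: nbhs_right_le.
have decay_le : `|CZ_pair s om nu delta (cutoff 0 M) psi| <= e / 2.
  by near: delta; near: M; exact: decay.
rewrite distrC opprK; apply: (le_trans (CZ_pair_correction_le cM d0 dr psiB)).
rewrite [leRHS]splitr; apply: lerD => //; apply: le_trans far_le.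
rewrite [leRHS]mulrDr mulr1 -[leLHS]addr0 lerD ?(far_field_const_ge0 s0 omP nnu)//.
by rewrite le_eqVlt; apply/orP; left; apply/eqP; rewrite /C; ring.
Unshelve. all: end_near. Qed.

End correction.

(** * Complex vector-valued kernels *)

Section complex_parts.
Context (R : realType).
Implicit Types (b : bool) (z w : R[i]).
Local Open Scope complex_scope.

Definition cpart b z : R := if b then complex.Re z else complex.Im z.

Lemma cpart0 b : cpart b 0 = 0.
Proof. by case: b. Qed.

Lemma cpartD b z w : cpart b (z + w) = cpart b z + cpart b w.
Proof. by case: b; case: z; case: w. Qed.

Lemma cpartN b z : cpart b (- z) = - cpart b z.
Proof. by case: b; case: z. Qed.

Lemma cpartB b z w : cpart b (z - w) = cpart b z - cpart b w.
Proof. by rewrite cpartD cpartN. Qed.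

Lemma cpartM b z w : cpart b (z * w) =
  cpart true z * cpart b w + (-1) ^+ b * (cpart false z * cpart (~~ b) w).
Proof. by case: b; case: z; case: w => u v x y /=; rewrite ?expr1 ?mulN1r ?expr0 ?mul1r. Qed.

Lemma cpart_realM b (a : R) z : cpart b (a%:C * z) = a * cpart b z.
Proof. by rewrite cpartM /= mul0r mulr0 addr0. Qed.

Lemma cabs2_ge0 z : 0 <= cabs2 z.
Proof. by rewrite addr_ge0 ?sqr_ge0. Qed.

Lemma sqr_cpart_le b z : cpart b z ^+ 2 <= cabs2 z.
Proof. by case: b; rewrite /cabs2 ?lerDl ?lerDr sqr_ge0. Qed.

Lemma normr_cpart_le b z : `|cpart b z| <= cabs z.
Proof. by rewrite -sqrtr_sqr; apply: ler_wsqrtr; exact: sqr_cpart_le. Qed.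

Variable n : nat.
Implicit Types (v : 'rV[R[i]]_n) (p : 'I_n * bool).

Lemma cvnorm2E v : cvnorm2 v = \sum_p cpart p.2 (v ord0 p.1) ^+ 2.
Proof.
rewrite -(pair_bigA _ (fun j b => cpart b (v ord0 j) ^+ 2)); apply: eq_bigr => j _.
by rewrite big_bool.
Qed.

Lemma cvnorm2_ge0 v : 0 <= cvnorm2 v.
Proof. by rewrite sumr_ge0// => j _; exact: cabs2_ge0. Qed.

Lemma sqr_cpart_le_cvnorm2 p v : cpart p.2 (v ord0 p.1) ^+ 2 <= cvnorm2 v.
Proof. by rewrite cvnorm2E (bigD1 p)//= lerDl sumr_ge0// => q _; exact: sqr_ge0. Qed.

Lemma normr_cpart_le_cvnorm p v : `|cpart p.2 (v ord0 p.1)| <= cvnorm v.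
Proof. by rewrite -sqrtr_sqr; apply: ler_wsqrtr; exact: sqr_cpart_le_cvnorm2. Qed.

Lemma cvnorm_le v (e : R) : 0 <= e ->
  (forall p, `|cpart p.2 (v ord0 p.1)| <= e) -> cvnorm v <= (n * 2)%:R * e.
Proof.
move=> e0 ve; have ne0 : 0 <= (n * 2)%:R * e by rewrite mulr_ge0.
rewrite -(ger0_norm ne0) -sqrtr_sqr; apply: ler_wsqrtr; rewrite cvnorm2E.
apply: (@le_trans _ _ (\sum_(p : 'I_n * bool) e ^+ 2)).
  by apply: ler_sum => p _; rewrite -real_normK ?num_real// lerXn2r ?nnegrE.
rewrite sumr_const card_prod card_ord card_bool -[_ *+ _]mulr_natl exprMn.
by rewrite ler_wpM2r ?sqr_ge0// -natrX ler_nat; case: (n * 2)%N => // k; rewrite expnS leq_pmulr.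
Qed.

End complex_parts.

Section kernel_parts.
Context (R : realType) (d d' : nat).
Local Notation V := 'rV[R]_d.
Local Notation X := (Rd R d).
Variables (s alpha : R) (Om : V -> 'rV[R[i]]_d').
Hypotheses (a01 : 0 < alpha <= 1) (OmP : CZ_Omega alpha Om).
Implicit Types (p : 'I_d' * bool) (b : bool).

Definition Om_part p (x : V) : R := cpart p.2 (Om x ord0 p.1).

Lemma CZ_profile_Om_part p : CZ_profile alpha (Om_part p).
Proof.
have [OmZ Om_unit Om_holder _] := OmP.
have hom (l : R) x : Om_part p (l *: x) = l * Om_part p x.
  by rewrite /Om_part OmZ mxE cpart_realM.
split=> // [x|x x' x1 x'1]; last first.
  rewrite /Om_part -cpartB.
  have := normr_cpart_le_cvnorm p (Om x - Om x'); rewrite !mxE => /le_trans; apply.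
  exact: Om_holder.
have [->|x0] := eqVneq x 0; first by rewrite -(scale0r (0 : V)) hom mul0r normr0 enorm_ge0.
have nx0 := enorm_gt0 x0; have u1 := enorm_unit x0.
rewrite -{1}[x]scale1r -(mulfV (lt0r_neq0 nx0)) -scalerA hom.
rewrite normrM gtr0_norm// -[leRHS]mulr1 ler_pM2l//.
exact: le_trans (normr_cpart_le_cvnorm _ _) (Om_unit _ u1).
Qed.

Lemma cpart_Kdelta (delta : R) (x : V) j b :
  cpart b (Kdelta s Om delta x ord0 j) = CZ_trunc s (Om_part (j, b)) delta x.
Proof. by rewrite mxE cpart_realM CZ_truncE. Qed.

Lemma cpart_Kern (x : V) j b :
  cpart b (Kern s Om x ord0 j) = CZ_kernel s (Om_part (j, b)) x.
Proof.
rewrite /Kern; case: eqP => [->|_]; last by rewrite mxE cpart_realM CZ_kernelE.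
by rewrite mxE cpart0 CZ_kernelE (profile0 (CZ_profile_Om_part _)) mulr0.
Qed.

Variable mu : bmeasure R d.

Lemma cpart_cint b (f : V -> R[i]) : cpart b (cint mu f) = \int[mu]_x cpart b (f x).
Proof. by case: b. Qed.

Lemma cpart_cvint_scale (n : nat) (f : V -> R[i]) (F : V -> 'rV[R[i]]_n) j b :
  (forall b b', Rintegrable mu (fun x => cpart b (f x) * cpart b' (F x ord0 j))) ->
  cpart b (cvint mu (fun x => f x *: F x) ord0 j) =
    \int[mu]_x (cpart true (f x) * cpart b (F x ord0 j)) +
    (-1) ^+ b * \int[mu]_x (cpart false (f x) * cpart (~~ b) (F x ord0 j)).
Proof.
move=> ifF; rewrite mxE cpart_cint -(RintegralZl _ measurableT (ifF _ _)).
rewrite -(RintegralD measurableT (ifF _ _) (RintegrableZl _ (ifF _ _))).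
by apply: eq_Rintegral => x _; rewrite mxE cpartM.
Qed.

Lemma cpart_cvint_real_scale (n : nat) (f : V -> R) (F : V -> 'rV[R[i]]_n) j b :
  cpart b (cvint mu (fun x => (f x)%:C%C *: F x) ord0 j) =
    \int[mu]_x (f x * cpart b (F x ord0 j)).
Proof. by rewrite mxE cpart_cint; apply: eq_Rintegral => x _; rewrite mxE cpart_realM. Qed.

Lemma cpart_Tdelta_real (delta : R) (f : V -> R) (x : V) j b :
  cpart b (Tdelta s Om mu delta (fun y => (f y)%:C%C) x ord0 j) =
    CZ_op s (Om_part (j, b)) mu delta f x.
Proof.
by rewrite cpart_cvint_real_scale; apply: eq_Rintegral => y _; rewrite cpart_Kdelta.
Qed.

Lemma square_integrable_cpart (f : V -> R[i]) b : L2 mu f ->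
  square_integrable mu (fun x => cpart b (f x)).
Proof.
move=> [mRe mIm fi].
have mpart b' : measurable_fun setT (fun x : X => cpart b' (f x)) by case: b'.
have mabs : measurable_fun setT (fun x : X => cabs2 (f x)).
  by apply: measurable_funD; exact: measurable_funX.
have fi_le : (\int[mu]_x (cabs2 (f x))%:E <= (fine (\int[mu]_x (cabs2 (f x))%:E))%:E)%E.
  by rewrite fineK// ge0_fin_numE// integral_ge0// => x _; rewrite lee_fin cabs2_ge0.
have [iabs _] := Rintegrable_ge0_le mabs (fun x => cabs2_ge0 (f x)) fi_le.
split=> //; apply: le_Rintegrable iabs _; first exact: measurable_funX.
by move=> x; rewrite ger0_norm ?sqr_ge0// sqr_cpart_le.
Qed.

Lemma L2_real (f : V -> R) : square_integrable mu f -> L2 mu (fun x => (f x)%:C%C).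
Proof.
move=> [mf f2]; split; [exact: mf|exact: (@measurable_cst _ _ X R setT 0)|].
under eq_integral do rewrite /cabs2/= expr0n addr0.
by rewrite -(EFin_Rintegral f2) ltry.
Qed.

Variable Lam : R.
Hypotheses (s0 : 0 < s) (nmu : nice s Lam mu).

Lemma cpart_Tdelta (delta : R) (f : V -> R[i]) (x : V) j b : 0 < delta -> L2 mu f ->
  cpart b (Tdelta s Om mu delta f x ord0 j) =
    CZ_op s (Om_part (j, b)) mu delta (fun y => cpart true (f y)) x +
    (-1) ^+ b * CZ_op s (Om_part (j, ~~ b)) mu delta (fun y => cpart false (f y)) x.
Proof.
move=> d0 Lf; rewrite cpart_cvint_scale => [|b1 b2].
  by congr (_ + _ * _); apply: eq_Rintegral => y _; rewrite cpart_Kdelta.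
under [X in Rintegrable _ X]eq_fun do rewrite cpart_Kdelta.
exact: (CZ_op_integrable s0 (CZ_profile_Om_part _) nmu x d0 (square_integrable_cpart b1 Lf)).
Qed.

Lemma continuous_cvnorm2_Tdelta (delta : R) (f : V -> R[i]) : 0 < delta -> L2 mu f ->
  continuous (fun x => cvnorm2 (Tdelta s Om mu delta f x)).
Proof.
move=> d0 Lf; under [X in continuous X]eq_fun do rewrite cvnorm2E.
apply: continuous_fun_sum => -[j b] /=.
have cop b1 b2 : continuous (CZ_op s (Om_part (j, b1)) mu delta (fun y => cpart b2 (f y))).
  exact: (CZ_op_continuous s0 (CZ_profile_Om_part _) nmu d0 (square_integrable_cpart _ Lf)).
under [X in continuous X]eq_fun do rewrite (cpart_Tdelta _ _ _ d0 Lf) expr2.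
have cpart_cont : continuous (fun x =>
    CZ_op s (Om_part (j, b)) mu delta (fun y => cpart true (f y)) x +
    (-1) ^+ b * CZ_op s (Om_part (j, ~~ b)) mu delta (fun y => cpart false (f y)) x).
  by apply: continuous_funD => //; apply: continuous_funM => //; exact: cst_continuous.
exact: continuous_funM.
Qed.

Lemma good_CZ_bounded_Cc (Lg : R) p : good s Om Lg mu -> CZ_bounded_Cc s (Om_part p) Lg mu.
Proof.
move=> [_ gmu] delta f d0 Cf; have Lf := Cc_square_integrable nmu Cf.
have := gmu delta _ d0 (L2_real Lf).
under [in X in (_ * X)%E]eq_integral do rewrite /cabs2/= expr0n addr0.
apply: le_trans; apply: ge0_le_integral => //.
- by move=> x _; rewrite lee_fin sqr_ge0.
- apply/measurable_EFinP; apply: measurable_funX; apply: continuous_measurable_Rd.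
  exact: (CZ_op_continuous s0 (CZ_profile_Om_part _) nmu d0 Lf).
- apply/measurable_EFinP; apply: continuous_measurable_Rd.
  exact: (continuous_cvnorm2_Tdelta d0 (L2_real Lf)).
- by move=> x _; rewrite lee_fin [p]surjective_pairing -cpart_Tdelta_real sqr_cpart_le_cvnorm2.
Qed.

Lemma sqrrD_sign_le (b : bool) (u v : R) :
  (u + (-1) ^+ b * v) ^+ 2 <= 2 * (u ^+ 2 + v ^+ 2).
Proof.
by case: b; rewrite ?expr1 ?expr0 ?mulN1r ?mul1r;
  [have := sqr_ge0 (u + v)|have := sqr_ge0 (u - v)]; lra.
Qed.

Lemma cvnorm2_Tdelta_le (delta : R) (f : V -> R[i]) (x : V) : 0 < delta -> L2 mu f ->
  cvnorm2 (Tdelta s Om mu delta f x) <= \sum_p 2 * (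
    CZ_op s (Om_part p) mu delta (fun y => cpart true (f y)) x ^+ 2 +
    CZ_op s (Om_part (p.1, ~~ p.2)) mu delta (fun y => cpart false (f y)) x ^+ 2).
Proof.
move=> d0 Lf; rewrite cvnorm2E; apply: ler_sum => -[j b] _ /=.
by rewrite (cpart_Tdelta _ _ _ d0 Lf) sqrrD_sign_le.
Qed.

Variable Lg : R.
Hypothesis bmu : forall p, CZ_bounded s (Om_part p) Lg mu.

Lemma CZ_op_sqr_integrable (delta : R) (f : V -> R) p : 0 < delta -> square_integrable mu f ->
  Rintegrable mu (fun x => CZ_op s (Om_part p) mu delta f x ^+ 2) /\
  \int[mu]_x (CZ_op s (Om_part p) mu delta f x ^+ 2) <= Lg ^+ 2 * \int[mu]_x (f x ^+ 2).
Proof.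
move=> d0 Lf; apply: Rintegrable_ge0_le; [|by move=> x; exact: sqr_ge0|exact: bmu].
apply: measurable_funX; apply: continuous_measurable_Rd.
exact: (CZ_op_continuous s0 (CZ_profile_Om_part _) nmu d0 Lf).
Qed.

Lemma integral_cvnorm2_Tdelta_le (delta : R) (f : V -> R[i]) : 0 < delta -> L2 mu f ->
  (\int[mu]_x (cvnorm2 (Tdelta s Om mu delta f x))%:E <=
    ((d' * 4)%:R * Lg ^+ 2)%:E * \int[mu]_x (cabs2 (f x))%:E)%E.
Proof.
move=> d0 Lf; have L2Re := square_integrable_cpart true Lf.
have L2Im := square_integrable_cpart false Lf.
have fE : (\int[mu]_x (cabs2 (f x))%:E)%E =
    (\int[mu]_x (cpart true (f x) ^+ 2) + \int[mu]_x (cpart false (f x) ^+ 2))%:E.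
  by rewrite -(RintegralD measurableT L2Re.2 L2Im.2)
    (EFin_Rintegral (RintegrableD L2Re.2 L2Im.2)).
pose G p x := 2 * (CZ_op s (Om_part p) mu delta (fun y => cpart true (f y)) x ^+ 2 +
  CZ_op s (Om_part (p.1, ~~ p.2)) mu delta (fun y => cpart false (f y)) x ^+ 2).
have GP p : Rintegrable mu (G p) /\ \int[mu]_x G p x <= 2 * Lg ^+ 2 *
    (\int[mu]_x (cpart true (f x) ^+ 2) + \int[mu]_x (cpart false (f x) ^+ 2)).
  have [iRe leRe] := CZ_op_sqr_integrable p d0 L2Re.
  have [iIm leIm] := CZ_op_sqr_integrable (p.1, ~~ p.2) d0 L2Im.
  have iReIm := RintegrableD iRe iIm; split; first exact: RintegrableZl.
  rewrite (RintegralZl _ measurableT iReIm) (RintegralD measurableT iRe iIm) -mulrA.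
  by rewrite ler_wpM2l// mulrDr lerD.
have iG := Rintegrable_sum (index_enum _) (fun p => (GP p).1).
apply: (@le_trans _ _ (\int[mu]_x (\sum_p G p x)%:E)%E).
  apply: ge0_le_integral => //.
  - by move=> x _; rewrite lee_fin cvnorm2_ge0.
  - apply/measurable_EFinP; apply: continuous_measurable_Rd.
    exact: (continuous_cvnorm2_Tdelta d0 Lf).
  - by apply/measurable_EFinP; exact: Rintegrable_measurable iG.
  - by move=> x _; rewrite lee_fin; exact: cvnorm2_Tdelta_le.
rewrite -(EFin_Rintegral iG) fE -EFinM lee_fin (Rintegral_sum _ (fun p => (GP p).1)).
apply: (le_trans (ler_sum _ (fun p _ => (GP p).2))).
rewrite sumr_const card_prod card_ord card_bool -[_ *+ _]mulr_natl !mulrA -natrM.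
by rewrite -mulnA.
Qed.

Lemma CZ_bounded_good : (0 < d')%N -> 0 <= Lg -> good s Om (Lam + (d' * 2)%:R * Lg) mu.
Proof.
move=> d'0 Lg0; have Lam0 := nice_ge0 nmu; have LgD : 0 <= (d' * 2)%:R * Lg by rewrite mulr_ge0.
split; first by apply: (nice_le nmu); rewrite lerDl.
move=> delta f d0 Lf; apply: (le_trans (integral_cvnorm2_Tdelta_le d0 Lf)).
apply: lee_wpmul2r; first by apply: integral_ge0 => x _; rewrite lee_fin cabs2_ge0.
rewrite lee_fin; apply: (@le_trans _ _ (((d' * 2)%:R * Lg) ^+ 2)).
  rewrite exprMn ler_wpM2r ?sqr_ge0// -natrX ler_nat expnMn leq_mul2r.
  by rewrite /= expnS leq_pmulr// expn_gt0 d'0.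
by rewrite lerXn2r ?nnegrE ?addr_ge0// lerDr.
Qed.

End kernel_parts.

Section complex_correction.
Context (R : realType) (d d' : nat).
Local Notation V := 'rV[R]_d.
Variables (s alpha Lam : R) (Om : V -> 'rV[R[i]]_d') (nu : bmeasure R d).
Hypotheses (a01 : 0 < alpha <= 1) (OmP : CZ_Omega alpha Om).
Hypotheses (s0 : 0 < s) (nnu : nice s Lam nu).

Lemma elipschitz_cpart (psi : V -> R[i]) b : lip_cs psi ->
  exists2 L, 0 < L & elipschitz L (fun x => cpart b (psi x)).
Proof.
move=> [[L psiL] _]; have L1 : 0 < `|L| + 1 by rewrite ltr_wpDl.
exists (`|L| + 1) => // x y; rewrite -cpartB; apply: (le_trans (normr_cpart_le _ _)).
apply: (le_trans (psiL x y)); rewrite ler_wpM2r ?enorm_ge0//.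
by apply: le_trans (ler_norm L) _; rewrite lerDl.
Qed.

Lemma Cc_cpart (psi : V -> R[i]) b : lip_cs psi -> Cc (fun x => cpart b (psi x)).
Proof.
move=> lpsi; have [L L0 psiL] := elipschitz_cpart b lpsi; have [_ [c [r psi0]]] := lpsi.
apply: (@supp_in_Cc _ _ c r) => [|x /eball_ge xr]; first exact: elipschitz_continuous psiL.
by rewrite psi0// cpart0.
Qed.

Lemma cpart_pairTdelta (delta : R) (phi : V -> R) (psi : V -> R[i]) j b :
  0 < delta -> square_integrable nu phi -> lip_cs psi ->
  cpart b (pairTdelta s Om nu delta (fun y => (phi y)%:C%C) psi ord0 j) =
    CZ_pair s (Om_part Om (j, b)) nu delta phi (fun x => cpart true (psi x)) +
    (-1) ^+ b *
    CZ_pair s (Om_part Om (j, ~~ b)) nu delta phi (fun x => cpart false (psi x)).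
Proof.
move=> d0 Lphi lpsi; rewrite cpart_cvint_scale => [|b1 b2].
  by congr (_ + _ * _); apply: eq_Rintegral => x _; rewrite cpart_Tdelta_real.
under [X in Rintegrable _ X]eq_fun do rewrite cpart_Tdelta_real.
exact: (CZ_pair_integrable s0 (CZ_profile_Om_part a01 OmP _) nnu d0 Lphi (Cc_cpart b1 lpsi)).
Qed.

Lemma cpart_corr_term (c z : V) (r : R) (phi : V -> R) (psi : V -> R[i]) j b :
  0 < r -> eball c r z -> admissible nu c r phi -> lip_cs psi ->
  (forall u, ~ eball c r u -> psi u = 0) ->
  cpart b (corr_term s Om nu psi phi z ord0 j) =
    \int[nu]_u (cpart true (psi u) * correction s (Om_part Om (j, b)) nu phi z u) +
    (-1) ^+ b *
    \int[nu]_u (cpart false (psi u) * correction s (Om_part Om (j, ~~ b)) nu phi z u).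
Proof.
move=> r0 zc phiP lpsi psi_supp.
pose F x := cvint nu (fun y => (1 - phi y)%:C%C *: (Kern s Om (x - y) - Kern s Om (z - y))).
have FE x b' : cpart b' (F x ord0 j) = correction s (Om_part Om (j, b')) nu phi z x.
  rewrite cpart_cvint_real_scale; apply: eq_Rintegral => y _; congr (_ * _).
  by rewrite -!(cpart_Kern s a01 OmP) -cpartB !mxE.
rewrite (cpart_cvint_scale (F := F)) => [|b1 b2].
  by congr (_ + _ * _); apply: eq_Rintegral => x _; rewrite FE.
under [X in Rintegrable _ X]eq_fun do rewrite FE.
apply: (correction_integrable s0 (CZ_profile_Om_part a01 OmP _) nnu r0 zc phiP (Cc_cpart b1 lpsi)).
by move=> u /psi_supp ->; rewrite cpart0.
Qed.

Lemma pairT_is_cpart (f g : V -> R[i]) (L : 'rV[R[i]]_d') :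
  (forall p, cpart p.2 (pairTdelta s Om nu delta f g ord0 p.1) @[delta --> 0^'+] -->
    cpart p.2 (L ord0 p.1)) -> pairT_is s Om nu f g L.
Proof.
move=> cvg_parts eps eps0; pose e := eps / ((d' * 2)%:R + 1).
have e0 : 0 < e by rewrite divr_gt0.
have : \forall delta \near 0^'+, forall p,
    `|cpart p.2 (L ord0 p.1) - cpart p.2 (pairTdelta s Om nu delta f g ord0 p.1)| <= e.
  by apply: filter_forall => p; have /cvgrPdist_le := cvg_parts p; exact.
rewrite near_withinE => /nbhs_ballP[eta /= eta0 near_eta]; exists eta => // delta d0 de.
have pair_le : cvnorm (pairTdelta s Om nu delta f g - L) <= (d' * 2)%:R * e.
  apply: (cvnorm_le (ltW e0)) => p; rewrite mxE [in X in _ + X]mxE cpartB distrC.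
  by apply: near_eta => //; rewrite /ball/= sub0r normrN gtr0_norm.
apply: (le_lt_trans pair_le); rewrite /e mulrCA gtr_pMr//.
by rewrite ltr_pdivrMr// mul1r ltrDl.
Qed.

Lemma pairing_decays_reflectionless (Lg : R) : (0 < d')%N -> 0 < Lg ->
  (forall p, CZ_bounded s (Om_part Om p) Lg nu) ->
  (forall p psi L, Cc psi -> elipschitz L psi -> \int[nu]_y psi y = 0 ->
    pairing_decays s (Om_part Om p) nu psi) ->
  reflectionless s Om nu.
Proof.
move=> d'0 Lg0 bnu decay; split.
  exists (Lam + (d' * 2)%:R * Lg); last exact: (CZ_bounded_good a01 OmP s0 nnu bnu d'0 (ltW Lg0)).
  by rewrite ltr_wpDl ?(nice_ge0 nnu)// mulr_gt0// ltr0n muln_gt0 d'0.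
move=> psi lpsi psiI c r z phi r0 sub /set_mem zc Lphi phi1 phi01.
have psi_supp u : ~ eball c r u -> psi u = 0.
  by apply: contra_notP => /eqP psiu; apply: sub; exact: subset_closure.
have phiP : admissible nu c r phi.
  split=> // [|y yc]; last exact/phi1/mem_set.
  exact: (square_integrable_cpart true Lphi).
exists (- corr_term s Om nu psi phi z); split; last by rewrite addNr.
apply: pairT_is_cpart => -[j b] /=.
have cvg_part b1 b2 : CZ_pair s (Om_part Om (j, b1)) nu delta phi (fun x => cpart b2 (psi x))
      @[delta --> 0^'+] -->
    - \int[nu]_u (cpart b2 (psi u) * correction s (Om_part Om (j, b1)) nu phi z u).
  have [L _ psiL] := elipschitz_cpart b2 lpsi; have Cpsi := Cc_cpart b2 lpsi.
  have psi0 : \int[nu]_y cpart b2 (psi y) = 0 by rewrite -cpart_cint psiI cpart0.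
  apply: (CZ_pair_cvg_correction s0 (CZ_profile_Om_part a01 OmP _) nnu r0 zc phiP Cpsi _ psi0).
    by move=> u /psi_supp ->; rewrite cpart0.
  exact: decay psiL psi0.
rewrite mxE cpartN [X in _ --> - X](cpart_corr_term j b r0 zc phiP lpsi psi_supp) opprD -mulrN.
apply: cvg_trans (near_eq_cvg _)
  (cvgD (cvg_part b true) (cvgMr (a := (-1) ^+ b) (cvg_part (~~ b) false))).
by near=> delta; rewrite cpart_pairTdelta//; case: phiP.
Unshelve. all: end_near. Qed.

End complex_correction.

Section tangent_mass.
Context (R : realType) (d : nat).
Local Notation V := 'rV[R]_d.
Local Notation X := (Rd R d).

Lemma nonzero_eball (mu : bmeasure R d) : ~ is_zero_measure mu ->
  exists n : nat, mu (eball 0 n.+1%:R) <> 0%E.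
Proof.
move=> mu_neq0; apply: contrapT => /forallNP null; apply: mu_neq0 => A mA.
have neg n : mu.-negligible (eball 0 n.+1%:R : set X).
  apply/negligibleP; first exact: measurable_eball.
  by apply: contrapT; exact: null.
apply: measure_negligible => //; apply: negligibleS (negligible_bigcup neg) => x _.
by exists (Num.truncn (enorm x)) => //; rewrite /eball/= subr0; exact: truncnS_gt.
Qed.

Variables (s Lam : R) (mu : bmeasure R d).
Hypothesis nmu : nice s Lam mu.

Lemma cutoff_integral_gt0_neq0 : 0 < \int[mu]_y cutoff 0 1 y -> ~ is_zero_measure mu.
Proof.
move=> pos zero; move: pos.
have Ccut : Cc (@cutoff R d 0 1) := cutoff_Cc 0 ltr01.
have mball := measurable_eball (0 : V) (2 * 1).
have [_] := Rintegral_le_measure mball (nice_lty nmu _ _) (Cc_measurable Ccut)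
  (@cutoff_itv01 _ _ _ _) (@cutoff_supp R d 0 1 ltr01).
by rewrite (zero _ mball) leNgt => /negP.
Qed.

Lemma blowup_mass_ge (c r : R) (x : V) : 0 < r -> ((c * r `^ s)%:E <= mu (eball x r))%E ->
  c <= \int[blowup_measure s mu x r]_y cutoff 0 1 y.
Proof.
move=> r0 dens; have nm := blowup_nice x r0 nmu.
have Ccut : Cc (@cutoff R d 0 1) := cutoff_Cc 0 ltr01.
apply: le_trans (measure_le_Rintegral (measurable_eball 0 1) (nice_lty nm _ _)
  (Cc_Rintegrable nm Ccut) (@cutoff_ge0 _ _ _ _) _); last first.
  by rewrite /eball/= => y /ltW y1; rewrite cutoff1.
rewrite -lee_fin fineK ?ge0_fin_numE ?(nice_lty nm)// blowup_measure_eball// scaler0 addr0 mulr1.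
apply: le_trans (lee_wpmul2l _ dens); last by rewrite lee_fin powR_ge0.
by rewrite -EFinM lee_fin mulrCA powR_mulNl// mulr1.
Qed.

Lemma tangent_mass_ge (c : R) (U : set_system nat) (x : V) (r_ : nat -> R)
    (nu : bmeasure R d) : ProperFilter U -> (forall j, 0 < r_ j) ->
  (forall j, ((c * r_ j `^ s)%:E <= mu (eball x (r_ j)))%E) ->
  weak_cvg U (fun j => blowup_measure s mu x (r_ j)) nu -> c <= \int[nu]_y cutoff 0 1 y.
Proof.
move=> FU r0 dens cvg_nu; have cv := cvg_nu _ (@cutoff_Cc R d 0 _ ltr01).
rewrite -(cvg_lim _ cv)//; apply: limr_ge; first exact: cvgP cv.
by apply: nearW => j; exact: blowup_mass_ge.
Qed.

End tangent_mass.

Section reflectionless_tangent.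
Context (R : realType) (d : nat).
Local Notation V := 'rV[R]_d.
Variables (s Lam : R) (mu : bmeasure R d).
Hypothesis nmu : nice s Lam mu.

Variables (d' : nat) (alpha Lg : R) (Om : V -> 'rV[R[i]]_d').
Hypotheses (a01 : 0 < alpha <= 1) (OmP : CZ_Omega alpha Om) (s0 : 0 < s).
Hypotheses (d'0 : (0 < d')%N) (Lg0 : 0 < Lg) (gmu : good s Om Lg mu).

Lemma ae_vanishing_density (chi : V -> R) : Cc chi -> (hausdorff s (msupp mu) < +oo)%E ->
  {ae mu, forall x, positive_upper_density mu s x /\
    forall p, vanishing_point s (Om_part Om p) mu chi x}.
Proof.
move=> Cchi hmu; have ae_filter := ae_filter_ringOfSetsType mu.
apply: (filterI (ae_positive_upper_density s0 nmu hmu)).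
apply: (@filter_forall _ _ _ _ ae_filter) => p.
exact: (ae_vanishing_point s0 (CZ_profile_Om_part a01 OmP p) nmu
  (good_CZ_bounded_Cc a01 OmP s0 nmu p gmu) Cchi).
Qed.

Lemma reflectionless_tangent (x : V) (K : R) : enorm x < K -> positive_upper_density mu s x ->
  (forall p, vanishing_point s (Om_part Om p) mu (cutoff 0 (K + 1)) x) ->
  exists nu : bmeasure R d, reflectionless s Om nu /\ ~ is_zero_measure nu.
Proof.
move=> xK [c c0 dens] van; have omP := CZ_profile_Om_part a01 OmP.
have /choice[r_ r_P] j : exists r, [/\ 0 < r, r < j.+1%:R^-1 &
    ((c * r `^ s)%:E < mu (eball x r))%E] by apply: dens; rewrite invr_gt0.
have r0 j : 0 < r_ j by case: (r_P j).
have [U [UF ooU]] := ultraFilterLemma (F := \oo) _.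
have FU : ProperFilter U by exact: ultra_proper.
have r_cvg0 : r_ @ U --> (0 : R).
  apply: cvg_trans (_ : r_ @ \oo --> (0 : R)); first exact: cvg_app ooU.
  apply: (squeeze_cvgr _ (cvg_cst 0) cvg_harmonic); apply: nearW => j.
  by have [rj0 rj _] := r_P j; rewrite (ltW rj0) (ltW rj).
have nm j := blowup_nice x (r0 j) nmu.
have [nu [nnu cvg_nu]] := weak_limit_exists UF nm.
have nu_mass : 0 < \int[nu]_y cutoff 0 1 y.
  apply: (lt_le_trans c0); apply: (tangent_mass_ge nmu FU r0 _ cvg_nu) => j.
  by have [_ _ /ltW] := r_P j.
exists nu; split; last exact: (cutoff_integral_gt0_neq0 nnu nu_mass).
apply: (pairing_decays_reflectionless a01 OmP s0 nnu d'0 Lg0) => [p|p psi L Cpsi psiL psi0].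
  apply: (weak_limit_bounded s0 (omP p) FU nm nnu cvg_nu) => j.
  apply: (CZ_bounded_Cc_blowup x (r0 j) nmu s0 (omP p)).
  exact: (good_CZ_bounded_Cc a01 OmP s0 nmu p gmu).
exact: (tangent_pairing_decays s0 (omP p) nmu xK (van p) FU r0 r_cvg0 nnu cvg_nu nu_mass
  psi0 Cpsi psiL).
Qed.

End reflectionless_tangent.

Theorem theorem1p1 (R : realType) (d d' : nat) (s alpha : R)
  (Om : 'rV[R]_d -> 'rV[R[i]]_d') :
  (2 <= d)%N -> (1 <= d')%N -> 0 < s -> s < d%:R -> 0 < alpha -> alpha <= 1 ->
  CZ_Omega alpha Om ->
  (forall nu : bmeasure R d, reflectionless s Om nu -> is_zero_measure nu) ->
  forall mu : bmeasure R d,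
    (exists2 Lam : R, 0 < Lam & nice s Lam mu) ->
    (hausdorff s (msupp mu) < +oo)%E ->
    (exists2 Lam : R, 0 < Lam & good s Om Lam mu) ->
    is_zero_measure mu.
Proof.
move=> _ d'0 s0 _ a0 a1 OmP noref mu [Lam _ nmu] hmu [Lg Lg0 gmu].
have a01 : 0 < alpha <= 1 by rewrite a0.
apply: contrapT => /nonzero_eball[n mun].
have Cchi : Cc (@cutoff R d 0 (n.+1%:R + 1)) by apply: cutoff_Cc; rewrite addr_gt0.
have [x] := ae_exists (measurable_eball 0 n.+1%:R) mun
  (ae_vanishing_density nmu a01 OmP s0 gmu Cchi hmu).
rewrite /eball/= subr0 => xn [dens van].
have [nu [nu_ref nu_neq0]] :=
  reflectionless_tangent nmu a01 OmP s0 d'0 Lg0 gmu xn dens van.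
exact/nu_neq0/noref.
Qed.
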